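(* Let $0<R_0<R$, let $(M,N)\in\mathbb{N}_0\times\mathbb{N}$, and let $\Delta k>0$ be the number defined in the context (determined by $R_0$, $M$, $N$). Let $Q_r=\{\tilde k_{m,n}\}_{m=0,n=1}^{M,N}$ be a family of not necessarily distinct positive frequencies, and let $K$ be the matrix built from $Q_r$ as in the context. If $$|\tilde k_{m,i}-k_{m,i}|<\Delta k\qquad\text{for all } 0\le m\le M,\ 1\le i\le N,$$ where $k_{m,i}=j_{m,i}/R_0$, then the matrix $K$ is invertible, and any $s\in S_{M,N}$ is uniquely recoverable from the measurements at the frequencies in $Q_r$; that is, if $s,s'\in S_{M,N}$ satisfy $F_{\tilde k}s=F_{\tilde k}s'$ for all $\tilde k\in Q_r$, then $s=s'$.
   Context: Notation: $\mathbb{N}=\{1,2,\dots\}$, $\mathbb{N}_0=\mathbb{N}\cup\{0\}$. $J_m$ is the Bessel function of the first kind of order $m$. For $m\in\mathbb{N}_0$, $n\in\mathbb{N}$, $j_{m,n}$ is the $n$-th positive zero of $J_m$, and $k_{m,n}=j_{m,n}/R_0$; also $k_{m,0}:=0$. For negative order, $j_{-m,n}:=j_{m,n}$ and $k_{-m,n}:=k_{m,n}$. Domains and forward operator: $D_0,D\subset\mathbb{R}^2$ are the concentric open discs centered at the origin of radii $R_0<R$. For a frequency $k>0$, $F_k:L^2(D_0)\to L^2(\partial D)$ is $s\mapsto u_k|_{\partial D}$, where $u_k(x)=\int_{D_0}G_k(x,y)s(y)\,dy$, $G_k(x,y)=-\frac{i}{4}H_0^{(1)}(k|x-y|)$, with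 $H_0^{(1)}$ the Hankel function of the first kind and order $0$ ($u_k$ is the outgoing solution of $(\Delta+k^2)u_k=s$ in $\mathbb{R}^2$, with $s$ extended by zero). $F_ks$ is the measurement at frequency $k$. Fourier-Bessel basis: in polar coordinates, for $m\in\mathbb{Z}$, $n\in\mathbb{N}$, $$\varphi_{m,n}(r,\theta)=\Big(\sqrt{\pi J_{m+1}^2(j_{m,n})}\,R_0\Big)^{-1}e^{im\theta}J_m(k_{m,n}r),$$ which form an orthonormal basis of $L^2(D_0)$ with $(f,g)_{L^2(D_0)}=\int_{D_0}f\overline g$. The source space is $S_{M,N}=\mathrm{span}\{\varphi_{m,n}: m=-M,\dots,M,\ n=1,\dots,N\}$. Singular vectors: for $k>0$ and $n\in\mathbb{Z}$, $$\psi_n^k(r,\theta)=(\sqrt{\pi}R_0A_n(kR_0))^{-1}J_n(kr)e^{in\theta},\qquad A_n(t)=\sqrt{J_n^2(t)-J_{n-1}(t)J_{n+1}(t)}.$$ Matrix $K$: $K\in\mathbb{R}^{(2M+1)N\times(2M+1)N}$ is the block-diagonal matrix with diagonal blocks $K_1^+,\dots,K_M^+,K^0,K_1^-,\dots,K_M^-$, each of size $N\times N$, with entries (row $i$, column $n$, $1\le i,n\le N$) $$(K_m^{+})_{i,n}=(\varphi_{m,n},\psi_{m}^{\tilde k_{m,i}})_{L^2(D_0)},\quad (K_m^{-})_{i,n}=(\varphi_{-m,n},\psi_{-m}^{\tilde k_{m,i}})_{L^2(D_0)}\ (1\le m\le M),\quad (K^0)_{i,n}=(\varphi_{0,n},\psi_0^{\tilde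 k_{0,i}})_{L^2(D_0)}.$$ The number $\Delta k$: let $\mu_m=R_0/\pi$ for $m\ge1$ and $\mu_0=R_0/(j_{0,2}-j_{0,1})$; let $\chi_{j,i}=1$ if $i\ne j$ and $\chi_{i,i}=0$. For $0\le m\le M$, $1\le i\le N$, let $\Delta k_{m,i}$ be the largest positive number such that for every $\delta\in(0,\Delta k_{m,i})$ and for both choices of sign, with $x=k_{m,i}\pm\delta$, one has $x\in(k_{m,i-1},k_{m,i+1})$ and $$\left|\frac{k_{m,i}}{x^2-k_{m,i}^2}\right|\ge\chi_{1,i}\left(\frac{\mu_m}{2}\log\frac{x^2-k_{m,1}^2}{x^2-k_{m,i-1}^2}+\frac{k_{m,i-1}}{x^2-k_{m,i-1}^2}\right)+\chi_{N,i}\left(\frac{\mu_m}{2}\log\frac{k_{m,N}^2-x^2}{k_{m,i+1}^2-x^2}+\frac{k_{m,i+1}}{k_{m,i+1}^2-x^2}\right),$$ where a term whose factor $\chi$ is $0$ is omitted. Such a number exists. Then $\Delta k=\min_{0\le m\le M,\,1\le i\le N}\Delta k_{m,i}$. *)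

(* Defs.v *)
From HB Require Import structures.
From mathcomp Require Import all_boot all_order all_algebra.
From mathcomp Require Import complex.
From mathcomp Require Import ring.
From mathcomp Require Import all_classical all_reals all_analysis.

Set Implicit Arguments.
Unset Strict Implicit.
Unset Printing Implicit Defensive.

Import Order.TTheory GRing.Theory Num.Theory.
Import numFieldNormedType.Exports.

Local Open Scope classical_set_scope.
Local Open Scope ring_scope.
Local Open Scope complex_scope.

Section BesselFunctions.
Context {R : realType}.
Implicit Types (x : R).

(* J_n(x) = sum_l (-1)^l / (l! (l+n)!) (x/2)^(2l+n) *)
Definition besselJ_nat (n : nat) (x : R) : R :=
  limn (series (fun l =>
    (-1) ^+ l / (l`!%:R * (l + n)`!%:R) * (x / 2) ^+ (2 * l + n))).

(* J_(-n) = (-1)^n J_n *)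
Definition besselJ (m : int) (x : R) : R :=
  match m with
  | Posz n => besselJ_nat n x
  | Negz n => (-1) ^+ n.+1 * besselJ_nat n.+1 x
  end.

Definition euler_gamma : R := limn (fun n => series harmonic n - ln n%:R).

(* Y_0(x) = (2/pi) (ln(x/2) + gamma) J_0(x)
            - (2/pi) sum_l (-1)^l H_l / (l!)^2 (x/2)^(2l)
   for x > 0, where the l-th partial sum [series harmonic l] is the harmonic
   number H_l = 1 + 1/2 + ... + 1/l. *)
Definition besselY0 (x : R) : R :=
  2 / pi * (ln (x / 2) + euler_gamma) * besselJ 0 x
  - 2 / pi * limn (series (fun l =>
      (-1) ^+ l * series harmonic l / (l`!%:R ^+ 2) * (x / 2) ^+ (2 * l))).

Definition hankel1_0 (x : R) : R[i] := besselJ 0 x +i* besselY0 x.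

(* j_{m,n} for n >= 1, with j_{-m,n} = j_{m,n} and j_{m,0} = 0. The positive
   zeros of J_m are isolated and unbounded, so each infimum is attained and the
   recursion enumerates them increasingly. *)
Fixpoint besselJ_zero (m : int) (n : nat) : R :=
  if n is n'.+1 then
    inf [set z | besselJ_zero m n' < z /\ besselJ `|m|%N z = 0]
  else 0.

(* k_{m,n}; in particular k_{m,0} = 0 *)
Definition wavenumber (r0 : R) (m : int) (n : nat) : R := besselJ_zero m n / r0.

End BesselFunctions.

Notation plane R := (measurableTypeR R * measurableTypeR R)%type.
Notation lebesgue2 R :=
  (@lebesgue_measure R \x @lebesgue_measure R)%E (only parsing).

Section Plane.
Context {R : realType}.

Definition euclid (x : plane R) : R :=
  Num.sqrt ((x.1 : R) ^+ 2 + (x.2 : R) ^+ 2).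

(* in `]-pi, pi]; the value at the origin is irrelevant *)
Definition angle (x : plane R) : R :=
  if 0 <= (x.2 : R) then acos (x.1 / euclid x) else - acos (x.1 / euclid x).

Definition of_polar (r t : R) : plane R := (r * cos t, r * sin t).

Definition disc (r : R) : set (plane R) := [set x | euclid x < r].

Definition expi (t : R) : R[i] := cos t +i* sin t.

Definition cintegral (D : set (plane R)) (f : plane R -> R[i]) : R[i] :=
  Rintegral (lebesgue2 R) D (fun x => complex.Re (f x))
  +i* Rintegral (lebesgue2 R) D (fun x => complex.Im (f x)).

(* Elements of L^2 spaces are represented by functions, of which only the
   values on the domain matter; equality in L^2 is equality a.e. *)
Definition inL2_disc (r : R) (f : plane R -> R[i]) : Prop :=
  [/\ measurable_fun (disc r) (fun x => complex.Re (f x)),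
      measurable_fun (disc r) (fun x => complex.Im (f x)) &
      (\int[lebesgue2 R]_(x in disc r)
         (complex.Re (f x) ^+ 2 + complex.Im (f x) ^+ 2)%:E
        < +oo)%E].

Definition eqL2_disc (r : R) (f g : plane R -> R[i]) : Prop :=
  {ae (lebesgue2 R), forall x, disc r x -> f x = g x}.

(* arc length on the circle of radius r is r times Lebesgue measure in the
   angle, so both have the same null sets *)
Definition eqL2_circle (r : R) (f g : plane R -> R[i]) : Prop :=
  {ae @lebesgue_measure R, forall t : R, 0 <= t < 2 * pi ->
    f (of_polar r t) = g (of_polar r t)}.

Definition dotL2_disc (r : R) (f g : plane R -> R[i]) : R[i] :=
  cintegral (disc r) (fun x => f x * (g x)^*%C).

End Plane.

Section SourceProblem.
Context {R : realType}.
Implicit Types (k : R).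

Definition green k (x y : plane R) : R[i] :=
  - ((0 +i* 1) / 4) * hankel1_0 (k * euclid (x.1 - y.1, x.2 - y.2)).

(* F_k s is the restriction of this function to the outer circle *)
Definition forward (r0 k : R) (s : plane R -> R[i]) (x : plane R) : R[i] :=
  cintegral (disc r0) (fun y => green k x y * s y).

Definition phi_polar (r0 : R) (m : int) (n : nat) (r t : R) : R[i] :=
  ((Num.sqrt (pi * besselJ (m + 1) (besselJ_zero m n) ^+ 2) * r0)^-1)%:C
  * expi (m%:~R * t) * (besselJ m (wavenumber r0 m n * r))%:C.

Definition phi (r0 : R) (m : int) (n : nat) (x : plane R) : R[i] :=
  phi_polar r0 m n (euclid x) (angle x).

Definition bessel_A (n : int) (t : R) : R :=
  Num.sqrt (besselJ n t ^+ 2 - besselJ (n - 1) t * besselJ (n + 1) t).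

Definition psi_polar (r0 k : R) (n : int) (r t : R) : R[i] :=
  ((Num.sqrt pi * r0 * bessel_A n (k * r0))^-1)%:C
  * (besselJ n (k * r))%:C * expi (n%:~R * t).

Definition psi (r0 k : R) (n : int) (x : plane R) : R[i] :=
  psi_polar r0 k n (euclid x) (angle x).

(* The orders -M, ..., M are the b - M for b < 2M + 1. *)
Definition source_space (r0 : R) (M N : nat) (s : plane R -> R[i]) : Prop :=
  inL2_disc r0 s /\
  exists c : 'I_(M.*2.+1) -> 'I_N -> R[i],
    eqL2_disc r0 s (fun x => \sum_(b < M.*2.+1) \sum_(n < N)
      c b n * phi r0 (b%:Z - M%:Z) n.+1 x).

(* the signed order of the b-th diagonal block: 1, ..., M, 0, -1, ..., -M *)
Definition block_order (M b : nat) : int :=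
  if (b < M)%N then b.+1%:Z else M%:Z - b%:Z.

(* The entries are real by [dot_phi_psi_real] below; rows and columns are
   numbered from 0, hence the successors. *)
Definition Kblock (r0 : R) (N : nat) (kt : nat -> nat -> R) (m : int) :
    'M[R]_N :=
  \matrix_(i < N, n < N)
    complex.Re (dotL2_disc r0 (phi r0 m n.+1) (psi r0 (kt `|m|%N i.+1) m)).

Definition Kmatrix (r0 : R) (M N : nat) (kt : nat -> nat -> R) :
    'M[R]_(\sum_(b < M.*2.+1) N) :=
  \mxdiag_(b < M.*2.+1) Kblock r0 N kt (block_order M b).

Lemma dot_phi_psi_real (r0 : R) (m : int) (n : nat) k :
  complex.Im (dotL2_disc r0 (phi r0 m n) (psi r0 k m)) = 0.
Proof.
rewrite /dotL2_disc /cintegral [LHS]/=.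
rewrite /Rintegral integral0_eq // => x _; congr (_%:E).
rewrite /phi /psi /phi_polar /psi_polar /expi /=.
set c := cos _; set d := sin _; ring.
Qed.

End SourceProblem.

Section DeltaK.
Context {R : realType}.
Implicit Types (x d : R).

Definition gap_coef (r0 : R) (m : nat) : R :=
  if m == 0%N then r0 / (besselJ_zero 0 2 - besselJ_zero 0 1) else r0 / pi.

Definition perturbation_bound (r0 : R) (N m i : nat) x : Prop :=
  let k := wavenumber r0 m in
  `| k i / (x ^+ 2 - k i ^+ 2) | >=
    (if i == 1%N then 0 else
       gap_coef r0 m / 2 * ln ((x ^+ 2 - k 1%N ^+ 2) / (x ^+ 2 - k i.-1 ^+ 2))
       + k i.-1 / (x ^+ 2 - k i.-1 ^+ 2))
    + (if i == N then 0 else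
       gap_coef r0 m / 2 * ln ((k N ^+ 2 - x ^+ 2) / (k i.+1 ^+ 2 - x ^+ 2))
       + k i.+1 / (k i.+1 ^+ 2 - x ^+ 2)).

Definition admissible_radius (r0 : R) (N m i : nat) : set R :=
  [set d | 0 < d /\
    forall e x, 0 < e < d ->
      x = wavenumber r0 m i + e \/ x = wavenumber r0 m i - e ->
      wavenumber r0 m i.-1 < x < wavenumber r0 m i.+1 /\
      perturbation_bound r0 N m i x].

(* the largest element; [xget] returns 0 only if there is none *)
Definition Delta_k_at (r0 : R) (N m i : nat) : R :=
  xget 0 (admissible_radius r0 N m i `&` ubound (admissible_radius r0 N m i)).

(* The index (0, 1) giving the default value lies in the range since N >= 1. *)
Definition Delta_k (r0 : R) (M N : nat) : R :=
  \big[Num.min/Delta_k_at r0 N 0 1]_(m < M.+1)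
    \big[Num.min/Delta_k_at r0 N 0 1]_(i < N) Delta_k_at r0 N m i.+1.

End DeltaK.

(* Main.v *)
Require Import Defs.
From HB Require Import structures.
From mathcomp Require Import all_boot all_order all_algebra.
From mathcomp Require Import complex ring lra.
From mathcomp Require Import all_classical all_reals all_analysis.
From mathcomp Require Import measurable_realfun.

(** Separation of variables. On the angular order m every object is radial: the
    field radiated by phi_(m,n) is an outgoing wave of order m, and its amplitude
    on the outer circle is a multiple of (phi_(m,n), psi_m^k). The multiple
    vanishes for no frequency k > 0, because J_m and Y_m have no common zero.
    Hence the measurements at the frequencies of Q_r determine, order by order,
    the product of a diagonal block of K with the vector of coefficients of the
    source, and recovery follows from the invertibility of the blocks.

    Invertibility is diagonal dominance. By Lommel's integral, and since J_m
    vanishes at the wavenumbers, the entry of a block in row i and column n is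
    k_n / (x^2 - k_n^2) up to factors that depend on the row or on the column
    only (dot_cauchy), x being the frequency of row i; these factors are nonzero
    unless x = k_i. The off-diagonal sum over n is compared with logarithms,
    term by term, through a lower bound of the gaps between wavenumbers: by
    Sturm comparison consecutive zeros of J_m are at least pi apart for m >= 1
    (besselJ_gap_pi), and the gaps of J_0 increase (besselJ0_gap_monotone). The
    inequality that defines Delta_k then says that the diagonal entry is at
    least as large as this sum when x is at a distance slightly larger than the
    actual one; moving x back towards k_i makes the inequality strict
    (cauchy_row_strict). When x = k_i the row is diagonal by orthogonality. The
    definition of Delta_k also forces the wavenumbers involved to increase
    strictly, so that the recursively defined zeros are zeros of J_m.

    The statement on the radiated field is Graf's addition formula, integrated
    over the disc (graf_disc, forward_phi). All Bessel functions are written as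
    (x/2)^m F_m(x^2/4), where F_m' = - F_(m+1) and F satisfies a three-term
    recurrence (cylinder). The Fourier coefficients of a cylindrical wave on
    circles of radius r around a point other than its centre satisfy ordinary
    differential equations in r, which come from the raising and lowering
    relations; the coefficient of order 0 is identified by an energy estimate and
    the others by the lowering relation (mode_coefE). Integrals over the disc are
    averaged over rotations, under which the plane measure is invariant
    (disc_average); radial integrals are computed by the divergence theorem on
    chords (radial_integral).

    Finally, equality almost everywhere on the circle separates the angular
    orders, because a nonzero polynomial in e^(it) has finitely many zeros
    (trig_polynomial_eq0). *)

Set Implicit Arguments.
Unset Strict Implicit.
Unset Printing Implicit Defensive.

Import Order.TTheory GRing.Theory Num.Theory.
Import numFieldNormedType.Exports.

Local Open Scope classical_set_scope.
Local Open Scope ring_scope.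

(** * Power series of Bessel type *)

Section BesselSeries.
Context {R : realType}.
Implicit Types (a : nat -> R) (u x : R).

Definition bseries_coef a m (l : nat) : R := (-1) ^+ l / l`!%:R * a (l + m)%N.

(** The series sum_l (-1)^l a_(l+m) u^l / l!, a shape that differentiation
    preserves by shifting m. Bessel functions of integer order, and the
    non-logarithmic part of Y_0, are of this form in u = x^2/4. *)
Definition bseries a m u : R := limn (pseries (bseries_coef a m) u).

Lemma is_cvg_bseries a m u : (forall n, `|a n| <= 1) ->
  cvgn (pseries (bseries_coef a m) u).
Proof.
move=> a1; apply: normed_cvg => /=.
apply: (@series_le_cvg _ _ (fun l => exp_coeff `|u| l)) => //= [l|l|].
- by rewrite exp_coeffE mulr_ge0// exprn_ge0.
- rewrite /bseries_coef exp_coeffE !normrM normrX normrN1 expr1n mul1r normfV.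
  rewrite normr_nat normrX ler_wpM2r ?exprn_ge0//.
  by rewrite ler_piMr ?invr_ge0.
- exact: is_cvg_series_exp_coeff.
Qed.

Lemma bseries_diffs a m :
  pseries_diffs (bseries_coef a m) = - bseries_coef a m.+1.
Proof.
apply/funext => l; rewrite /pseries_diffs /bseries_coef fctE.
rewrite factS natrM exprS addSnnS.
by field; rewrite ?nat1r ?natr1 !pnatr_eq0 -lt0n fact_gt0.
Qed.

Lemma pseriesN (c : nat -> R) u : pseries (- c) u = - pseries c u.
Proof.
apply/funext => n; transitivity (- \sum_(0 <= i < n) c i * u ^+ i) => //.
rewrite -sumrN /pseries /series /=.
by apply: eq_bigr => i _; rewrite fctE mulNr.
Qed.

Lemma is_derive_bseries a m u : (forall n, `|a n| <= 1) ->
  is_derive u 1 (bseries a m) (- bseries a m.+1 u).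
Proof.
move=> a1; rewrite /bseries -limN; last exact: is_cvg_bseries.
rewrite -pseriesN -bseries_diffs.
apply: (@pseries_snd_diffs _ _ (`|u| + 1)) => //.
- exact: is_cvg_bseries.
- rewrite bseries_diffs pseriesN; apply: is_cvgN; exact: is_cvg_bseries.
- rewrite bseries_diffs pseries_diffsN pseriesN; apply: is_cvgN.
  rewrite bseries_diffs pseriesN; apply: is_cvgN; exact: is_cvg_bseries.
- by rewrite [ltRHS]ger0_norm ?addr_ge0// ltrDl.
Qed.

Lemma bseries0 a m : (forall n, `|a n| <= 1) -> bseries a m 0 = a m.
Proof.
move=> a1; apply/cvg_lim => //; rewrite -cvg_shiftS.
rewrite (_ : (fun _ => _) = cst (a m)); first exact: cvg_cst.
apply/funext => n; rewrite /pseries /series /= big_nat_recl//= big1.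
  by rewrite /bseries_coef expr0 fact0 invr1 !mul1r mulr1 addr0.
by move=> i _; rewrite expr0n mulr0.
Qed.

(** Coefficientwise the three-term combination is again a series of this shape;
    its new coefficients a_n - (n+1) a_(n+1) vanish for a_n = 1/n!. *)
Lemma bseries_three_term a m u : (forall n, `|a n| <= 1) ->
  bseries a m u - m.+1%:R * bseries a m.+1 u + u * bseries a m.+2 u =
  bseries (fun n => a n - n.+1%:R * a n.+1) m u.
Proof.
move=> a1; apply/esym/cvg_lim => //; rewrite -cvg_shiftS.
pose S k n := pseries (bseries_coef a k) u n.
rewrite (_ : (fun _ => _) =
    (fun n => S m n.+1 - m.+1%:R * S m.+1 n.+1 + u * S m.+2 n)).
  have cS k : S k n @[n --> \oo] --> bseries a k u by exact: is_cvg_bseries.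
  have cS' k : S k n.+1 @[n --> \oo] --> bseries a k u.
    by rewrite cvg_shiftS; exact: cS.
  apply: cvgD; last by apply: cvgMr.
  by apply: cvgB => //; apply: cvgMr.
apply/funext => n; rewrite /S /pseries /series /=.
rewrite mulr_sumr -sumrB !big_nat_recl//= mulr_sumr -addrA -big_split/=.
congr (_ + _).
  by rewrite /bseries_coef !expr0 !fact0 !add0n; field.
apply: eq_bigr => i _; rewrite /bseries_coef !addSn !addnS factS natrM !exprS.
rewrite -!natr1 natrD.
by field; rewrite ?nat1r ?natr1 !pnatr_eq0 -lt0n fact_gt0.
Qed.

End BesselSeries.

(** * Bessel functions stripped of powers, their Wronskian and Lommel integrals *)

Section RealDerivatives.
Context {R : realType}.
Implicit Types (f df : R -> R) (a b x : R).

Lemma is_derive_continuous f x d : is_derive x 1 f d -> {for x, continuous f}.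
Proof. by case=> /derivable1_diffP/differentiable_continuous. Qed.

Lemma is_derive_gt0_lt f df a b : a < b ->
  (forall x, x \in `]a, b[ -> is_derive x 1 f (df x)) ->
  (forall x, x \in `]a, b[ -> 0 < df x) ->
  {within `[a, b], continuous f} -> f a < f b.
Proof.
move=> ab dfx df0 cf; have [c cab E] := MVT ab dfx cf.
by rewrite -subr_gt0 E mulr_gt0 ?df0// subr_gt0.
Qed.

Lemma is_derive_ge0_le f df a b : a <= b ->
  (forall x, x \in `]a, b[ -> is_derive x 1 f (df x)) ->
  (forall x, x \in `]a, b[ -> 0 <= df x) ->
  {within `[a, b], continuous f} -> f a <= f b.
Proof.
rewrite le_eqVlt => /predU1P[-> //|ab] dfx df0 cf.
have [c cab E] := MVT ab dfx cf.
by rewrite -subr_ge0 E mulr_ge0 ?df0// subr_ge0 ltW.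
Qed.

End RealDerivatives.

Section BesselFamilies.
Context {R : realType}.
Implicit Types (u x : R) (F G : nat -> R -> R).

(** The functions u^(j/2) F_j(u), with u = x^2/4, are cylinder functions of order
    j: these are their differentiation and recurrence formulas freed from powers
    of x. The addition formula of Graf follows from these two alone, so that it
    holds for J and for Y by one proof. *)
Definition cylinder F := forall j u, 0 < u ->
  is_derive u 1 (F j) (- F j.+1 u) /\
  u * F j.+2 u = j.+1%:R * F j.+1 u - F j u.

(** The entire function with J_m(x) = (x/2)^m E_m(x^2/4). *)
Definition besselE m : R -> R := bseries (fun n => n`!%:R^-1) m.

Lemma besselE_coef_le1 n : `|n`!%:R^-1| <= 1 :> R.
Proof. by rewrite normfV normr_nat invf_le1 ?ler1n ?ltr0n fact_gt0. Qed.

Lemma is_derive_besselE m u : is_derive u 1 (besselE m) (- besselE m.+1 u).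
Proof. by apply: is_derive_bseries => n; exact: besselE_coef_le1. Qed.

Lemma besselE_three_term m u :
  u * besselE m.+2 u = m.+1%:R * besselE m.+1 u - besselE m u.
Proof.
have := @bseries_three_term R _ m u besselE_coef_le1.
rewrite [RHS](_ : _ = 0) /besselE => [|]; last first.
  apply/cvg_lim => //; rewrite (_ : pseries _ _ = cst 0); first exact: cvg_cst.
  apply/funext => n; rewrite /pseries /series /= big1// => i _.
  rewrite /bseries_coef factS natrM invfM mulVKf ?pnatr_eq0//.
  by rewrite subrr mulr0 mul0r.
by move=> ?; lra.
Qed.

Lemma cylinder_besselE : cylinder besselE.
Proof.
by move=> j u _; split; [exact: is_derive_besselE|exact: besselE_three_term].
Qed.

Lemma besselE0 m : besselE m 0 = m`!%:R^-1.
Proof. by rewrite /besselE bseries0// => n; exact: besselE_coef_le1. Qed.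

Lemma besselJ_natE m x : besselJ_nat m x = (x / 2) ^+ m * besselE m ((x / 2) ^+ 2).
Proof.
have cE : cvgn (pseries (bseries_coef (fun n => n`!%:R^-1 : R) m) ((x / 2) ^+ 2)).
  by apply: is_cvg_bseries => n; exact: besselE_coef_le1.
apply/cvg_lim => //.
rewrite (_ : series _ = (x / 2) ^+ m \*o
   pseries (bseries_coef (fun n => n`!%:R^-1 : R) m) ((x / 2) ^+ 2)).
  exact: cvgMr.
apply/funext => n; rewrite /pseries /series /= mulr_sumr.
by apply: eq_bigr => l _; rewrite /bseries_coef exprD exprM invfM; ring.
Qed.

(** Substituting the recurrence into u times the cross product of order m + 1
    gives the cross product of order m. *)
Lemma cylinder_wronskian F G m u : cylinder F -> cylinder G -> 0 < u ->
  u ^+ m * (F m.+1 u * G m u - F m u * G m.+1 u) = F 1%N u * G 0%N u - F 0%N u * G 1%N u.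
Proof.
move=> cF cG u0; elim: m => [|m <-]; first by rewrite mul1r.
have [_ HF] := cF m u u0; have [_ HG] := cG m u u0.
rewrite exprSr -!mulrA mulrBr !mulrA HF -(mulrA _ _ (G _ u)) (mulrC (F m.+1 u)).
rewrite (mulrA u) HG; congr (_ * _); ring.
Qed.

(** The non-logarithmic part of Y_0, whose coefficients carry the harmonic
    numbers H_n. *)
Definition besselS m : R -> R := bseries (fun n => series harmonic n / n`!%:R) m.

Lemma besselS_coef_le1 n : `|series harmonic n / n`!%:R| <= 1 :> R.
Proof.
rewrite ger0_norm; last first.
  rewrite divr_ge0// sumr_ge0// => i _; rewrite /harmonic /= invr_ge0.
  exact: ler0n.
rewrite ler_pdivrMr ?ltr0n ?fact_gt0// mul1r.
apply: (@le_trans _ _ n%:R); last by rewrite ler_nat fact_geq.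
rewrite /series /= -[leRHS]mulr1 mulr_natl -[in leRHS](subn0 n) -sumr_const_nat.
apply: ler_sum => i _.
by rewrite /harmonic /= invf_le1 ?ler1n ?ltr0n.
Qed.

Lemma is_derive_besselS m u : is_derive u 1 (besselS m) (- besselS m.+1 u).
Proof. by apply: is_derive_bseries => n; exact: besselS_coef_le1. Qed.

(** The defect a_n - (n+1) a_(n+1) of the coefficients a_n = H_n / n! is
    - 1/(n+1)!, which is where the term E_1 comes from. *)
Lemma besselS_three_term u :
  u * besselS 2 u = besselS 1 u - besselS 0 u - besselE 1 u.
Proof.
have := @bseries_three_term R _ 0 u besselS_coef_le1.
rewrite [RHS](_ : _ = - besselE 1 u) /besselS => [|]; last first.
  rewrite /besselE /bseries -limN; last first.
    by apply: is_cvg_bseries => n; exact: besselE_coef_le1.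
  congr (limn _); rewrite -pseriesN; congr (pseries _ _).
  apply/funext => n; rewrite fctE /bseries_coef addn0 addn1.
  rewrite /series /= big_nat_recr//= /harmonic factS natrM.
  by field; rewrite ?nat1r ?natr1 !pnatr_eq0 -lt0n fact_gt0.
by move=> ?; lra.
Qed.

Lemma is_derive_inv u : u != 0 -> is_derive u 1 (fun x : R => x^-1) (- u ^- 2).
Proof.
move=> u0; have := is_deriveV u0 (is_derive_id u 1).
by rewrite /GRing.scale /= mulr1.
Qed.

(** Y_0 as a function of u = x^2/4, so that ln (x/2) = (ln u) / 2. *)
Definition besselY_zero u : R :=
  (ln u + 2 * euler_gamma) / pi * besselE 0 u - 2 / pi * besselS 0 u.
(** The function - Y_0' in the variable u, written out. *)
Definition besselY_one u : R :=
  (ln u + 2 * euler_gamma) / pi * besselE 1 u - (u^-1 / pi) * besselE 0 u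
  - 2 / pi * besselS 1 u.

(** Y_m(x) = (x/2)^m besselY m (x^2/4): upward recurrence from the orders 0 and 1. *)
Fixpoint besselY m u : R :=
  if m is m'.+1 then
    if m' is i.+1 then (m'%:R * besselY m' u - besselY i u) / u
    else besselY_one u
  else besselY_zero u.

Lemma besselY_three_term m u : 0 < u ->
  u * besselY m.+2 u = m.+1%:R * besselY m.+1 u - besselY m u.
Proof. by move=> u0; rewrite [besselY m.+2 u]/= mulrC divfK// gt_eqF. Qed.

Lemma is_derive_besselY0 u : 0 < u ->
  is_derive u 1 (besselY 0) (- besselY 1 u).
Proof.
move=> u0; have dE := is_derive_besselE 0 u; have dS := is_derive_besselS 0 u.
have dl := is_derive1_ln u0.
rewrite /= /besselY_zero; apply: is_derive_eq.
rewrite /besselY_one /GRing.scale /= ?fctE. move: pi (lt0r_neq0 (pi_gt0 R)) => p p0; field.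
by rewrite p0 gt_eqF.
Qed.

Lemma is_derive_besselY1 u : 0 < u ->
  is_derive u 1 (besselY 1) (- besselY 2 u).
Proof.
move=> u0; have dE := is_derive_besselE 0 u; have dS := is_derive_besselS 1 u.
have dE1 := is_derive_besselE 1 u.
have dl := is_derive1_ln u0; have u'0 : u != 0 by rewrite gt_eqF.
have dV := is_derive_inv u'0.
have H1 := besselS_three_term u; have H2 := besselE_three_term 0 u.
rewrite /= /besselY_one; apply: is_derive_eq.
rewrite /besselY_one /GRing.scale /= ?fctE.
have -> : besselE 2 u = (besselE 1 u - besselE 0 u) / u.
  by apply: (mulfI u'0); rewrite H2 mulrCA divff// mulr1 ?mul1r.
have -> : besselS 2 u = (besselS 1 u - besselS 0 u - besselE 1 u) / u.
  by apply: (mulfI u'0); rewrite H1 mulrCA divff// mulr1.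
rewrite /besselY_zero; move: pi (lt0r_neq0 (pi_gt0 R)) => p p0; field.
by rewrite p0 gt_eqF.
Qed.

(** Differentiating the recurrence that produces one order yields minus the
    recurrence that produces the next one, so that the rule F_j' = - F_(j+1)
    climbs with the recurrence. *)
Lemma is_derive_three_term (f g : R -> R) (c h u : R) : u != 0 ->
  is_derive u 1 f (- g u) -> is_derive u 1 g (- h) -> u * h = c * g u - f u ->
  is_derive u 1 (fun x => (c * g x - f x) / x) (- (((c + 1) * h - g u) / u)).
Proof.
move=> u0 df dg uh; have dV := is_derive_inv u0.
apply: is_derive_eq.
have -> : f u = c * g u - u * h by rewrite uh opprB addrCA subrr addr0.
by rewrite /GRing.scale /= ?fctE; field.
Qed.

Lemma cylinder_besselY : cylinder besselY.
Proof.
move=> j u u0; split; last exact: besselY_three_term.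
suff [] : is_derive u 1 (besselY j) (- besselY j.+1 u) /\
  is_derive u 1 (besselY j.+1) (- besselY j.+2 u) by [].
elim: j => [|j [IH1 IH2]].
  by split; [exact: is_derive_besselY0|exact: is_derive_besselY1].
split; first exact: IH2.
have u'0 : u != 0 by rewrite gt_eqF.
have := is_derive_three_term u'0 IH1 IH2 (besselY_three_term j u0).
by rewrite natr1.
Qed.

(** The Wronskian is constant, and its value is read off at u = 0: multiplied by
    u it becomes the entire function W below, in which the logarithms have
    cancelled and only the derivative of ln contributes at 0. *)
Lemma wronskian_besselEY u : 0 < u ->
  u * (besselE 1 u * besselY 0 u - besselE 0 u * besselY 1 u) = pi^-1.
Proof.
move=> u0; have u'0 : u != 0 by rewrite gt_eqF.
(* W is constant by the two three-term relations. *)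
pose W x : R := pi^-1 * besselE 0 x ^+ 2
  + 2 / pi * (x * (besselE 0 x * besselS 1 x - besselE 1 x * besselS 0 x)).
transitivity (W u).
  rewrite /W /= /besselY_zero /besselY_one;
  by move: pi (lt0r_neq0 (pi_gt0 R)) => p p0; field; rewrite p0 gt_eqF.
transitivity (W 0); last first.
  by rewrite /W mul0r mulr0 addr0 besselE0 fact0 invr1 expr1n mulr1.
apply: is_derive_0_is_cst => x; rewrite /W.
have dE0 := is_derive_besselE 0 x; have dS0 := is_derive_besselS 0 x.
have dE1 := is_derive_besselE 1 x; have dS1 := is_derive_besselS 1 x.
have H1 := besselS_three_term x; have H2 := besselE_three_term 0 x.
apply: is_derive_eq; rewrite /GRing.scale /= ?fctE.
apply: (@etrans _ _ (2 / pi * (- besselE 0 x * besselE 1 x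
   + (besselE 0 x * besselS 1 x - besselE 1 x * besselS 0 x)
   + (- besselE 0 x * (x * besselS 2 x) + (x * besselE 2 x) * besselS 0 x)))).
  ring.
by rewrite H1 H2; ring.
Qed.

(** A common zero would annihilate the Wronskian. Hence the outgoing combination
    E + i Y never vanishes, and no angular mode is silent on the outer circle. *)
Lemma besselEY_neq0 m u : 0 < u -> besselE m u = 0 -> besselY m u != 0.
Proof.
move=> u0 E0; apply/eqP => Y0.
have := cylinder_wronskian m cylinder_besselE cylinder_besselY u0.
rewrite E0 Y0 mulr0 mul0r subrr mulr0 => W0.
have := wronskian_besselEY u0; rewrite -W0 mulr0 => /eqP.
by rewrite eq_sym invr_eq0 gt_eqF ?pi_gt0.
Qed.

(** With u = x^2/4, J_m^2 - J_(m-1) J_(m+1) = u^m besselA m u. *)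
Definition besselA m u : R :=
  besselE m u ^+ 2 - m%:R * besselE m u * besselE m.+1 u
  + u * besselE m.+1 u ^+ 2.

Lemma is_derive_expr m u :
  is_derive u 1 (fun x : R => x ^+ m.+1) (m.+1%:R * u ^+ m).
Proof.
have -> : (fun x : R => x ^+ m.+1) = id ^+ m.+1 by rewrite exprfctE.
by apply: is_derive_eq; rewrite /GRing.scale /= mulr1.
Qed.

Lemma is_derive_besselA m u :
  is_derive u 1 (fun x => x ^+ m.+1 * besselA m x) (u ^+ m * besselE m u ^+ 2).
Proof.
have dE0 := is_derive_besselE m u.
have dE1 := is_derive_besselE m.+1 u.
have dX := is_derive_expr m u.
have H := besselE_three_term m u.
have dA : is_derive u 1 (besselA m) (- 2 * besselE m u * besselE m.+1 u
   + m%:R * besselE m.+1 u ^+ 2 + m%:R * besselE m u * besselE m.+2 u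
   + besselE m.+1 u ^+ 2 - 2 * besselE m.+1 u * (u * besselE m.+2 u)).
  by rewrite /besselA; apply: is_derive_eq; rewrite /GRing.scale /= ?fctE; ring.
apply: is_derive_eq; rewrite /GRing.scale /= ?fctE exprS.
rewrite -/(besselA m u) /besselA.
have -> : besselE m u = m.+1%:R * besselE m.+1 u - u * besselE m.+2 u.
  by rewrite H opprB addrCA subrr addr0.
by rewrite -natr1; ring.
Qed.

(** By the preceding derivative, u^(m+1) besselA m u is the integral from 0 to u
    of t^m E_m(t)^2, and E_m does not vanish identically near 0. *)
Lemma besselA_gt0 m u : 0 < u -> 0 < besselA m u.
Proof.
move=> u0; pose f x := x ^+ m.+1 * besselA m x.
have df x : is_derive x 1 f (x ^+ m * besselE m x ^+ 2) by exact: is_derive_besselA.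
have cf : continuous f by move=> x; exact: is_derive_continuous (df x).
suff : 0 < f u by rewrite /f pmulr_rgt0// exprn_gt0.
have mono x y : 0 <= x -> x <= y -> f x <= f y.
  move=> x0 xy;
  apply: (is_derive_ge0_le xy (fun z _ => df z)).
    move=> z; rewrite in_itv/= => /andP[xz _].
    by rewrite mulr_ge0 ?sqr_ge0// exprn_ge0// (le_trans x0)// ltW.
  exact: continuous_subspaceT.
have f0 : f 0 = 0 by rewrite /f exprS !mul0r.
rewrite lt_neqAle -f0 mono ?(ltW u0)// andbT; apply/negP => /eqP fu0.
have fx0 x : x \in `]0, u[ -> f x = 0.
  rewrite in_itv/= => /andP[/ltW x0 /ltW xu]; apply/eqP.
  have := mono 0 x (lexx _) x0; have := mono x u x0 xu.
  by rewrite -fu0 f0 eq_le => -> ->.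
have Ex0 x : x \in `]0, u[ -> besselE m x = 0.
  move=> xI; have [] := df x.
  rewrite (_ : 'D_1 f x = 0).
    move=> _ /esym/eqP; rewrite mulf_eq0 sqrf_eq0 => /orP[|/eqP//].
    by rewrite expf_eq0 => /andP[_ /eqP x0]; move: xI; rewrite x0 in_itv/= ltxx.
  rewrite (@near_eq_derive _ _ _ f (cst 0)) ?oner_eq0 ?derive_cst//.
  by near=> y; apply: fx0; near: y; exact: near_in_itvoo.
have : besselE m x @[x --> 0^'+] --> besselE m 0.
  apply: cvg_at_right_filter.
  exact: is_derive_continuous (is_derive_besselE m 0).
move=> /cvg_lim => /(_ (@Rhausdorff _)).
have -> : lim (besselE m x @[x --> 0^'+]) = 0.
  apply/cvg_lim => //; apply: cvg_near_cst; near=> x.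
  by apply: Ex0; rewrite in_itv/=; apply/andP; split=> //; near: x; exact: nbhs_right_lt.
rewrite besselE0 => /eqP; rewrite eq_sym invr_eq0 pnatr_eq0 -leqn0 leqNgt.
by rewrite fact_gt0.
Unshelve. all: by end_near.
Qed.

(** At a common zero of E_m and E_(m+1), besselA would vanish. *)
Lemma besselE_simple_zero m u : 0 < u -> besselE m u = 0 -> besselE m.+1 u != 0.
Proof.
move=> u0 E0; have := besselA_gt0 m u0; rewrite /besselA E0.
by apply: contraTneq => ->; rewrite !mulr0 expr0n subr0 mulr0 addr0 ltxx.
Qed.

Lemma is_derive_besselE_scale c n (x : R) :
  is_derive x 1 (fun x => besselE n (c * x)) (- (c * besselE n.+1 (c * x))).
Proof.
have dl : is_derive x 1 (fun x => c * x) c.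
  by apply: is_derive_eq; rewrite /GRing.scale /= mulr1.
have := @is_derive1_comp _ (besselE n) (fun x => c * x) x _ _ (is_derive_besselE n (c * x)) dl.
by move=> /is_derive_eq; apply; rewrite /GRing.scale/= mulNr mulrC.
Qed.

Lemma continuous_besselE_scale c n : continuous (fun x : R => besselE n (c * x)).
Proof. by move=> x; exact: is_derive_continuous (is_derive_besselE_scale c n x). Qed.

(** Bessel's equation in the self-adjoint form: on differentiating the
    Wronskian-like combination of the solutions for a and b everything but the
    difference of the spectral parameters cancels. This primitive makes the
    scalar product of two Bessel functions of the same order explicit. *)
Lemma is_derive_lommel m (a b u : R) :
  is_derive u 1 (fun x => x ^+ m.+1 * (a * besselE m.+1 (a * x) * besselE m (b * x)
      - b * besselE m (a * x) * besselE m.+1 (b * x)))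
    ((a - b) * (u ^+ m * besselE m (a * u) * besselE m (b * u))).
Proof.
have dE c k := is_derive_besselE_scale c k u.
have dX := is_derive_expr m u.
have dEa0 := dE a m; have dEa1 := dE a m.+1; have dEb0 := dE b m; have dEb1 := dE b m.+1.
have Ha := besselE_three_term m (a * u); have Hb := besselE_three_term m (b * u).
apply: is_derive_eq; rewrite /GRing.scale /= ?fctE exprS.
have -> : besselE m (a * u) =
    m.+1%:R * besselE m.+1 (a * u) - a * u * besselE m.+2 (a * u).
  by rewrite Ha opprB addrCA subrr addr0.
have -> : besselE m (b * u) =
    m.+1%:R * besselE m.+1 (b * u) - b * u * besselE m.+2 (b * u).
  by rewrite Hb opprB addrCA subrr addr0.
ring.
Qed.

Lemma continuous_besselE m : continuous (besselE m).
Proof. by move=> x; exact: is_derive_continuous (is_derive_besselE m x). Qed.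

Lemma besselY0E x : 0 < x -> besselY0 x = besselY 0 ((x / 2) ^+ 2).
Proof.
move=> x0; rewrite /besselY0 /= /besselY_zero lnXn ?divr_gt0// besselJ_natE expr0 mul1r.
congr (_ - _ * _).
  by move: euler_gamma (ln _) pi => g l p; ring.
congr (limn _); apply/funext => n; rewrite /pseries /series /=.
apply: eq_bigr => l _; rewrite /bseries_coef addn0 exprM expr2 invfM; ring.
Qed.

Lemma besselJE (m : int) x : besselJ m x =
  (if m is Negz _ then (-1) ^+ `|m|%N else 1) * (x / 2) ^+ `|m|%N * besselE `|m|%N ((x / 2) ^+ 2).
Proof.
by case: m => n; rewrite /besselJ besselJ_natE ?mul1r// mulrA.
Qed.

Lemma bessel_AE (m : int) x :
  bessel_A m x = Num.sqrt (((x / 2) ^+ 2) ^+ `|m|%N * besselA `|m|%N ((x / 2) ^+ 2)).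
Proof.
rewrite /bessel_A; congr (Num.sqrt _).
have J0 k : besselJ k x ^+ 2 = ((x / 2) ^+ 2) ^+ `|k|%N * besselE `|k|%N ((x / 2) ^+ 2) ^+ 2.
  rewrite besselJE !exprMn exprAC; congr (_ * _).
  by case: k => n; rewrite ?sqrr_sign ?expr1n ?mul1r exprAC.
have key n : besselJ n%:Z x ^+ 2 - besselJ (n%:Z - 1) x * besselJ (n%:Z + 1) x =
   ((x / 2) ^+ 2) ^+ n * besselA n ((x / 2) ^+ 2).
  rewrite J0 /besselA; case: n => [|n].
    rewrite (_ : (0%:Z - 1) = Negz 0)// (_ : 0%:Z + 1 = 1)// !besselJE /=.
    by rewrite !expr0 !expr1; ring.
  rewrite (_ : n.+1%:Z - 1 = n%:Z); last by rewrite -addn1 PoszD addrK.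
  rewrite (_ : n.+1%:Z + 1 = n.+2%:Z); last by rewrite -[n.+2]addn1 PoszD.
  rewrite !besselJE !absz_nat !mul1r.
  have -> : besselE n ((x / 2) ^+ 2) = n.+1%:R * besselE n.+1 ((x / 2) ^+ 2) - (x / 2) ^+ 2 * besselE n.+2 ((x / 2) ^+ 2).
    by rewrite besselE_three_term opprB addrCA subrr addr0.
  by rewrite [((x / 2) ^+ 2) ^+ _]exprAC; rewrite !exprS expr0; ring.
case: m => n; first exact: key.
rewrite J0 (_ : `|Negz n|%N = n.+1)// -key.
rewrite (_ : Negz n - 1 = Negz n.+1); last by rewrite !NegzE -opprD -PoszD addn1.
have -> : besselJ (Negz n + 1) x = (-1) ^+ n * besselJ n x.
  rewrite (_ : Negz n + 1 = - n%:Z); last by rewrite NegzE -addn1 PoszD opprD subrK.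
  by case: n => [|n]; rewrite ?mul1r ?oppr0 -?NegzE.
have -> : besselJ (Negz n.+1) x = (-1) ^+ n * besselJ n.+2 x.
  by rewrite /besselJ !exprS mulrA mulrNN !mul1r.
rewrite J0 (_ : n.+1%:Z - 1 = n%:Z); last by rewrite -addn1 PoszD addrK.
rewrite (_ : n.+1%:Z + 1 = n.+2%:Z); last by rewrite -[n.+2]addn1 PoszD.
rewrite mulrACA -exprMn mulrNN mul1r expr1n mul1r mulrC; ring.
Qed.

End BesselFamilies.

(** * Sturm comparison *)

Section Sturm.
Context {R : realType}.
Implicit Types (f v w p q : R -> R) (a b x : R).

Lemma continuous_constant_sign f a b :
  (forall x, x \in `]a, b[ -> {for x, continuous f}) ->
  (forall x, x \in `]a, b[ -> f x != 0) ->
  exists2 s : R, s != 0 & forall x, x \in `]a, b[ -> 0 < s * f x.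
Proof.
move=> cf f0; have [ab|ba] := ltP a b; last first.
  exists 1; rewrite ?oner_eq0// => x; rewrite in_itv/= => /andP[ax xb].
  by have := lt_trans ax xb; rewrite ltNge ba.
have cI : (a + b) / 2 \in `]a, b[ by rewrite in_itv/= !midf_lt.
exists (f ((a + b) / 2)); first exact: f0.
move=> x xI; rewrite lt_neqAle eq_sym mulf_neq0 ?f0//= leNgt; apply/negP => neg.
set c := (a + b) / 2 in cI neg.
wlog cx : c x cI xI neg / c <= x => [H|].
  by have /orP[cx|xc] := le_total c x; [exact: (H c x)|apply: (H x c); rewrite // mulrC].
have sub : {subset `[c, x] <= `]a, b[}.
  move=> y; move: cI xI; rewrite !in_itv/= => /andP[ac _] /andP[_ xb] /andP[cy yx].
  by rewrite (lt_le_trans ac cy) (le_lt_trans yx xb).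
have cfI : {within `[c, x], continuous f}.
  by apply: continuous_in_subspaceT => y; rewrite inE => /sub; exact: cf.
have mM : Num.min (f c) (f x) <= 0 <= Num.max (f c) (f x).
  have [fc|fc] := ltP (f c) 0.
    have fx : 0 <= f x by rewrite ltW// -(nmulr_rlt0 _ fc).
    by rewrite ge_min le_max (ltW fc) fx orbT.
  have {}fc : 0 < f c by rewrite lt_neqAle eq_sym f0.
  have fx : f x <= 0 by rewrite ltW// -(pmulr_rlt0 _ fc).
  by rewrite ge_min le_max (ltW fc) fx orbT.
have [y yI fy0] := IVT cx cfI mM.
by have := f0 y (sub _ yI); rewrite fy0 eqxx.
Qed.

(** If v'' = - q v and w'' = - p w with q < p, then w oscillates faster and is
    already negative when v vanishes: otherwise the Wronskian v' w - v w', which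
    increases from 0 at a, would be at most 0 at the zero b of v. *)
Lemma sturm_comparison v v' q w w' p a b : a < b ->
  (forall x, x \in `[a, b] -> is_derive x 1 v (v' x)) ->
  (forall x, x \in `[a, b] -> is_derive x 1 v' (- (q x * v x))) ->
  (forall x, x \in `[a, b] -> is_derive x 1 w (w' x)) ->
  (forall x, x \in `[a, b] -> is_derive x 1 w' (- (p x * w x))) ->
  (forall x, x \in `]a, b[ -> q x < p x) ->
  v a = 0 -> w a = 0 -> v b = 0 ->
  (forall x, x \in `]a, b[ -> 0 < v x) ->
  (forall x, x \in `]a, b[ -> 0 < w x) ->
  w b < 0.
Proof.
move=> ab dv dv' dw dw' qp va wa vb v0 w0.
pose W x := v' x * w x - v x * w' x.
have dW x : x \in `[a, b] -> is_derive x 1 W ((p x - q x) * v x * w x).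
  move=> xI; have ? := dv _ xI; have ? := dv' _ xI.
  have ? := dw _ xI; have ? := dw' _ xI.
  by apply: is_derive_eq; rewrite /GRing.scale /=; ring.
have oc x : x \in `]a, b[ -> x \in `[a, b] by exact: subset_itv_oo_cc.
have : W a < W b.
  apply: (is_derive_gt0_lt ab (fun x xI => dW x (oc x xI))).
    by move=> x xI; rewrite !mulr_gt0 ?v0 ?w0// subr_gt0 qp.
  by apply: continuous_in_subspaceT => x; rewrite inE => xI; exact: is_derive_continuous (dW x xI).
rewrite /W va wa vb mulr0 !mul0r !subr0 => Wb.
rewrite ltNge; apply/negP => wb.
suff : v' b <= 0 by rewrite leNgt => /negP; apply; rewrite ltNge; apply/negP => vb'; have := lt_le_trans Wb (mulr_le0_ge0 vb' wb); rewrite ltxx.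
rewrite leNgt; apply/negP => v'b.
have bI : b \in `[a, b] by rewrite in_itv/= lexx ltW.
have cv' := is_derive_continuous (dv' b bI).
have : \forall x \near b^'-, 0 < v' x.
  have : v' x @[x --> b^'-] --> v' b by exact: cvg_at_left_filter.
  by move=> /cvgr_gt; exact.
move=> [e /= e0 H].
pose c := Num.max ((a + b) / 2) (b - e / 2).
have cb : c < b by rewrite gt_max midf_lt//= ltrBlDr ltrDl divr_gt0.
have ac : a < c by rewrite lt_max midf_lt.
have cI : {subset `]c, b[ <= `]a, b[}.
  by move=> x; rewrite !in_itv/= => /andP[cx ->]; rewrite (lt_trans ac).
have : v c < v b.
  apply: (is_derive_gt0_lt cb (fun x xI => dv x (oc x (cI x xI)))).
    move=> x; rewrite in_itv/= => /andP[cx xb]; apply: H => //=.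
    rewrite ger0_norm ?subr_ge0 ?ltW// ltrBlDr -ltrBlDl.
    rewrite (le_lt_trans _ cx)// /c le_max; apply/orP; right.
    by rewrite lerD2l lerN2 ler_pdivrMr// ler_pMr// ler1n.
  apply: continuous_in_subspaceT => x; rewrite inE/= in_itv/= => /andP[cx xb].
  apply: (is_derive_continuous (dv x _)); rewrite in_itv/= xb.
  by rewrite ltW// (lt_le_trans ac).
by rewrite vb ltNge ltW// v0// in_itv/= ac.
Qed.

End Sturm.

(** * Zeros of the Bessel functions and their gaps *)

Section BesselZeros.
Context {R : realType}.
Implicit Types (m n : nat) (x : R).

Lemma is_derive_besselJ m x : x != 0 ->
  is_derive x 1 (@besselJ_nat R m) (m%:R / x * besselJ_nat m x - besselJ_nat m.+1 x).
Proof.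
move=> x0.
have dl : is_derive x 1 (fun x : R => x / 2) (1 / 2).
  by apply: is_derive_eq; rewrite /GRing.scale /=; ring.
have dX : is_derive x 1 (fun x : R => (x / 2) ^+ m) (m%:R / x * (x / 2) ^+ m).
  case: m => [|m].
    by rewrite !mul0r; exact: is_derive_cst.
  have := @is_derive1_comp _ (fun y : R => y ^+ m.+1) _ x _ _ (is_derive_expr m (x / 2)) dl.
  move=> /is_derive_eq; apply; rewrite /GRing.scale /= exprS.
  by move: (_ ^+ m) => y; field.
have dE : is_derive x 1 (fun x : R => besselE m ((x / 2) ^+ 2))
    (- (x / 2) * besselE m.+1 ((x / 2) ^+ 2)).
  have d2 : is_derive x 1 (fun x : R => (x / 2) ^+ 2) (x / 2).
    by apply: is_derive_eq; rewrite /GRing.scale /= ?expr1; field.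
  have := @is_derive1_comp _ (besselE m) _ x _ _ (is_derive_besselE m _) d2.
  by move=> /is_derive_eq; apply; rewrite /GRing.scale /= mulNr mulrC mulNr.
have -> : @besselJ_nat R m = fun x => (x / 2) ^+ m * besselE m ((x / 2) ^+ 2).
  by apply/funext => y; rewrite besselJ_natE.
apply: is_derive_eq; rewrite /GRing.scale /= !besselJ_natE [_ ^+ m.+1]exprS; ring.
Qed.

Lemma is_derive_besselJS m x : x != 0 ->
  is_derive x 1 (@besselJ_nat R m.+1)
   (besselJ_nat m x - m.+1%:R / x * besselJ_nat m.+1 x).
Proof.
move=> x0; have := is_derive_besselJ m.+1 x0.
move=> /is_derive_eq; apply; rewrite !besselJ_natE.
have -> : besselE m ((x / 2) ^+ 2) =
    m.+1%:R * besselE m.+1 ((x / 2) ^+ 2) - (x / 2) ^+ 2 * besselE m.+2 ((x / 2) ^+ 2).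
  by rewrite besselE_three_term opprB addrCA subrr addr0.
by rewrite !exprS; field.
Qed.

Lemma continuous_besselJ m : continuous (@besselJ_nat R m).
Proof.
have -> : @besselJ_nat R m = (fun x => x ^+ m * besselE m (x ^+ 2)) \o (fun x => x / 2).
  by apply/funext => y /=; rewrite besselJ_natE.
move=> x; apply: continuous_comp; first exact: mulrr_continuous.
apply: continuousM; first exact: exprn_continuous.
apply: (@continuous_comp _ _ _ (fun x => x ^+ 2)); first exact: exprn_continuous.
exact: continuous_besselE.
Qed.

(** The infimum that defines the next zero is attained because J_m is continuous.
    A strict increase rules out the empty set, whose infimum is 0. *)
Lemma besselJ_zeroS m n (Z := @besselJ_zero R m) : 0 <= Z n -> Z n < Z n.+1 ->
  besselJ_nat m (Z n.+1) = 0 /\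
  forall z, z \in `](Z n), (Z n.+1)[ -> besselJ_nat m z != 0.
Proof.
move=> Zn0 ZnS; set S := [set z | Z n < z /\ besselJ_nat m z = 0].
have ZE : Z n.+1 = inf S by [].
have lbS : lbound S (Z n) by move=> z [/ltW].
have S0 : S !=set0.
  apply/set0P/eqP => S0; move: ZnS; rewrite ZE S0 inf0 => /(le_lt_trans Zn0).
  by rewrite ltxx.
have infS : has_inf S by split=> //; exists (Z n).
split; last first.
  move=> z; rewrite in_itv/= => /andP[Zz zZ]; apply/eqP => Jz.
  by move: zZ; rewrite ltNge ZE ge_inf//; exists (Z n).
apply/eqP/negPn/negP => J0.
have : \forall x \near Z n.+1, besselJ_nat m x != 0.
  have cJ : besselJ_nat m x @[x --> Z n.+1] --> besselJ_nat m (Z n.+1).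
    exact: continuous_besselJ.
  by move: cJ => /cvgr_neq0; exact.
move=> [e /= e0 H].
have [z [Zz Jz] zZ] := inf_adherent e0 infS.
have Zz' : Z n.+1 <= z by rewrite ZE ge_inf//; exists (Z n).
have := H z; rewrite /= Jz eqxx => /(_ _)/negP; apply=> //.
by rewrite ler0_norm ?subr_le0// opprB ltrBlDl ZE.
Qed.

(** Liouville's normal form: v(x) = sqrt(x) J_m(x) satisfies
    v'' = - (1 + (1/4 - m^2) / x^2) v, to which Sturm comparison applies. *)
Definition liouvilleJ m x : R := Num.sqrt x * besselJ_nat m x.
Definition liouvilleJ' m x : R :=
  Num.sqrt x * ((m%:R + 2^-1) / x * besselJ_nat m x - besselJ_nat m.+1 x).
Definition liouville_potential m x : R := 1 + (4^-1 - m%:R ^+ 2) / x ^+ 2.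

Lemma is_derive_liouvilleJ m x : 0 < x ->
  is_derive x 1 (liouvilleJ m) (liouvilleJ' m x).
Proof.
move=> x0; have x'0 : x != 0 by rewrite gt_eqF.
have dJ := is_derive_besselJ m x'0; have ds := is_derive1_sqrt x0.
rewrite /liouvilleJ; apply: is_derive_eq; rewrite /GRing.scale /= /liouvilleJ'.
have s0 : Num.sqrt x != 0 by rewrite gt_eqF// sqrtr_gt0.
have -> : x^-1 = (Num.sqrt x ^+ 2)^-1 by rewrite sqr_sqrtr// ltW.
by move: (Num.sqrt x) s0 => s s0; field.
Qed.

Lemma is_derive_liouvilleJ' m x : 0 < x ->
  is_derive x 1 (liouvilleJ' m) (- (liouville_potential m x * liouvilleJ m x)).
Proof.
move=> x0; have x'0 : x != 0 by rewrite gt_eqF.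
have dJ := is_derive_besselJ m x'0; have ds := is_derive1_sqrt x0.
have dJ1 := is_derive_besselJS m x'0; have dV := is_derive_inv x'0.
rewrite /liouvilleJ'; apply: is_derive_eq.
rewrite /GRing.scale /= /liouvilleJ /liouville_potential.
have s0 : Num.sqrt x != 0 by rewrite gt_eqF// sqrtr_gt0.
have xE : x = Num.sqrt x ^+ 2 by rewrite sqr_sqrtr// ltW.
move: (besselJ_nat m x) (besselJ_nat m.+1 x) => J J1.
by move: (Num.sqrt x) s0 xE x'0 => s s0 -> _; rewrite -natr1; field.
Qed.

(** For m >= 1 the potential lies below 1, so J_m oscillates more slowly than the
    sine function. *)
Lemma besselJ_gap_pi m (a b : R) : (0 < m)%N -> 0 < a -> a < b ->
  besselJ_nat m a = 0 -> besselJ_nat m b = 0 ->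
  (forall x, x \in `]a, b[ -> besselJ_nat m x != 0) ->
  pi <= b - a.
Proof.
move=> m0 a0 ab Ja Jb Jab; rewrite leNgt; apply/negP => ltpi.
have [s s0 sJ] := continuous_constant_sign (fun x _ => @continuous_besselJ m x) Jab.
suff : sin (b - a) < 0.
  by rewrite ltNge sin_ge0_pi// subr_ge0 ltW//= ltW.
have xgt0 x : x \in `[a, b] -> 0 < x.
  by rewrite in_itv/= => /andP[ax _]; exact: lt_le_trans ax.
have dsh x : is_derive x 1 (fun x : R => x - a) 1.
  by apply: is_derive_eq; rewrite subr0.
apply: (@sturm_comparison R (fun x => s * liouvilleJ m x) (fun x => s * liouvilleJ' m x)
  (liouville_potential m) (fun x => sin (x - a)) (fun x => cos (x - a)) (fun=> 1) a b ab).
- move=> x /xgt0 x0; have dv := is_derive_liouvilleJ m x0.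
  by apply: is_derive_eq.
- move=> x /xgt0 x0; have dv := is_derive_liouvilleJ' m x0.
  by apply: is_derive_eq; rewrite /GRing.scale /=; ring.
- move=> x _; have := @is_derive1_comp _ sin _ x _ _ (is_derive_sin _) (dsh x).
  by move=> /is_derive_eq; apply; rewrite /GRing.scale /= mulr1.
- move=> x _; have := @is_derive1_comp _ cos _ x _ _ (is_derive_cos _) (dsh x).
  by move=> /is_derive_eq; apply; rewrite /GRing.scale /= mulr1 mul1r.
- move=> x xI; have x0 := xgt0 _ (subset_itv_oo_cc xI).
  rewrite /liouville_potential gtrDl pmulr_llt0 ?invr_gt0 ?exprn_gt0// subr_lt0.
  rewrite (@lt_le_trans _ _ 1)//; first by rewrite invf_lt1// ltr1n.
  by rewrite -natrX ler1n expn_gt0 m0.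
- by rewrite /liouvilleJ Ja !mulr0.
- by rewrite subrr sin0.
- by rewrite /liouvilleJ Jb !mulr0.
- move=> x xI; rewrite /liouvilleJ mulrCA mulr_gt0 ?sJ// sqrtr_gt0.
  exact: xgt0 _ (subset_itv_oo_cc xI).
- move=> x; rewrite in_itv/= => /andP[ax xb].
  by rewrite sin_gt0_pi// subr_gt0 ax (lt_trans _ ltpi)// ltrD2r.
Qed.

(** For m = 0 the potential is decreasing, so J_0 oscillates more slowly than its
    own translate by the preceding gap. *)
Lemma besselJ0_gap_monotone (a b c : R) : 0 < a -> a < b -> b < c ->
  besselJ_nat 0 a = 0 -> besselJ_nat 0 b = 0 -> besselJ_nat 0 c = 0 ->
  (forall x, x \in `]a, b[ -> besselJ_nat 0 x != 0) ->
  (forall x, x \in `]b, c[ -> besselJ_nat 0 x != 0) ->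
  b - a <= c - b.
Proof.
move=> a0 ab bc Ja Jb Jc Jab Jbc; rewrite leNgt; apply/negP => ltgap.
have [s s0 sJ] := continuous_constant_sign (fun x _ => @continuous_besselJ 0 x) Jbc.
have [t t0 tJ] := continuous_constant_sign (fun x _ => @continuous_besselJ 0 x) Jab.
(* The translate by d vanishes at b, where J_0 has its next zero. *)
pose d := b - a; have d0 : 0 < d by rewrite subr_gt0.
have shI x : x \in `]b, c] -> x - d \in `]a, b[.
  rewrite !in_itv/= /d => /andP[bx xc]; apply/andP; split; lra.
have shP x : x \in `[b, c] -> 0 < x - d.
  by rewrite !in_itv/= /d => /andP[bx xc]; lra.
have dsh x : is_derive x 1 (fun x : R => x - d) 1.
  by apply: is_derive_eq; rewrite subr0.
suff : t * liouvilleJ 0 (c - d) < 0.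
  rewrite ltNge /liouvilleJ mulrCA mulr_ge0// ltW// tJ// shI//.
  by rewrite in_itv/= bc lexx.
have b0 : 0 < b by exact: lt_trans ab.
have xgt0 x : x \in `[b, c] -> 0 < x.
  by rewrite in_itv/= => /andP[bx _]; exact: lt_le_trans bx.
apply: (@sturm_comparison R (fun x => s * liouvilleJ 0 x) (fun x => s * liouvilleJ' 0 x)
  (liouville_potential 0) (fun x => t * liouvilleJ 0 (x - d))
  (fun x => t * liouvilleJ' 0 (x - d)) (fun x => liouville_potential 0 (x - d)) b c bc).
- move=> x /xgt0 x0; have dv := is_derive_liouvilleJ 0 x0.
  by apply: is_derive_eq.
- move=> x /xgt0 x0; have dv := is_derive_liouvilleJ' 0 x0.
  by apply: is_derive_eq; rewrite /GRing.scale /=; ring.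
- move=> x /shP x0; have := @is_derive1_comp _ (liouvilleJ 0) _ x _ _ (is_derive_liouvilleJ 0 x0) (dsh x).
  by move=> dv; apply: is_derive_eq; rewrite /GRing.scale /=; ring.
- move=> x /shP x0; have := @is_derive1_comp _ (liouvilleJ' 0) _ x _ _ (is_derive_liouvilleJ' 0 x0) (dsh x).
  by move=> dv; apply: is_derive_eq; rewrite /GRing.scale /=; ring.
- move=> x xI; have xI' := subset_itv_oo_cc xI; rewrite /liouville_potential.
  rewrite expr0n subr0 ltrD2l ltr_pM2l ?invr_gt0// ltf_pV2 ?posrE ?exprn_gt0 ?shP ?xgt0//.
  rewrite ltrXn2r// ?ltW ?shP ?xgt0//.
  by rewrite ltrBlDr ltrDl.
- by rewrite /liouvilleJ Jb !mulr0.
- by rewrite /liouvilleJ /d opprB addrCA subrr addr0 Ja !mulr0.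
- by rewrite /liouvilleJ Jc !mulr0.
- move=> x xI; rewrite /liouvilleJ mulrCA mulr_gt0 ?sJ// sqrtr_gt0.
  exact: xgt0 _ (subset_itv_oo_cc xI).
- move=> x xI; rewrite /liouvilleJ mulrCA mulr_gt0 ?tJ//.
    by rewrite sqrtr_gt0 shP// subset_itv_oo_cc.
  by rewrite shI// subset_itv_oo_oc.
Qed.

End BesselZeros.

(** * Diagonal dominance and sums of Cauchy type *)

Section DiagonalDominance.
Context {R : realType}.

(** Levy-Desplanques: a left kernel vector of the transpose is tested at its
    entry of largest modulus. *)
Lemma dominant_unitmx n (A : 'M[R]_n) :
  (forall i, \sum_(j | j != i) `|A i j| < `|A i i|) -> A \in unitmx.
Proof.
move=> dom; rewrite unitmxE unitfE -det_tr; apply/negP => /det0P[v v0 vA].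
have [i vi] : exists i, v 0 i != 0.
  by apply/existsP; apply: contraNT v0; rewrite negb_exists => /forallP v0; apply/eqP/rowP => i; apply/eqP; have := v0 i; rewrite negbK !mxE.
pose im := [arg max_(k > i) `|v 0 k|]%O.
have vm k : `|v 0 k| <= `|v 0 im|.
  by rewrite /im; case: arg_maxP => // j _; exact.
have vm0 : 0 < `|v 0 im| by rewrite (lt_le_trans _ (vm i))// normr_gt0.
have /rowP/(_ im) := vA; rewrite !mxE (bigD1 im)//= mxE => /eqP.
rewrite addr_eq0 => /eqP/(congr1 Num.norm); rewrite normrN normrM => E.
have : `|v 0 im| * `|A im im| <= `|v 0 im| * \sum_(j | j != im) `|A im j|.
  rewrite E mulr_sumr (le_trans (ler_norm_sum _ _ _))//.
  by apply: ler_sum => j _; rewrite mxE normrM ler_wpM2r.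
by rewrite ler_pM2l// leNgt dom.
Qed.

Lemma unitmx_mxdiag m (p : 'I_m -> nat) (B : forall i, 'M[R]_(p i)) :
  (forall i, B i \in unitmx) -> \mxdiag_i B i \in unitmx.
Proof.
move=> uB; rewrite -row_free_unit /row_free rank_mxdiag.
by apply/eqP/eq_bigr => i _; exact: mxrank_unit.
Qed.

End DiagonalDominance.

Section CauchyRow.
Context {R : realType}.
Implicit Types (k : nat -> R) (mu x : R).

Lemma ln_div_ge (a b : R) : 0 < a -> 0 < b -> 1 - b / a <= ln (a / b).
Proof.
move=> a0 b0; have := @le_ln1Dx R (b / a - 1).
rewrite addrCA subrr addr0 -[X in ln X]invf_div lnV ?posrE ?divr_gt0// => H.
have : - ln (a / b) <= b / a - 1 by apply: H; rewrite ltrBrDr addNr divr_gt0.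
lra.
Qed.

(** The inequality ln y >= 1 - 1/y bounds one term of a sum by a difference of
    two logarithms, the gap hypothesis supplying the length t - p of the step;
    such differences telescope in left_sum_le. The bound right_term_le is its
    mirror image, for wavenumbers above x. *)
Lemma left_term_le mu (p t x : R) : 0 <= p -> p < t -> t < x -> 1 <= mu * (t - p) ->
  p / (x ^+ 2 - p ^+ 2) <= mu / 2 * ln ((x ^+ 2 - p ^+ 2) / (x ^+ 2 - t ^+ 2)).
Proof.
move=> p0 pt tx mugap.
have A0 : 0 < x ^+ 2 - p ^+ 2 by nra.
have B0 : 0 < x ^+ 2 - t ^+ 2 by nra.
have mu0 : 0 < mu.
  by rewrite -(pmulr_lgt0 _ (_ : 0 < t - p)) ?subr_gt0// (lt_le_trans ltr01).
have := ln_div_ge A0 B0.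
set L := ln _ => H.
apply: (@le_trans _ _ (mu / 2 * (1 - (x ^+ 2 - t ^+ 2) / (x ^+ 2 - p ^+ 2)))); last first.
  by rewrite ler_wpM2l// divr_ge0// ltW.
have -> : 1 - (x ^+ 2 - t ^+ 2) / (x ^+ 2 - p ^+ 2) = (t ^+ 2 - p ^+ 2) / (x ^+ 2 - p ^+ 2).
  by field; rewrite gt_eqF.
rewrite mulrA; apply: ler_wpM2r; first by rewrite invr_ge0 ltW.
rewrite subr_sqr mulrA -mulrA [leRHS](_ : _ = (mu * (t - p)) * ((t + p) / 2)); last by field.
apply: (@le_trans _ _ ((t + p) / 2)); first lra.
by rewrite ler_peMl//; lra.
Qed.

Lemma right_term_le mu (p t x : R) : 0 <= x -> x < p -> p < t -> 1 <= mu * (t - p) ->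
  t / (t ^+ 2 - x ^+ 2) <= mu / 2 * ln ((t ^+ 2 - x ^+ 2) / (p ^+ 2 - x ^+ 2)).
Proof.
move=> x0 xp pt mugap.
have p0 : 0 < p by exact: le_lt_trans xp.
have mu0 : 0 < mu.
  by rewrite -(pmulr_lgt0 _ (_ : 0 < t - p)) ?subr_gt0// (lt_le_trans ltr01).
have tx1 : 0 < t - x by lra.
have px1 : 0 < p - x by lra.
have tx2 : 0 < t + x by lra.
have px2 : 0 < p + x by lra.
have H1 := ln_div_ge tx1 px1; have H2 := ln_div_ge tx2 px2.
have -> : (t ^+ 2 - x ^+ 2) / (p ^+ 2 - x ^+ 2) = (t - x) / (p - x) * ((t + x) / (p + x)).
  by rewrite !subr_sqr; field; rewrite !gt_eqF.
rewrite lnM ?posrE ?divr_gt0//.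
apply: (@le_trans _ _ (mu / 2 * ((1 - (p - x) / (t - x)) + (1 - (p + x) / (t + x))))); last first.
  by rewrite ler_wpM2l ?lerD// divr_ge0// ltW.
have -> : mu / 2 * ((1 - (p - x) / (t - x)) + (1 - (p + x) / (t + x))) =
    mu * (t - p) * (t / (t ^+ 2 - x ^+ 2)).
  by rewrite subr_sqr; field; rewrite !gt_eqF.
by rewrite ler_peMl// divr_ge0 ?(le_trans _ (ltW pt)) ?ltW// subr_gt0 ltrXn2r// ?ltW//; lra.
Qed.

Lemma left_sum_le k mu x j : (0 < j)%N ->
  (forall n, (0 < n <= j)%N -> 0 <= k n) ->
  (forall n, (0 < n < j)%N -> k n < k n.+1 /\ 1 <= mu * (k n.+1 - k n)) ->
  k j < x ->
  \sum_(1 <= n < j.+1) k n / (x ^+ 2 - k n ^+ 2) <=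
  mu / 2 * ln ((x ^+ 2 - k 1%N ^+ 2) / (x ^+ 2 - k j ^+ 2)) + k j / (x ^+ 2 - k j ^+ 2).
Proof.
elim: j => // -[_|j IH] _ k0 kS kx.
  rewrite big_nat1 divff ?ln1 ?mulr0 ?add0r// gt_eqF//.
  by have := k0 1%N isT; nra.
have [kj gap] := kS j.+1 (leqnn _).
have kjx := lt_trans kj kx.
have kj0 : 0 <= k j.+1 by apply: k0; rewrite /= leqnSn.
rewrite big_nat_recr//= lerD2r.
apply: (le_trans (IH _ _ _ _)) => //.
- by move=> n /andP[n0 nj]; apply: k0; rewrite n0/= (leq_trans nj).
- by move=> n /andP[n0 nj]; apply: kS; rewrite n0/= (leq_trans nj).
have T := left_term_le kj0 kj kx gap.
have k1 : 0 < x ^+ 2 - k 1%N ^+ 2.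
  have k1j : k 1%N <= k j.+1.
    elim: {IH T gap kx kj kjx kj0} j k0 kS => // j IH k0 kS.
    apply: (@le_trans _ _ (k j.+1)).
      apply: IH => n /andP[n0 nj]; [apply: k0|apply: kS]; rewrite n0/= (leq_trans nj)//.
    by apply/ltW; have [] := kS j.+1; rewrite //= !ltnS leqnSn.
  have := k0 1%N isT; nra.
have kj1 : 0 < x ^+ 2 - k j.+1 ^+ 2 by nra.
have kj2 : 0 < x ^+ 2 - k j.+2 ^+ 2 by nra.
move: T; rewrite !ln_div ?posrE// => T.
have := lerD (lexx (mu / 2 * (ln (x ^+ 2 - k 1%N ^+ 2) - ln (x ^+ 2 - k j.+1 ^+ 2)))) T.
by move=> /le_trans; apply; rewrite -mulrDr addrA subrK.
Qed.

Lemma right_sum_le k mu x j d : 0 <= x -> x < k j ->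
  (forall n, (j <= n < j + d)%N -> k n < k n.+1 /\ 1 <= mu * (k n.+1 - k n)) ->
  \sum_(j <= n < (j + d).+1) k n / (k n ^+ 2 - x ^+ 2) <=
  mu / 2 * ln ((k (j + d)%N ^+ 2 - x ^+ 2) / (k j ^+ 2 - x ^+ 2)) + k j / (k j ^+ 2 - x ^+ 2).
Proof.
move=> x0 xk; have kj0 : 0 < k j ^+ 2 - x ^+ 2 by nra.
elim: d => [|d IH] kS.
  by rewrite addn0 big_nat1 divff ?ln1 ?mulr0 ?add0r// gt_eqF.
have kS' n : (j <= n < j + d)%N -> k n < k n.+1 /\ 1 <= mu * (k n.+1 - k n).
  by move=> /andP[jn nd]; apply: kS; rewrite jn addnS leqW.
have kjd : x < k (j + d)%N.
  elim: {IH kS} d kS' => [|d IH] kS; first by rewrite addn0.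
  rewrite (@lt_trans _ _ (k (j + d)%N))//.
    by apply: IH => n /andP[jn nd]; apply: kS; rewrite jn addnS leqW.
  by rewrite addnS; have [] := kS (j + d)%N; rewrite // leq_addr addnS ltnS leqnn.
have jd : (j <= j + d < j + d.+1)%N by rewrite leq_addr addnS ltnS leqnn.
have [kk gap] := kS (j + d)%N jd.
rewrite addnS big_nat_recr ?leqW ?leq_addr//=.
have T := right_term_le x0 kjd kk gap.
apply: (le_trans (lerD (IH kS') T)).
have p1 : 0 < k (j + d)%N ^+ 2 - x ^+ 2 by nra.
have p2 : 0 < k (j + d).+1 ^+ 2 - x ^+ 2 by nra.
rewrite !ln_div ?posrE// addrAC -mulrDr lerD2r.
by rewrite addrC addrA subrK.
Qed.

End CauchyRow.

(** * Dominance of the Cauchy rows near the wavenumbers *)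

Section Dominance.
Context {R : realType}.
Implicit Types (k : nat -> R) (x y d : R).

Lemma cauchy_ratio_lt (K L X Y : R) :
  (K < X /\ X < Y \/ Y < X /\ X < K) -> (L < K /\ L < Y \/ K < L /\ Y < L) ->
  `|X - K| / `|X - L| < `|Y - K| / `|Y - L|.
Proof.
move=> XY KL; rewrite -!normf_div.
have XL : X - L != 0 by rewrite subr_eq0; apply/eqP; lra.
have YL : Y - L != 0 by rewrite subr_eq0; apply/eqP; lra.
have EX : (X - K) / (X - L) = 1 - (K - L) / (X - L) by field.
have EY : (Y - K) / (Y - L) = 1 - (K - L) / (Y - L) by field.
case: XY KL => -[h1 h2] [] [h3 h4].
- rewrite !ger0_norm ?divr_ge0//; try lra.
  rewrite EX EY ltrD2l ltrN2 ltr_pM2l ?subr_gt0// ltf_pV2 ?posrE; lra.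
- have -> : `|(X - K) / (X - L)| = (X - K) / (L - X).
    by rewrite normf_div gtr0_norm ?subr_gt0// ltr0_norm ?opprB// subr_lt0; lra.
  have -> : `|(Y - K) / (Y - L)| = (Y - K) / (L - Y).
    by rewrite normf_div gtr0_norm ?ltr0_norm ?opprB ?subr_lt0 ?subr_gt0//; lra.
  by rewrite ltr_pM// ?invr_ge0 ?subr_ge0 ?ltf_pV2 ?posrE; lra.
- have -> : `|(X - K) / (X - L)| = (K - X) / (X - L).
    by rewrite normf_div ltr0_norm ?gtr0_norm ?opprB ?subr_lt0 ?subr_gt0//; lra.
  have -> : `|(Y - K) / (Y - L)| = (K - Y) / (Y - L).
    by rewrite normf_div ltr0_norm ?gtr0_norm ?opprB ?subr_lt0 ?subr_gt0//; lra.
  by rewrite ltr_pM// ?invr_ge0 ?subr_ge0 ?ltf_pV2 ?posrE; lra.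
- rewrite !ger0_norm; first last.
  + by rewrite -mulrNN -invrN !opprB divr_ge0//; lra.
  + by rewrite -mulrNN -invrN !opprB divr_ge0//; lra.
  rewrite -[ltLHS]mulrNN -invrN -[ltRHS]mulrNN -invrN !opprB.
  have -> : (K - X) / (L - X) = 1 - (L - K) / (L - X) by field; apply/eqP; lra.
  have -> : (K - Y) / (L - Y) = 1 - (L - K) / (L - Y) by field; apply/eqP; lra.
  by rewrite ltrD2l ltrN2 ltr_pM2l ?subr_gt0// ltf_pV2 ?posrE; lra.
Qed.

Lemma increasing_below k N : (forall n, (n <= N)%N -> k n < k n.+1) ->
  forall i j, (i < j <= N.+1)%N -> k i < k j.
Proof.
move=> kS i; elim=> // j IH; rewrite !ltnS => /andP[ij jN].
have [->|ne] := eqVneq i j; first exact: kS.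
by apply: lt_trans (kS _ jN); apply: IH; rewrite ltn_neqAle ne ij leqW.
Qed.

(** The weights |x^2 - k_i^2| / |x^2 - k_n^2| decrease as x moves towards k_i, so
    dominance at a point further away implies strict dominance. *)
Lemma cauchy_row_strict k N i x y : (0 < i <= N)%N ->
  (forall n, (n <= N)%N -> k n < k n.+1) -> k 0%N = 0 ->
  k i.-1 < y < k i.+1 ->
  (k i < x /\ x < y \/ y < x /\ x < k i) ->
  \sum_(1 <= n < N.+1 | n != i) k n / `|y ^+ 2 - k n ^+ 2|
    <= k i / `|y ^+ 2 - k i ^+ 2| ->
  \sum_(1 <= n < N.+1 | n != i) k n / `|x ^+ 2 - k n ^+ 2|
    < k i / `|x ^+ 2 - k i ^+ 2|.
Proof.
move=> /andP[i0 iN] kS k0 /andP[iy yi] xy H.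
have mono := increasing_below kS.
have kpos n : (0 < n <= N.+1)%N -> 0 < k n by rewrite -k0; exact: mono.
have ki0 : 0 < k i by rewrite kpos// i0 leqW.
have ki1 : 0 <= k i.-1.
  have [->|p] := posnP i.-1; first by rewrite k0.
  by rewrite ltW// kpos// p/= (leq_trans (leq_pred _))// leqW.
have y0 : 0 < y by exact: le_lt_trans iy.
have XY : k i ^+ 2 < x ^+ 2 /\ x ^+ 2 < y ^+ 2 \/ y ^+ 2 < x ^+ 2 /\ x ^+ 2 < k i ^+ 2.
  by case: xy => -[h1 h2]; [left|right]; split; nra.
have KL n : (0 < n <= N)%N -> n != i ->
    k n ^+ 2 < k i ^+ 2 /\ k n ^+ 2 < y ^+ 2 \/ k i ^+ 2 < k n ^+ 2 /\ y ^+ 2 < k n ^+ 2.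
  move=> /andP[n0 nN]; have kn : 0 < k n by rewrite kpos// n0 leqW.
  rewrite neq_ltn => /orP[ni|ni].
    have kni : k n <= k i.-1.
      have [->//|ne] := eqVneq n i.-1.
      rewrite ltW// mono// ltn_neqAle ne -ltnS prednK// ni/=.
      by rewrite (leq_trans (leq_pred _))// leqW.
    have kki : k n < k i by rewrite mono// ni leqW.
    by left; split; nra.
  have kni : k i.+1 <= k n.
    have [->//|ne] := eqVneq i.+1 n.
    by rewrite ltW// mono// ltn_neqAle ne ni leqW.
  have kki : k i < k n by rewrite mono// ni leqW.
  by right; split; nra.
have X0 : 0 < `|x ^+ 2 - k i ^+ 2|.
  by rewrite normr_gt0 subr_eq0; apply/eqP; lra.
have Y0 : 0 < `|y ^+ 2 - k i ^+ 2|.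
  by rewrite normr_gt0 subr_eq0; apply/eqP; lra.
rewrite ltr_pdivlMr//; move: H; rewrite ler_pdivlMr// !mulr_suml => H.
have term n : (0 < n <= N)%N -> n != i ->
  k n / `|x ^+ 2 - k n ^+ 2| * `|x ^+ 2 - k i ^+ 2| <
  k n / `|y ^+ 2 - k n ^+ 2| * `|y ^+ 2 - k i ^+ 2|.
  move=> nN ni; rewrite -!mulrA ltr_pM2l; last first.
    by case/andP: nN => n0 nN; rewrite kpos// n0 leqW.
  by rewrite ![_^-1 * _]mulrC; exact: cauchy_ratio_lt XY (KL n nN ni).
have [hP|noP] := boolP (has (fun n => n != i) (index_iota 1 N.+1)).
  apply: lt_le_trans H; rewrite big_nat_cond [ltRHS]big_nat_cond.
  apply: ltr_sum.
    apply/hasP; case/hasP: hP => n nI ni; exists n => //.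
    by move: nI; rewrite mem_index_iota ni andbT.
  by move=> n /andP[nN ni]; exact: term.
rewrite big_seq_cond big_pred0// => n; apply/negP => /andP[nI ni].
by move/hasP: noP; apply; exists n.
Qed.

(** The two logarithmic expressions of the perturbation bound dominate the parts
    n < i and n > i of the row sum. *)
Lemma perturbation_bound_row (r0 : R) (N m i : nat) x (k := wavenumber r0 m) :
  (0 < i <= N)%N ->
  (forall n, (n <= N)%N -> k n < k n.+1) -> k 0%N = 0 ->
  (forall n, (0 < n < N)%N -> 1 <= gap_coef r0 m * (k n.+1 - k n)) ->
  k i.-1 < x < k i.+1 -> perturbation_bound r0 N m i x ->
  \sum_(1 <= n < N.+1 | n != i) k n / `|x ^+ 2 - k n ^+ 2|
    <= k i / `|x ^+ 2 - k i ^+ 2|.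
Proof.
move=> /andP[i0 iN] kS k0 gap /andP[ix xi].
have mono := increasing_below kS.
have kpos n : (0 < n <= N.+1)%N -> 0 < k n by rewrite -k0; exact: mono.
have ki1 : 0 <= k i.-1.
  have [->|p] := posnP i.-1; first by rewrite k0.
  by rewrite ltW// kpos// p/= (leq_trans (leq_pred _))// leqW.
have x0 : 0 < x by exact: le_lt_trans ix.
rewrite /perturbation_bound -/k normrM ger0_norm ?normfV; last first.
  by rewrite ltW// kpos// i0 leqW.
apply: le_trans.
rewrite (big_cat_nat (n := i))//= ?leqW//.
rewrite [X in _ + X <= _]big_ltn_cond ?ltnS// eqxx/=.
apply: lerD.
  have [i1|i1] := eqVneq i 1%N; first by rewrite big_geq// i1.
  have iE : i = i.-1.+1 by rewrite prednK.
  have i1' : (0 < i.-1)%N by rewrite -ltnS -iE ltn_neqAle eq_sym i1.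
  have iN1 : (i.-1 <= N)%N by rewrite (leq_trans (leq_pred _)).
  rewrite [leLHS](_ : _ = \sum_(1 <= n < i.-1.+1) k n / (x ^+ 2 - k n ^+ 2)).
    apply: left_sum_le => //.
    - by move=> n /andP[n0 ni]; rewrite ltW// kpos// n0 (leq_trans ni)// leqW.
    - move=> n /andP[n0 ni]; split; first by rewrite kS// ltnW// (leq_trans ni).
      by apply: gap; rewrite n0 (leq_trans ni).
  apply: congr_big_nat => //.
    by move=> n /andP[n1]; rewrite -iE => /ltn_eqF ->.
  move=> n; rewrite -iE => /andP[_ /andP[n1 ni]].
  have kni : k n <= k i.-1.
    have [->//|ne] := eqVneq n i.-1.
    by rewrite ltW// mono// ltn_neqAle ne -ltnS -iE ni leqW.
  have kn : 0 < k n by rewrite kpos// n1 leqW// (leq_trans (ltnW ni)).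
  by rewrite gtr0_norm//; nra.
have [->|iN'] := eqVneq i N; first by rewrite big_geq.
have {}iN' : (i < N)%N by rewrite ltn_neqAle iN'.
have NE : N = (i.+1 + (N - i.+1))%N by rewrite subnKC.
rewrite [leLHS](_ : _ = \sum_(i.+1 <= n < (i.+1 + (N - i.+1)).+1) k n / (k n ^+ 2 - x ^+ 2)).
  rewrite {2}NE; apply: right_sum_le => //; first exact: ltW.
  move=> n; rewrite -NE => /andP[ni nN]; split; first by rewrite kS// ltnW.
  by apply: gap; rewrite nN (leq_trans _ ni).
rewrite -NE; apply: congr_big_nat => //.
  by move=> n /andP[/gtn_eqF ->].
move=> n /andP[_ /andP[ni nN]].
have kni : k i.+1 <= k n.
  have [->//|ne] := eqVneq i.+1 n.
  by rewrite ltW// mono// ltn_neqAle ne ni leqW.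
rewrite ltr0_norm ?opprB//; nra.
Qed.

Section AdmissibleWavenumbers.
Variables (r0 : R) (N m : nat).
Let k := wavenumber r0 m.
Hypothesis r0_gt0 : 0 < r0.
Hypothesis adm : forall i, (0 < i <= N)%N -> exists d, admissible_radius r0 N m i d.

Hypothesis N_gt0 : (0 < N)%N.

(** An admissible radius places points on both sides of k_i between its two
    neighbours, so it separates k_(i-1), k_i and k_(i+1). This strict increase
    makes the recursively defined zeros genuine zeros up to the index N + 1. *)
Lemma wavenumber_lt n : (n <= N)%N -> k n < k n.+1.
Proof.
move=> nN.
have H i : (0 < i <= N)%N -> k i.-1 < k i /\ k i < k i.+1.
  move=> iN; have [d [d0 Hd]] := adm iN.
  have e0 : 0 < d / 2 < d by rewrite divr_gt0//= ltr_pdivrMr// ltr_pMr// ltr1n.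
  have [/andP[h1 h2] _] := Hd (d / 2) _ e0 (or_introl erefl).
  have [/andP[h3 h4] _] := Hd (d / 2) _ e0 (or_intror erefl).
  by rewrite -/k in h1 h2 h3 h4; split; [apply: lt_trans h3 _|apply: lt_trans h2]; lra.
case: n nN => [_|n nN]; first by have [] := H 1%N N_gt0.
by have [] := H n.+1 nN.
Qed.

Let Z := @besselJ_zero R m.

Lemma wavenumber0 : k 0%N = 0.
Proof. by rewrite /k /wavenumber mul0r. Qed.

Lemma besselJ_zero_lt n : (n <= N)%N -> Z n < Z n.+1.
Proof.
move=> nN; have := wavenumber_lt nN.
by rewrite /k /wavenumber ltr_pM2r ?invr_gt0.
Qed.

Lemma besselJ_zero_ge0 n : (n <= N.+1)%N -> 0 <= Z n.
Proof.
elim: n => // n IH nN; apply: (@le_trans _ _ (Z n)); first by rewrite IH// ltnW.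
exact/ltW/besselJ_zero_lt.
Qed.

Lemma besselJ_zero_gt0 n : (0 < n <= N.+1)%N -> 0 < Z n.
Proof.
case: n => // n nN; apply: (@le_lt_trans _ _ (Z n)); last exact: besselJ_zero_lt.
by rewrite besselJ_zero_ge0// ltnW.
Qed.

Lemma besselJ_zero_root n : (n <= N)%N -> besselJ_nat m (Z n.+1) = 0 /\
  forall z, z \in `](Z n), (Z n.+1)[ -> besselJ_nat m z != 0.
Proof.
move=> nN; apply: besselJ_zeroS; last exact: besselJ_zero_lt.
by rewrite besselJ_zero_ge0// leqW.
Qed.

(** The coefficient is the reciprocal of a lower bound of the gaps: pi / r0 for
    m >= 1, and the first gap for m = 0, where the gaps increase. *)
Lemma gap_coef_gap n : (0 < n < N)%N -> 1 <= gap_coef r0 m * (k n.+1 - k n).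
Proof.
move=> /andP[n0 nN]; rewrite /k /wavenumber -mulrBl /gap_coef -!/(Z _).
have Zn0 i : (0 < i < N)%N -> besselJ_nat m (Z i) = 0.
  by case: i => // i iN; have [] := besselJ_zero_root (ltnW (ltnW iN)).
case: eqVneq => m0; last first.
  have [J0 Jn0] := besselJ_zero_root (ltnW nN).
  have gap : pi <= Z n.+1 - Z n.
    apply: (@besselJ_gap_pi R m _ _ _ _ _ _ J0 Jn0); first by rewrite lt0n.
    - by rewrite besselJ_zero_gt0// n0 leqW// ltnW.
    - exact/besselJ_zero_lt/ltnW.
    - by rewrite Zn0// n0.
  rewrite [leRHS](_ : _ = (Z n.+1 - Z n) / pi); last first.
    by move: pi (lt0r_neq0 (pi_gt0 R)) => p p0; field; rewrite p0 gt_eqF.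
  by rewrite ler_pdivlMr ?mul1r// pi_gt0.
have -> : @besselJ_zero R 0 = Z by rewrite /Z m0.
have N1 : (1 < N)%N by exact: leq_ltn_trans nN.
have gap0 : 0 < Z 2%N - Z 1%N by rewrite subr_gt0 besselJ_zero_lt// ltnW.
rewrite [leRHS](_ : _ = (Z n.+1 - Z n) / (Z 2%N - Z 1%N)); last first.
  by field; rewrite !gt_eqF.
rewrite ler_pdivlMr// mul1r.
elim: n n0 nN => // -[//|n] IH _ nN.
apply: (le_trans (IH isT (ltnW nN))).
have [Jc Jbc] := besselJ_zero_root (ltnW nN).
have [Jb Jab] := besselJ_zero_root (ltnW (ltnW nN)).
have J0E : @besselJ_nat R 0 = besselJ_nat m by rewrite m0.
apply: besselJ0_gap_monotone; rewrite ?J0E//.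
- by apply: besselJ_zero_gt0; rewrite /= ltnS; exact: ltnW (ltnW (ltnW nN)).
- exact/besselJ_zero_lt/ltnW/ltnW.
- exact/besselJ_zero_lt/ltnW.
- by rewrite Zn0//= ltnW.
Qed.

(** The hypothesis is used at a distance e between |x - k_i| and d; strictness is
    gained on the way back from k_i +- e to x. *)
Lemma wavenumber_row_dominant i d x : (0 < i <= N)%N ->
  admissible_radius r0 N m i d -> `|x - k i| < d -> x != k i ->
  \sum_(1 <= n < N.+1 | n != i) k n / `|x ^+ 2 - k n ^+ 2|
    < k i / `|x ^+ 2 - k i ^+ 2|.
Proof.
move=> iN [d0 Hd] xd xk.
pose e := (`|x - k i| + d) / 2.
have e0 : 0 < e < d by rewrite /e; have := normr_ge0 (x - k i); lra.
have xe : `|x - k i| < e by rewrite /e; lra.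
have step y : y = k i + e \/ y = k i - e ->
   (k i < x /\ x < y \/ y < x /\ x < k i) -> 
  \sum_(1 <= n < N.+1 | n != i) k n / `|x ^+ 2 - k n ^+ 2|
    < k i / `|x ^+ 2 - k i ^+ 2|.
  move=> yE xy; have [yI pb] := Hd e y e0 yE.
  apply: (cauchy_row_strict iN wavenumber_lt wavenumber0 yI xy).
  by apply: perturbation_bound_row => //; [exact: wavenumber_lt|exact: wavenumber0|exact: gap_coef_gap].
have [lt|gt|eq] := ltgtP x (k i); last by rewrite eq eqxx in xk.
  move: xe; rewrite ltr0_norm ?subr_lt0// => xe.
  by apply: (step (k i - e)); [right|right; split=> //; lra].
move: xe; rewrite gtr0_norm ?subr_gt0// => xe.
by apply: (step (k i + e)); [left|left; split=> //; lra].
Qed.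

Lemma wavenumber_neighbours i d x : (0 < i <= N)%N ->
  admissible_radius r0 N m i d -> `|x - k i| < d -> k i.-1 < x < k i.+1.
Proof.
move=> iN [d0 Hd] xd; have [->|xk] := eqVneq x (k i).
  case/andP: iN => i0 iN; rewrite -{2}(prednK i0) !wavenumber_lt//.
  by rewrite (leq_trans (leq_pred _)).
have e0 : 0 < `|x - k i| < d by rewrite normr_gt0 subr_eq0 xk.
have [] // := Hd _ x e0 _.
have [lt|gt|eq] := ltgtP x (k i); last by rewrite eq eqxx in xk.
  by right; rewrite -/k ltr0_norm ?subr_lt0//; ring.
by left; rewrite -/k gtr0_norm ?subr_gt0//; ring.
Qed.

End AdmissibleWavenumbers.

(** A number below Delta_k forces Delta_k_at to be positive, hence to be the
    largest admissible radius rather than the default value 0. *)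
Lemma Delta_k_admissible (r0 : R) (M N m i : nat) (t : R) : (m <= M)%N -> (0 < i <= N)%N ->
  `|t| < Delta_k r0 M N ->
  exists2 d, admissible_radius r0 N m i d & `|t| < d.
Proof.
move=> mM iN tD; have tDm : `|t| < Delta_k_at r0 N m i.
  apply: (lt_le_trans tD); rewrite /Delta_k.
  have mM' : (m < M.+1)%N by rewrite ltnS.
  apply: (le_trans (bigmin_le _ (Ordinal mM') _)) => /=.
  case/andP: iN => i0 iN; have iN' : (i.-1 < N)%N by rewrite prednK.
  by apply: (le_trans (bigmin_le _ (Ordinal iN') _)); rewrite /= prednK.
exists (Delta_k_at r0 N m i) => //.
move: tDm; rewrite /Delta_k_at; case: xgetP => [y _ [//]|_].
by rewrite ltNge normr_ge0.
Qed.

End Dominance.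

(** * Rotation invariance of the plane measure *)

Section Rotations.
Context {R : realType}.
Implicit Types (c s r : R) (A : set (plane R)) (T : plane R -> plane R).

Local Notation mu := (@lebesgue_measure R).
Local Notation mu2 := (lebesgue2 R).

Lemma lebesgue_measure_translation c (A : set (measurableTypeR R)) :
  measurable A ->
  pushforward mu (fun y : R => (y + c : measurableTypeR R)) A = mu A.
Proof.
move=> mA; apply/esym/lebesgue_measure_unique => //=.
  exact: measurable_funD.
move=> _ _ [[a b] _ <-].
rewrite /pushforward (_ : _ @^-1` _ = `](a - c), (b - c)]%classic).
  by rewrite !lebesgue_measure_itv/= !lte_fin ltrD2r -!EFinB opprB addrA subrK.
by apply/seteqP; split => x /=; rewrite !in_itv/= ltrBlDr lerBrDr.
Qed.

Definition preserves T := measurable_fun setT T /\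
  forall A, measurable A -> mu2 (T @^-1` A) = mu2 A.

Lemma preserves_comp T T' : preserves T -> preserves T' -> preserves (T \o T').
Proof.
move=> [mT pT] [mT' pT']; split; first exact: measurableT_comp.
move=> A mA; rewrite comp_preimage pT' ?pT//.
by rewrite -[X in measurable X]setTI; exact: mT.
Qed.

Lemma shear2_preserves c : preserves (fun p : plane R => (p.1, (p.2 : R) + c * (p.1 : R))).
Proof.
have mT : measurable_fun setT (fun p : plane R => (p.1, (p.2 : R) + c * (p.1 : R)) : plane R).
  apply/measurable_fun_pairP; split => /=.
    exact: measurable_fst.
  apply: measurable_funD => /=; first exact: measurable_snd.
  apply: measurable_funM; first exact: measurable_cst.
  exact: measurable_fst.
split; first exact: mT.
move=> A mA; rewrite /product_measure1; apply: eq_integral => x _ /=.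
rewrite -[RHS](lebesgue_measure_translation (c * x)); last exact: measurable_xsection.
by rewrite /pushforward; congr (mu _).
Qed.

Lemma shear1_preserves c : preserves (fun p : plane R => ((p.1 : R) + c * (p.2 : R), p.2)).
Proof.
have mT : measurable_fun setT (fun p : plane R => ((p.1 : R) + c * (p.2 : R), p.2) : plane R).
  apply/measurable_fun_pairP; split => /=; last exact: measurable_snd.
  apply: measurable_funD => /=; first exact: measurable_fst.
  apply: measurable_funM; first exact: measurable_cst.
  exact: measurable_snd.
have pm2E B : measurable B -> mu2 B = product_measure2 mu mu B.
  move=> mB; apply: product_measure_unique => // C D mC mD.
  exact: product_measure2E.
split; first exact: mT.
move=> A mA; rewrite !pm2E//; last by rewrite -[X in measurable X]setTI; exact: mT.
rewrite /product_measure2; apply: eq_integral => y _ /=.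
rewrite -[RHS](lebesgue_measure_translation (c * y)); last exact: measurable_ysection.
by rewrite /pushforward; congr (mu _).
Qed.

Definition rotate c s (p : plane R) : plane R :=
  (c * (p.1 : R) - s * (p.2 : R), s * (p.1 : R) + c * (p.2 : R)).

(** A rotation is a product of three shears, and a shear translates each line
    parallel to an axis. The decomposition divides by 1 + c, so the half turn is
    treated as the square of a quarter turn. *)
Lemma rotate_preserves c s : c ^+ 2 + s ^+ 2 = 1 -> preserves (rotate c s).
Proof.
wlog c1 : c s / 1 + c != 0.
  move=> H cs; have [c1|] := eqVneq (1 + c) 0; last by move=> c1; exact: H.
  have sE : s = 0 by apply/eqP; rewrite -sqrf_eq0; apply/eqP; move: c1 cs => /eqP; rewrite addrC addr_eq0 => /eqP ->; lra.
  have -> : rotate c s = rotate 0 1 \o rotate 0 1.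
    move/eqP: c1; rewrite addrC addr_eq0 => /eqP ->; rewrite sE.
    by apply/funext => -[x y]; rewrite /rotate /=; congr pair; ring.
  apply: preserves_comp; apply: H; rewrite ?addr0 ?oner_eq0//; ring.
move=> cs; pose t := s / (1 + c).
(* t is the tangent of half the angle of rotation. *)
have -> : rotate c s = (fun p : plane R => ((p.1 : R) + - t * (p.2 : R), p.2)) \o
   (fun p : plane R => (p.1, (p.2 : R) + s * (p.1 : R))) \o
   (fun p : plane R => ((p.1 : R) + - t * (p.2 : R), p.2)).
  apply/funext => -[x y]; rewrite /rotate /=.
  have st : s * t = 1 - c.
    rewrite /t mulrA -expr2; have -> : s ^+ 2 = 1 - c ^+ 2 by rewrite -cs; ring.
    by field.
  have tc : t * (1 + c) = s by rewrite /t divfK.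
  congr pair.
    transitivity (x - (s * t) * x - t * (1 + (1 - s * t)) * y); last ring.
    rewrite st subKr tc; ring.
  transitivity (y * (1 - s * t) + s * x); last ring.
  by rewrite st subKr; ring.
by do !apply: preserves_comp; first [exact: shear1_preserves|exact: shear2_preserves].
Qed.

Lemma measurable_sqnorm : measurable_fun setT (fun p : plane R => (p.1 : R) ^+ 2 + (p.2 : R) ^+ 2).
Proof.
by apply: measurable_funD; apply: measurable_funX; [exact: measurable_fst|exact: measurable_snd].
Qed.

Lemma discE (r : R) : 0 < r -> disc r = [set p : plane R | (p.1 : R) ^+ 2 + (p.2 : R) ^+ 2 < r ^+ 2].
Proof.
move=> r0; apply/seteqP; split => p; rewrite /disc /euclid /=.
  by move=> pr; rewrite -(sqr_sqrtr (_ : 0 <= (p.1 : R) ^+ 2 + (p.2 : R) ^+ 2)) ?addr_ge0 ?sqr_ge0// ltrXn2r// ?sqrtr_ge0// ltW.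
by move=> pr; rewrite -(gtr0_norm r0) -sqrtr_sqr ltr_sqrt// exprn_gt0.
Qed.

Lemma measurable_disc (r : R) : 0 < r -> measurable (disc r : set (plane R)).
Proof.
move=> r0; rewrite discE// -[X in measurable X]setTI.
rewrite (_ : [set _ | _] = (fun p : plane R => (p.1 : R) ^+ 2 + (p.2 : R) ^+ 2) @^-1` `]-oo, r ^+ 2[).
  by apply: measurable_sqnorm => //; exact: measurable_itv.
by apply/seteqP; split => p /=; rewrite in_itv.
Qed.

Lemma rotate_disc c s r : c ^+ 2 + s ^+ 2 = 1 -> 0 < r -> rotate c s @^-1` disc r = disc r.
Proof.
move=> cs r0; rewrite discE//; apply/seteqP.
have E (x y : R) : (c * x - s * y) ^+ 2 + (s * x + c * y) ^+ 2 = x ^+ 2 + y ^+ 2.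
  by rewrite -[RHS]mul1r -cs; ring.
by split=> -[x y] /=; rewrite E.
Qed.

Lemma disc_lty r : 0 < r -> (mu2 (disc r) < +oo)%E.
Proof.
move=> r0; apply: (@le_lt_trans _ _ (mu2 (`[- r, r]%classic `*` `[- r, r]%classic))).
  apply: le_measure; rewrite ?inE.
  - exact: measurable_disc.
  - by apply: measurableX; exact: measurable_itv.
  - rewrite discE// => -[x y] /= xyr; rewrite !in_itv/=.
    by split; apply/andP; split; nra.
rewrite product_measure1E//; do ?exact: measurable_itv.
rewrite -[ltLHS]/(mu `[(- r)%R, r]%classic * mu `[(- r)%R, r]%classic)%E.
by rewrite lebesgue_measure_itv/= lte_fin; case: ifPn => _; rewrite ?mul0e// -EFinB -EFinM ltry.
Qed.

Lemma disc_gt0 r : 0 < r -> (0 < mu2 (disc r))%E.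
Proof.
move=> r0; apply: (@lt_le_trans _ _ (mu2 (`]0, (r / 2)]%classic `*` `]0, (r / 2)]%classic))).
  rewrite product_measure1E//; do ?exact: measurable_itv.
  rewrite -[ltRHS]/(mu `]0%R, (r / 2)%R]%classic * mu `]0%R, (r / 2)%R]%classic)%E.
  rewrite lebesgue_measure_itv/= lte_fin divr_gt0// -EFinB -EFinM lte_fin.
  by rewrite subr0 mulr_gt0// divr_gt0.
apply: le_measure; rewrite ?inE.
- by apply: measurableX; exact: measurable_itv.
- exact: measurable_disc.
- by rewrite discE// => -[x y] /= []; rewrite !in_itv/= => /andP[x0 xr] /andP[y0 yr]; nra.
Qed.

Lemma integral_rotate c s r (f : plane R -> R) : c ^+ 2 + s ^+ 2 = 1 -> 0 < r ->
  mu2.-integrable (disc r) (EFin \o f) ->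
  mu2.-integrable (disc r) (EFin \o (f \o rotate c s)) ->
  Rintegral mu2 (disc r) (f \o rotate c s) = Rintegral mu2 (disc r) f.
Proof.
move=> cs r0 intf intfr; rewrite /Rintegral; congr fine.
have [mT pT] := rotate_preserves cs; have mD := measurable_disc r0.
pose g := (EFin \o f) \_ (disc r).
transitivity (\int[mu2]_(x in rotate c s @^-1` disc r) (g \o rotate c s) x)%E.
  rewrite rotate_disc//; apply: eq_integral => x; rewrite inE => Dx /=.
  rewrite /g patchE; case: ifPn => [//|]; rewrite notin_setE => -[].
  by rewrite -[disc r _]/((rotate c s @^-1` disc r) x) rotate_disc.
have mf : measurable_fun (disc r) f.
  by apply/measurable_EFinP; exact: measurable_int intf.
have mg : measurable_fun setT g.
  by apply/(measurable_restrictT _ mD)/measurable_EFinP.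
have grE : {in disc r, EFin \o (f \o rotate c s) =1 g \o rotate c s}.
  move=> x; rewrite inE => Dx; rewrite /= /g patchE; case: ifPn => [//|].
  rewrite notin_setE => -[].
  by rewrite -[disc r _]/((rotate c s @^-1` disc r) x) rotate_disc.
have intg : mu2.-integrable (rotate c s @^-1` disc r) (g \o rotate c s).
  by rewrite rotate_disc//; apply: eq_integrable intfr; [exact: mD|exact: grE].
rewrite -(integral_pushforward mT mg intg mD).
transitivity (\int[mu2]_(x in disc r) g x)%E.
  by apply: eq_measure_integral => A mA _; exact: pT.
by apply: eq_integral => x xD; rewrite /g patchE xD.
Qed.

End Rotations.

(** * Integrals of radial functions over the disc *)

Lemma coordinate_le (R : realType) (x y r : R) :
  0 < r -> x ^+ 2 + y ^+ 2 < r ^+ 2 -> `|x| <= r.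
Proof. by move=> r0 H; rewrite ler_norml; apply/andP; split; nra. Qed.

Lemma disc_section (R : realType) (s r x y : R) : 0 < s -> s ^+ 2 = r ^+ 2 - y ^+ 2 ->
  (x ^+ 2 + y ^+ 2 < r ^+ 2) = (- s < x < s).
Proof.
move=> s0 s2; apply/idP/idP; last by move=> /andP[h1 h2]; nra.
by move=> H; apply/andP; split; nra.
Qed.

Section BoundedMeasurable.
Context {R : realType}.
Variable r : R.
Hypothesis r0 : 0 < r.
Local Notation mu := (@lebesgue_measure R).
Local Notation mu2 := (lebesgue2 R).
Implicit Types (f g : plane R -> R).

(** A class of integrable functions on the disc that is closed under products. *)
Definition bounded_measurable f :=
  measurable_fun (disc r) f /\ exists C, forall p, disc r p -> `|f p| <= C.

Definition sqnorm (p : plane R) : R := (p.1 : R) ^+ 2 + (p.2 : R) ^+ 2.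

Lemma sqnorm_ge0 p : 0 <= sqnorm p.
Proof. by rewrite /sqnorm addr_ge0 ?sqr_ge0. Qed.

Lemma in_discE p : disc r p <-> sqnorm p < r ^+ 2.
Proof. by rewrite (discE r0). Qed.

Lemma bm_cst c : bounded_measurable (cst c).
Proof. by split; [exact: measurable_cst|exists `|c|]. Qed.

Lemma bm_fst : bounded_measurable (fun p => p.1).
Proof.
split; first exact: measurable_funTS measurable_fst.
by exists r => p /in_discE; exact: coordinate_le.
Qed.

Lemma bm_snd : bounded_measurable (fun p => p.2).
Proof.
split; first exact: measurable_funTS measurable_snd.
by exists r => p /in_discE H; apply: (@coordinate_le _ p.2 p.1) => //; rewrite addrC.
Qed.

Lemma bmD f g : bounded_measurable f -> bounded_measurable g ->
  bounded_measurable (fun p => f p + g p).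
Proof.
move=> [mf [C fC]] [mg [D gD]]; split; first exact: measurable_funD.
by exists (C + D) => p Dp; rewrite (le_trans (ler_normD _ _))// lerD ?fC ?gD.
Qed.

Lemma bmN f : bounded_measurable f -> bounded_measurable (fun p => - f p).
Proof.
move=> [mf [C fC]]; split; first exact: measurable_funN.
by exists C => p Dp; rewrite normrN fC.
Qed.

Lemma bmB f g : bounded_measurable f -> bounded_measurable g ->
  bounded_measurable (fun p => f p - g p).
Proof. by move=> bf bg; apply: bmD => //; exact: bmN. Qed.

Lemma bmM f g : bounded_measurable f -> bounded_measurable g ->
  bounded_measurable (fun p => f p * g p).
Proof.
move=> [mf [C fC]] [mg [D gD]]; split; first exact: measurable_funM.
by exists (C * D) => p Dp; rewrite normrM ler_pM ?fC ?gD.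
Qed.

Lemma bmX f n : bounded_measurable f -> bounded_measurable (fun p => f p ^+ n).
Proof.
move=> bf; elim: n => [|n IH]; first exact: (bm_cst 1).
rewrite (_ : (fun _ => _) = (fun p => f p * f p ^+ n)); first exact: bmM.
by apply/funext => p; rewrite exprS.
Qed.

Lemma bm_comp (h : R -> R) f (a b : R) : bounded_measurable f ->
  (forall p, disc r p -> f p \in `[a, b]) -> (forall x, x \in `[a, b] -> {for x, continuous h}) ->
  bounded_measurable (fun p => h (f p)).
Proof.
move=> [mf _] fI ch.
have [ab|ba] := leP a b; last first.
  have e : disc r = set0.
    apply/seteqP; split => // p /fI; rewrite in_itv/= => /andP[ap pb].
    by have := le_trans ap pb; rewrite leNgt ba.
  by rewrite /bounded_measurable e; split; [exact: measurable_fun_set0|exists 0].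
have cI : {within `[a, b], continuous h}.
  by apply: continuous_in_subspaceT => x; rewrite inE; exact: ch.
have mh : measurable_fun `[a, b] h.
  by apply: subspace_continuous_measurable_fun => //; exact: measurable_itv.
split.
  apply: (measurable_comp (F := `[a, b]%classic)) => //.
  by move=> _ [p Dp <-]; exact: fI.
have [M MI HM] := EVT_max ab cI; have [m mI Hm] := EVT_min ab cI.
exists (Num.max `|h M| `|h m|) => p Dp; have fpI := fI p Dp.
have := HM _ fpI; have := Hm _ fpI; rewrite ler_norml le_max => h1 h2.
have := ler_norm (h M); have := ler_norm (- h m); rewrite normrN => h3 h4.
rewrite lerNl le_max; apply/andP; split; apply/orP; [right|left]; lra.
Qed.

Lemma bm_sqnorm_comp (h : R -> R) : continuous h ->
  bounded_measurable (fun p => h (sqnorm p)).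
Proof.
move=> ch; apply: (@bm_comp h sqnorm 0 (r ^+ 2)) => //.
- by apply: bmD; apply: bmX; [exact: bm_fst|exact: bm_snd].
- by move=> p /in_discE /ltW pr; rewrite in_itv/= sqnorm_ge0.
- by move=> x _; exact: ch.
Qed.

Lemma bm_integrable f : bounded_measurable f -> mu2.-integrable (disc r) (EFin \o f).
Proof.
move=> [mf [C fC]]; apply: measurable_bounded_integrable => //.
- exact: measurable_disc.
- exact: disc_lty.
- exists C; split; first exact: num_real.
  by move=> x Cx p Dp; apply: (le_trans (fC p Dp)); exact: ltW.
Qed.

(** On the chord at height y the integrand is the derivative of
    x g(x^2 + y^2), which vanishes at both ends of the chord. *)
Lemma radial_line_integral (g dg : R -> R) (y : R) :
  (forall x : R, is_derive x 1 g (dg x)) -> continuous dg -> g (r ^+ 2) = 0 ->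
  (\int[mu]_x (((fun p => g (sqnorm p) + 2 * (p.1 : R) ^+ 2 * dg (sqnorm p)) \_ (disc r)) (x, y))%:E = 0)%E.
Proof.
move=> gd cdg gr.
have cg : continuous g by move=> x; exact: is_derive_continuous (gd x).
have [yr|ry] := ltP `|y| r; last first.
  rewrite integral0_eq// => x _; rewrite patchE; case: ifPn => //.
  rewrite inE => /in_discE; rewrite /sqnorm /= ltNge.
  suff -> : r ^+ 2 <= (x : R) ^+ 2 + y ^+ 2 by [].
  apply: (@le_trans _ _ (y ^+ 2)); last by rewrite lerDr sqr_ge0.
  by rewrite -(real_normK (num_real y)) ler_pXn2r// ?nnegrE// ltW.
pose s : R := Num.sqrt (r ^+ 2 - y ^+ 2).
have ry0 : 0 < r ^+ 2 - y ^+ 2.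
  by rewrite subr_gt0 -(real_normK (num_real y)) ltrXn2r// ltW.
have s0 : 0 < s by rewrite sqrtr_gt0.
have s2 : s ^+ 2 = r ^+ 2 - y ^+ 2 by rewrite sqr_sqrtr// ltW.
pose h x := g (x ^+ 2 + y ^+ 2) + 2 * x ^+ 2 * dg (x ^+ 2 + y ^+ 2).
have cq : continuous (fun x : R => x ^+ 2 + y ^+ 2).
  by move=> x; apply: cvgD; [exact: exprn_continuous|exact: cvg_cst].
have ch : continuous h.
  move=> x; apply: cvgD.
    by apply: (@continuous_comp _ _ _ (fun x : R => x ^+ 2 + y ^+ 2)); [exact: cq|exact: cg].
  apply: cvgM; last first.
    by apply: (@continuous_comp _ _ _ (fun x : R => x ^+ 2 + y ^+ 2)); [exact: cq|exact: cdg].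
  by apply: cvgM; [exact: cvg_cst|exact: exprn_continuous].
transitivity (\int[mu]_(x in `](- s)%R, s[) (h x)%:E)%E.
  rewrite [RHS]integral_mkcond; apply: eq_integral => x _; rewrite !patchE.
  have -> : ((x, y) \in disc r) = (x \in `]- s, s[%classic).
    apply/idP/idP => [/set_mem/in_discE H|/set_mem H]; apply/mem_set.
      by rewrite /= in_itv/= -(disc_section _ s0 s2).
    by apply/in_discE; move: H; rewrite /= in_itv/= -(disc_section _ s0 s2).
  by case: ifP.
rewrite -(@integral_itv_bndoo _ _ _ _ true false); last first.
  apply: measurable_funTS; apply/measurable_EFinP.
  exact: continuous_measurable_fun.
pose F (x : R) := x * g (x ^+ 2 + y ^+ 2).
have dF (x : R) : is_derive x 1 F (h x).
  have dq : is_derive x 1 (fun x : R => x ^+ 2 + y ^+ 2) (2 * x).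
    by apply: is_derive_eq; rewrite /GRing.scale /=; ring.
  have dgq := @is_derive1_comp _ g _ x _ _ (gd _) dq.
  by apply: is_derive_eq; rewrite /GRing.scale /= /h; ring.
have ss : - s < s by lra.
rewrite (@continuous_FTC2 _ h F _ _ ss).
- by rewrite /F sqrrN s2 subrK gr !mulr0 subee.
- exact: continuous_subspaceT.
- split.
  + by move=> x _; case: (dF x).
  + by apply: cvg_at_right_filter; exact: is_derive_continuous (dF _).
  + by apply: cvg_at_left_filter; exact: is_derive_continuous (dF _).
- by move=> x _; rewrite derive1E; case: (dF x).
Qed.

(** The integrand is half the divergence of the field g(|x|^2) x, which vanishes
    on the circle; each of its two components is integrated along chords. *)
Lemma radial_integral0 (g dg : R -> R) :
  (forall x : R, is_derive x 1 g (dg x)) -> continuous dg -> g (r ^+ 2) = 0 ->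
  (\int[mu2]_(p in disc r) (g (sqnorm p) + sqnorm p * dg (sqnorm p))%:E = 0)%E.
Proof.
move=> gd cdg gr.
have cg : continuous g by move=> x; exact: is_derive_continuous (gd x).
pose f1 (p : plane R) := g (sqnorm p) + 2 * (p.1 : R) ^+ 2 * dg (sqnorm p).
pose f2 (p : plane R) := g (sqnorm p) + 2 * (p.2 : R) ^+ 2 * dg (sqnorm p).
have b1 : bounded_measurable f1.
  apply: bmD; first exact: bm_sqnorm_comp.
  apply: bmM; last exact: bm_sqnorm_comp.
  by apply: bmM; [exact: bm_cst|exact: bmX bm_fst].
have b2 : bounded_measurable f2.
  apply: bmD; first exact: bm_sqnorm_comp.
  apply: bmM; last exact: bm_sqnorm_comp.
  by apply: bmM; [exact: bm_cst|exact: bmX bm_snd].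
have mD := measurable_disc r0.
have i1 := bm_integrable b1; have i2 := bm_integrable b2.
have I1 : (\int[mu2]_(p in disc r) (f1 p)%:E = 0)%E.
  rewrite integral_mkcond -integral21_prod_meas1; last exact/(integrable_mkcond _ mD).
  rewrite integral0_eq// => y _.
  rewrite -[RHS](radial_line_integral y gd cdg gr).
  by apply: eq_integral => x _; rewrite !patchE; case: ifP.
have I2 : (\int[mu2]_(p in disc r) (f2 p)%:E = 0)%E.
  rewrite integral_mkcond -integral12_prod_meas1; last exact/(integrable_mkcond _ mD).
  rewrite integral0_eq// => x _.
  rewrite -[RHS](radial_line_integral x gd cdg gr).
  apply: eq_integral => y _; rewrite !patchE.
  have -> : ((x, y) \in disc r) = ((y, x) \in disc r).
    by apply/idP/idP => /set_mem/in_discE H; apply/mem_set/in_discE; move: H; rewrite /sqnorm addrC.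
  have e : sqnorm (x, y) = sqnorm (y, x) by rewrite /sqnorm addrC.
  by case: ifP => // _; rewrite /f2 e.
transitivity (\int[mu2]_(p in disc r) ((2^-1)%:E * ((f1 p)%:E + (f2 p)%:E)))%E.
  apply: eq_integral => p _; rewrite -EFinD -EFinM; congr EFin.
  have half (a b G D : R) : G + (a ^+ 2 + b ^+ 2) * D =
      2^-1 * ((G + 2 * a ^+ 2 * D) + (G + 2 * b ^+ 2 * D)) by field.
  exact: half.
rewrite integralZl//; last exact: integrableD.
by rewrite integralD// I1 I2 adde0 mule0.
Qed.

(** Subtracting the boundary value of g reduces to a field that vanishes on the
    circle. The statement is the fundamental theorem of calculus in the variable
    |x|^2: the integrand is the derivative of |x|^2 g(|x|^2). *)
Lemma radial_integral (g dg : R -> R) :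
  (forall x : R, is_derive x 1 g (dg x)) -> continuous dg ->
  Rintegral mu2 (disc r) (fun p => g (sqnorm p) + sqnorm p * dg (sqnorm p)) =
  g (r ^+ 2) * fine (mu2 (disc r)).
Proof.
move=> gd cdg; pose g0 x := g x - g (r ^+ 2).
have g0d (x : R) : is_derive x 1 g0 (dg x).
  by have gx := gd x; apply: is_derive_eq; rewrite subr0.
have H := @radial_integral0 g0 dg g0d cdg (subrr _).
have cg : continuous g by move=> x; exact: is_derive_continuous (gd x).
have mD := measurable_disc r0.
apply/eqP; rewrite -subr_eq0; apply/eqP.
rewrite -Rintegral_cst// -RintegralB//.
- rewrite /Rintegral -[RHS]/(fine 0%E) -H; congr fine; apply: eq_integral => p _.
  by rewrite /g0; congr EFin; ring.
- apply: bm_integrable; apply: bmD; first exact: bm_sqnorm_comp.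
  apply: bmM; last exact: bm_sqnorm_comp.
  by apply: (bm_sqnorm_comp (h := id)) => x; exact: cvg_id.
- by apply: bm_integrable; exact: bm_cst.
Qed.

End BoundedMeasurable.

Local Open Scope complex_scope.
Local Notation "z ^*" := (conjc z) : ring_scope.
Local Notation "''i'" := (Complex 0 1) : ring_scope.

(** * Differentiation of complex-valued curves *)

Section ComplexCalculus.
Context {R : realType}.
Implicit Types (f g : R -> R[i]) (x : R) (z w : R[i]).

Local Notation Re := (@complex.Re R).
Local Notation Im := (@complex.Im R).

Lemma ReD z w : Re (z + w) = Re z + Re w. Proof. by case: z w => a b []. Qed.
Lemma ImD z w : Im (z + w) = Im z + Im w. Proof. by case: z w => a b []. Qed.
Lemma ReN z : Re (- z) = - Re z. Proof. by case: z. Qed.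
Lemma ImN z : Im (- z) = - Im z. Proof. by case: z. Qed.
Lemma ReM z w : Re (z * w) = Re z * Re w - Im z * Im w. Proof. by case: z w => a b []. Qed.
Lemma ImM z w : Im (z * w) = Re z * Im w + Im z * Re w. Proof. by case: z w => a b []. Qed.
Lemma ReJ z : Re z^* = Re z. Proof. by case: z. Qed.
Lemma ImJ z : Im z^* = - Im z. Proof. by case: z. Qed.
Lemma ReC x : Re x%:C = x. Proof. by []. Qed.
Lemma ImC x : Im x%:C = 0. Proof. by []. Qed.
Lemma eqc z w : Re z = Re w -> Im z = Im w -> z = w.
Proof. by case: z w => a b [c d] /= -> ->. Qed.

(** The squared modulus, which unlike the modulus is differentiable along every
    differentiable curve. *)
Definition nsq z : R := Re z ^+ 2 + Im z ^+ 2.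

Lemma nsq_ge0 z : 0 <= nsq z. Proof. by rewrite /nsq addr_ge0 ?sqr_ge0. Qed.
Lemma nsq_eq0 z : nsq z = 0 -> z = 0.
Proof.
move=> /eqP; rewrite /nsq paddr_eq0 ?sqr_ge0// !sqrf_eq0 => /andP[/eqP a /eqP b].
exact: eqc.
Qed.
Lemma nsqE z : (nsq z)%:C = z * z^*.
Proof. by case: z => a b; apply: eqc; rewrite /= /nsq/=; ring. Qed.
Lemma nsqM z w : nsq (z * w) = nsq z * nsq w.
Proof. by rewrite /nsq ReM ImM; ring. Qed.
Lemma nsqN z : nsq (- z) = nsq z. Proof. by rewrite /nsq ReN ImN !sqrrN. Qed.
Lemma nsqJ z : nsq z^* = nsq z. Proof. by rewrite /nsq ReJ ImJ sqrrN. Qed.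
Lemma nsqC x : nsq x%:C = x ^+ 2. Proof. by rewrite /nsq /= expr0n addr0. Qed.

Lemma nsq_sub_gt0 z w : nsq w < nsq z -> 0 < nsq (z - w).
Proof.
move=> zw; rewrite lt_neqAle nsq_ge0 andbT eq_sym; apply/eqP => /nsq_eq0/eqP.
by rewrite subr_eq0 => /eqP zw'; rewrite zw' ltxx in zw.
Qed.

Definition cderive f x z :=
  is_derive x 1 (fun t => Re (f t)) (Re z) /\ is_derive x 1 (fun t => Im (f t)) (Im z).

Lemma cderive_eq f x z w : cderive f x z -> z = w -> cderive f x w.
Proof. by move=> + <-. Qed.

Lemma cderive_cst z x : cderive (fun=> z) x 0.
Proof. by split; exact: is_derive_cst. Qed.

Lemma cderiveD f g x z w : cderive f x z -> cderive g x w ->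
  cderive (fun t => f t + g t) x (z + w).
Proof.
move=> [f1 f2] [g1 g2]; split.
  rewrite (_ : (fun t => _) = (fun t => Re (f t) + Re (g t))).
    by apply: is_derive_eq; rewrite ReD.
  by apply/funext => t; rewrite ReD.
rewrite (_ : (fun t => _) = (fun t => Im (f t) + Im (g t))).
  by apply: is_derive_eq; rewrite ImD.
by apply/funext => t; rewrite ImD.
Qed.

Lemma cderiveM f g x z w : cderive f x z -> cderive g x w ->
  cderive (fun t => f t * g t) x (z * g x + f x * w).
Proof.
move=> [f1 f2] [g1 g2]; split.
  rewrite (_ : (fun t => _) = (fun t => Re (f t) * Re (g t) - Im (f t) * Im (g t))).
    by apply: is_derive_eq; rewrite ReD !ReM /GRing.scale /=; ring.
  by apply/funext => t; rewrite ReM.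
rewrite (_ : (fun t => _) = (fun t => Re (f t) * Im (g t) + Im (f t) * Re (g t))).
  by apply: is_derive_eq; rewrite ImD !ImM /GRing.scale /=; ring.
by apply/funext => t; rewrite ImM.
Qed.

Lemma cderiveZ f x z w : cderive f x w -> cderive (fun t => z * f t) x (z * w).
Proof.
move=> fw; apply: cderive_eq (cderiveM (cderive_cst z x) fw) _.
by rewrite mul0r add0r.
Qed.

Lemma cderiveB f g x z w : cderive f x z -> cderive g x w ->
  cderive (fun t => f t - g t) x (z - w).
Proof.
move=> fz gw; have := cderiveD fz (cderiveZ (-1) gw).
by rewrite mulN1r; under eq_fun do rewrite mulN1r.
Qed.

Lemma cderiveX f x z n : cderive f x z ->
  cderive (fun t => f t ^+ n) x (n%:R * f x ^+ n.-1 * z).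
Proof.
move=> fz; elim: n => [|n IH].
  by apply: cderive_eq (cderive_cst 1 x) _; rewrite !mul0r.
have -> : (fun t => f t ^+ n.+1) = (fun t => f t * f t ^+ n).
  by apply/funext => t; rewrite exprS.
apply: cderive_eq (cderiveM fz IH) _; case: n {IH} => [|n].
  by rewrite !expr0; ring.
by rewrite -[n.+2%:R]natr1 exprS /=; ring.
Qed.

Lemma cderiveC (g : R -> R) x d : is_derive x 1 g d -> cderive (fun t => (g t)%:C) x d%:C.
Proof. by move=> gd; split => //; exact: is_derive_cst. Qed.

Lemma nsq_derive f x z : cderive f x z ->
  is_derive x 1 (fun t => nsq (f t)) (2 * Re ((f x)^* * z)).
Proof.
move=> [f1 f2]; rewrite /nsq; apply: is_derive_eq.
by rewrite ReM ReJ ImJ /GRing.scale /=; ring.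
Qed.

Lemma cderive_uniq f x z w : cderive f x z -> cderive f x w -> z = w.
Proof.
move=> [[_ f1] [_ f2]] [[_ g1] [_ g2]]; apply: eqc.
  by rewrite -f1 -g1.
by rewrite -f2 -g2.
Qed.

Lemma expi0 : expi (0 : R) = 1.
Proof. by rewrite /expi cos0 sin0. Qed.

Lemma expiD x y : expi (x + y) = expi x * expi y.
Proof. by apply: eqc; rewrite ?ReM ?ImM /= ?cosD ?sinD; ring. Qed.

Lemma expiJ x : (expi x)^* = expi (- x).
Proof. by apply: eqc; rewrite /= ?cosN ?sinN. Qed.

Lemma nsq_expi x : nsq (expi x) = 1.
Proof. by rewrite /nsq /= cos2Dsin2. Qed.

Lemma cderive_expi (c x : R) :
  cderive (fun t => expi (c * t)) x (c%:C * 'i * expi (c * x)).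
Proof.
have dl : is_derive x 1 (fun t => c * t) c.
  by apply: is_derive_eq; rewrite /GRing.scale /= mulr1.
split.
  have := @is_derive1_comp _ cos _ x _ _ (is_derive_cos _) dl.
  by move=> /is_derive_eq; apply; rewrite /GRing.scale /=; ring.
have := @is_derive1_comp _ sin _ x _ _ (is_derive_sin _) dl.
by move=> /is_derive_eq; apply; rewrite /GRing.scale /=; ring.
Qed.

Lemma expi_natM (n : nat) x : expi (n%:R * x) = expi x ^+ n.
Proof.
elim: n => [|n IH]; first by rewrite mul0r expi0.
by rewrite -natr1 mulrDl mul1r expiD IH exprSr.
Qed.

Lemma expi_2pi (m : int) : expi (m%:~R * (2 * pi)) = 1 :> R[i].
Proof.
have H (n : nat) : expi (n%:R * (2 * pi)) = 1 :> R[i].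
  by rewrite expi_natM /expi mulr_natl cos2pi sin2pi expr1n.
case: m => n; first exact: H.
rewrite NegzE mulrNz mulNr -expiJ.
by have := H n.+1; rewrite -pmulrn => ->; rewrite conjc1.
Qed.

End ComplexCalculus.

(** * Complex integrals over the circle *)

Section CircleIntegral.
Context {R : realType}.
Implicit Types (f g : R -> R[i]) (x : R) (z w : R[i]).

Local Notation Re := (@complex.Re R).
Local Notation Im := (@complex.Im R).
Local Notation mu := (@lebesgue_measure R).
Local Notation circle := (`[0, (2 * pi : R)]%classic).

Definition ccont f := continuous (fun t => Re (f t)) /\ continuous (fun t => Im (f t)).

Lemma ccont_cderive f df : (forall t, cderive f t (df t)) -> ccont f.
Proof.
by move=> fd; split=> t; have [d1 d2] := fd t; [exact: is_derive_continuous d1|exact: is_derive_continuous d2].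
Qed.

Lemma ccont_cst z : ccont (fun=> z).
Proof. by split=> t; exact: cvg_cst. Qed.

Lemma ccontD f g : ccont f -> ccont g -> ccont (fun t => f t + g t).
Proof.
have ReDf : (fun t => Re (f t + g t)) = (fun t => Re (f t) + Re (g t)).
  by apply/funext => t; rewrite ReD.
have ImDf : (fun t => Im (f t + g t)) = (fun t => Im (f t) + Im (g t)).
  by apply/funext => t; rewrite ImD.
move=> [f1 f2] [g1 g2]; rewrite /ccont ReDf ImDf; split => t; apply: cvgD.
- exact: f1. - exact: g1. - exact: f2. - exact: g2.
Qed.

Lemma ccontM f g : ccont f -> ccont g -> ccont (fun t => f t * g t).
Proof.
have ReMf : (fun t => Re (f t * g t)) = (fun t => Re (f t) * Re (g t) - Im (f t) * Im (g t)).
  by apply/funext => t; rewrite ReM.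
have ImMf : (fun t => Im (f t * g t)) = (fun t => Re (f t) * Im (g t) + Im (f t) * Re (g t)).
  by apply/funext => t; rewrite ImM.
move=> [f1 f2] [g1 g2]; rewrite /ccont ReMf ImMf; split => t.
  by apply: cvgB; apply: cvgM; [exact: f1|exact: g1|exact: f2|exact: g2].
by apply: cvgD; apply: cvgM; [exact: f1|exact: g2|exact: f2|exact: g1].
Qed.

Definition cint f : R[i] :=
  Rintegral mu circle (fun t => Re (f t)) +i* Rintegral mu circle (fun t => Im (f t)).

Lemma Re_cint f : Re (cint f) = Rintegral mu circle (fun t => Re (f t)).
Proof. by []. Qed.
Lemma Im_cint f : Im (cint f) = Rintegral mu circle (fun t => Im (f t)).
Proof. by []. Qed.

Lemma circle_integrable (g : R -> R) : continuous g -> mu.-integrable circle (EFin \o g).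
Proof.
move=> cg; apply: continuous_compact_integrable; first exact: segment_compact.
exact: continuous_subspaceT.
Qed.

Lemma cintD f g : ccont f -> ccont g -> cint (fun t => f t + g t) = cint f + cint g.
Proof.
move=> [f1 f2] [g1 g2]; apply: eqc; rewrite ?ReD ?ImD ?Re_cint ?Im_cint.
  by under eq_Rintegral do rewrite ReD; rewrite RintegralD//; exact: circle_integrable.
by under eq_Rintegral do rewrite ImD; rewrite RintegralD//; exact: circle_integrable.
Qed.

Lemma cintZ f z : ccont f -> cint (fun t => z * f t) = z * cint f.
Proof.
move=> [f1 f2].
have i1 := circle_integrable f1; have i2 := circle_integrable f2.
have mc : measurable circle by exact: measurable_itv.
have cZ (c : R) (g : R -> R) : continuous g -> continuous (fun t => c * g t).
  by move=> cg t; apply: cvgM; [exact: cvg_cst|exact: cg].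
apply: eqc; rewrite ?ReM ?ImM !(Re_cint, Im_cint).
  under eq_Rintegral do rewrite ReM.
  by rewrite RintegralB ?RintegralZl//; apply: circle_integrable; exact: cZ.
under eq_Rintegral do rewrite ImM.
by rewrite RintegralD ?RintegralZl//; apply: circle_integrable; exact: cZ.
Qed.

Lemma cint_FTC f df : (forall t, cderive f t (df t)) -> ccont df ->
  cint df = f (2 * pi) - f 0.
Proof.
move=> fd [c1 c2]; have pi0 : (0 : R) < 2 * pi by rewrite mulr_gt0// pi_gt0.
have key (F g : R -> R) : (forall t : R, is_derive t 1 F (g t)) -> continuous g ->
    Rintegral mu circle g = F (2 * pi) - F 0.
  move=> Fg cg; rewrite /Rintegral (@continuous_FTC2 _ g F _ _ pi0)//.
  - exact: continuous_subspaceT.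
  - split.
    + by move=> x _; case: (Fg x).
    + by apply: cvg_at_right_filter; exact: is_derive_continuous (Fg _).
    + by apply: cvg_at_left_filter; exact: is_derive_continuous (Fg _).
  - by move=> x _; rewrite derive1E; case: (Fg x).
apply: eqc; rewrite ?ReD ?ImD ?ReN ?ImN ?Re_cint ?Im_cint.
  by apply: (key (fun t => Re (f t)) (fun t => Re (df t))) c1 => t; case: (fd t).
by apply: (key (fun t => Im (f t)) (fun t => Im (df t))) c2 => t; case: (fd t).
Qed.

Lemma cint_cst z : cint (fun=> z) = (2 * pi)%:C * z.
Proof.
rewrite (@cint_FTC (fun t => t%:C * z)).
- by rewrite mul0r subr0.
- move=> t; apply: cderive_eq (cderiveM (cderiveC (is_derive_id t 1)) (cderive_cst z t)) _.
  by rewrite mulr0 addr0 mul1r.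
- exact: ccont_cst.
Qed.

Lemma derive_under_circle (f df : R -> R -> R) (u v a C : R) : a \in `]u, v[ ->
  (forall r t, r \in `]u, v[ -> is_derive r 1 (f ^~ t) (df r t)) ->
  (forall r, r \in `]u, v[ -> continuous (f r)) ->
  (forall r t, r \in `]u, v[ -> circle t -> `|df r t| <= C) ->
  is_derive a 1 (fun r => Rintegral mu circle (f r)) (Rintegral mu circle (df a)).
Proof.
move=> aI fd cf fC.
have mc : measurable circle by exact: measurable_itv.
have d1E r t : r \in `]u, v[ -> partial1of2 f r t = df r t.
  by move=> rI; rewrite partial1of2E; have [_] := fd r t rI.
have C0 : 0 <= C.
  apply: le_trans (fC a 0 aI _); first exact: normr_ge0.
  by rewrite /= in_itv/= lexx mulr_ge0// pi_ge0.
have iC : mu.-integrable circle (EFin \o (fun=> C)).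
  by apply: circle_integrable => t; exact: cvg_cst.
have if_ r : `]u, v[%classic r -> mu.-integrable circle (EFin \o f r).
  by move=> rI; apply: circle_integrable; exact: cf.
have df1 r t : `]u, v[%classic r -> circle t -> derivable (f ^~ t) r 1.
  by move=> rI _; have [] := fd r t rI.
have bd r t : `]u, v[%classic r -> circle t -> `|partial1of2 f r t| <= (fun=> C) t.
  by move=> rI tI; rewrite d1E//; exact: fC.
have D := @derivable_under_integral R _ (measurableTypeR R) mu f circle mc a u v
  aI if_ df1 (fun=> C) (fun=> C0) iC bd.
have V := @differentiation_under_integral R _ (measurableTypeR R) mu f circle mc a u v
  aI if_ df1 (fun=> C) (fun=> C0) iC bd.
split; first exact: D.
rewrite -derive1E V; apply: eq_Rintegral => t _; exact: d1E.
Qed.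

Lemma cderive_under_circle (f df : R -> R -> R[i]) (u v a C : R) : a \in `]u, v[ ->
  (forall r t, r \in `]u, v[ -> cderive (f ^~ t) r (df r t)) ->
  (forall r, r \in `]u, v[ -> ccont (f r)) ->
  (forall r t, r \in `]u, v[ -> circle t -> nsq (df r t) <= C ^+ 2) -> 0 <= C ->
  cderive (fun r => cint (f r)) a (cint (df a)).
Proof.
move=> aI fd cf fC C0; split.
  apply: (@derive_under_circle (fun r t => Re (f r t)) (fun r t => Re (df r t)) u v a C aI).
  - by move=> r t rI; have [] := fd r t rI.
  - by move=> r rI; have [] := cf r rI.
  - move=> r t rI tI; rewrite -(ler_pXn2r (n := 2))// ?nnegrE// real_normK ?num_real//.
    by apply: le_trans (fC r t rI tI); rewrite /nsq lerDl sqr_ge0.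
apply: (@derive_under_circle (fun r t => Im (f r t)) (fun r t => Im (df r t)) u v a C aI).
- by move=> r t rI; have [] := fd r t rI.
- by move=> r rI; have [] := cf r rI.
- move=> r t rI tI; rewrite -(ler_pXn2r (n := 2))// ?nnegrE// real_normK ?num_real//.
  by apply: le_trans (fC r t rI tI); rewrite /nsq lerDr sqr_ge0.
Qed.

End CircleIntegral.

(** * Cylindrical waves on a circle: the raising and lowering relations *)

Section ComplexBounds.
Context {R : realType}.
Implicit Types (z w : R[i]) (a b : R).

Lemma conjcM z w : (z * w)^* = z^* * w^*. Proof. exact: rmorphM. Qed.
Lemma conjcN z : (- z)^* = - z^*. Proof. exact: rmorphN. Qed.
Lemma conjci : ('i : R[i])^* = - 'i. Proof. by apply: eqc; rewrite /= ?oppr0. Qed.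

Lemma nsqD_le z w : nsq (z + w) <= 2 * (nsq z + nsq w).
Proof.
case: z w => a b [c d]; rewrite /nsq /=.
have := sqr_ge0 (a - c); have := sqr_ge0 (b - d); nra.
Qed.

Lemma nsq_normc z : nsq z = Normc.normc z ^+ 2.
Proof. by case: z => a b; rewrite /nsq /= sqr_sqrtr// addr_ge0 ?sqr_ge0. Qed.

Lemma normc_ge0 z : 0 <= Normc.normc z.
Proof. by case: z => a b; exact: sqrtr_ge0. Qed.

Lemma normc_le z a : 0 <= a -> nsq z <= a ^+ 2 -> Normc.normc z <= a.
Proof. by move=> a0; rewrite nsq_normc ler_pXn2r// nnegrE normc_ge0. Qed.

Lemma nsq_sub_bounds z w a b : 0 <= a -> a < b -> nsq z = b ^+ 2 -> nsq w <= a ^+ 2 ->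
  (b - a) ^+ 2 <= nsq (z - w) <= (b + a) ^+ 2.
Proof.
move=> a0 ab zb wa; have b0 : 0 <= b by exact: le_trans (ltW ab).
have w1 := normc_le a0 wa.
have z1 : Normc.normc z = b.
  by apply/eqP; rewrite -(eqrXn2 (n := 2))// ?normc_ge0// -nsq_normc zb.
have t1 := le_normcD z (- w); rewrite normcN z1 in t1.
have t2 := le_normcD (z - w) w; rewrite subrK z1 in t2.
rewrite nsq_normc; have := normc_ge0 (z - w); move: t1 t2.
move: (Normc.normc (z - w)) (Normc.normc w) w1 => x y yx t1 t2 x0.
by apply/andP; split; rewrite ler_pXn2r ?nnegrE//; lra.
Qed.

(** Bounds uniform in r and t, for differentiation under the integral sign. *)
Definition cbounded (T : Type) (S : set T) (f : T -> R[i]) :=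
  exists C, 0 <= C /\ forall p, S p -> nsq (f p) <= C.

Variables (T : Type) (S : set T).
Implicit Types (f g : T -> R[i]).

Lemma cbounded_cst z : cbounded S (fun=> z).
Proof. by exists (nsq z); rewrite nsq_ge0. Qed.

Lemma cboundedD f g : cbounded S f -> cbounded S g -> cbounded S (fun p => f p + g p).
Proof.
move=> [C [C0 fC]] [D [D0 gD]]; exists (2 * (C + D)); split.
  by rewrite mulr_ge0// addr_ge0.
by move=> p Sp; rewrite (le_trans (nsqD_le _ _))// ler_wpM2l// lerD ?fC ?gD.
Qed.

Lemma cboundedM f g : cbounded S f -> cbounded S g -> cbounded S (fun p => f p * g p).
Proof.
move=> [C [C0 fC]] [D [D0 gD]]; exists (C * D); split; first exact: mulr_ge0.
by move=> p Sp; rewrite nsqM ler_pM ?nsq_ge0 ?fC ?gD.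
Qed.

Lemma cboundedN f : cbounded S f -> cbounded S (fun p => - f p).
Proof. by move=> [C [C0 fC]]; exists C; split=> // p Sp; rewrite nsqN fC. Qed.

Lemma cboundedJ f : cbounded S f -> cbounded S (fun p => (f p)^*).
Proof. by move=> [C [C0 fC]]; exists C; split=> // p Sp; rewrite nsqJ fC. Qed.

Lemma cboundedX f n : cbounded S f -> cbounded S (fun p => f p ^+ n).
Proof.
move=> bf; elim: n => [|n IH]; first exact: (cbounded_cst 1).
rewrite (_ : (fun _ => _) = (fun p => f p * f p ^+ n)); first exact: cboundedM.
by apply/funext => p; rewrite exprS.
Qed.

Lemma cboundedC (h : R -> R) (u : T -> R) a b :
  (forall p, S p -> a <= u p <= b) -> (forall x, a <= x -> {for x, continuous h}) ->
  cbounded S (fun p => (h (u p))%:C).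
Proof.
move=> uI ch; have [ab|ba] := leP a b; last first.
  by exists 0; split=> // p /uI /andP[ap pb]; have := le_trans ap pb; rewrite leNgt ba.
have cI : {within `[a, b], continuous h}.
  by apply: continuous_in_subspaceT => x; rewrite inE/= in_itv/= => /andP[ax _]; exact: ch.
have [M MI HM] := EVT_max ab cI; have [m mI Hm] := EVT_min ab cI.
exists (h M ^+ 2 + h m ^+ 2); split; first by rewrite addr_ge0 ?sqr_ge0.
move=> p Sp; rewrite nsqC; have upI : u p \in `[a, b] by rewrite in_itv/= uI.
have := HM _ upI; have := Hm _ upI; move: (h M) (h m) (h (u p)) => x y z yz zx.
have [z0|z0] := leP 0 z.
  by rewrite (@le_trans _ _ (x ^+ 2))// ?lerDl ?sqr_ge0//; nra.
by rewrite (@le_trans _ _ (y ^+ 2))// ?lerDr ?sqr_ge0//; nra.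
Qed.

Lemma ccontJ (f : R -> R[i]) : ccont f -> ccont (fun t => (f t)^*).
Proof.
move=> [f1 f2]; split.
  rewrite (_ : (fun _ => _) = (fun t => complex.Re (f t)))//.
  by apply/funext => t; rewrite ReJ.
rewrite (_ : (fun _ => _) = (fun t => - complex.Im (f t))).
  by move=> t; apply: cvgN; exact: f2.
by apply/funext => t; rewrite ImJ.
Qed.

Lemma ccontX (f : R -> R[i]) n : ccont f -> ccont (fun t => f t ^+ n).
Proof.
move=> bf; elim: n => [|n IH]; first exact: (ccont_cst 1).
rewrite (_ : (fun _ => _) = (fun p => f p * f p ^+ n)); first exact: ccontM.
by apply/funext => p; rewrite exprS.
Qed.

Lemma ccontN (f : R -> R[i]) : ccont f -> ccont (fun t => - f t).
Proof.
move=> cf; rewrite (_ : (fun _ => _) = (fun t => (-1) * f t)).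
  by apply: ccontM => //; exact: ccont_cst.
by apply/funext => p; rewrite mulN1r.
Qed.

End ComplexBounds.

Section Graf.
Context {R : realType}.
Variables (G : nat -> R -> R) (kap : R) (X om : R[i]).
Implicit Types (r t : R) (j : nat) (m : int).
Hypothesis cG : cylinder G.
Hypothesis kap_gt0 : 0 < kap.
Hypothesis om1 : nsq om = 1.

(** With p = |p| e^(ia), this is a cylindrical wave F_j(kappa |p|^2) |p|^j e^(ija)
    of order j evaluated at the displacement p from its centre. *)
Definition cylinder_mode j (p : R[i]) : R[i] := (G j (kap * nsq p))%:C * p ^+ j.

(** The differential of the mode at p, applied to the direction z. *)
Definition cylinder_mode_deriv j (p z : R[i]) : R[i] :=
  - (kap%:C * (p^* * z + p * z^*)) * ((G j.+1 (kap * nsq p))%:C * p ^+ j)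
  + (G j (kap * nsq p))%:C * (j%:R * p ^+ j.-1 * z).

Lemma cderive_radial j (p : R -> R[i]) x z : 0 < nsq (p x) -> cderive p x z ->
  cderive (fun t => (G j (kap * nsq (p t)))%:C) x
    (- (kap%:C * ((p x)^* * z + p x * z^*)) * (G j.+1 (kap * nsq (p x)))%:C).
Proof.
move=> p0 pz; have kp : 0 < kap * nsq (p x) by rewrite mulr_gt0.
have dn := nsq_derive pz; have [dG _] := cG j kp.
have dk : is_derive x 1 (fun t => kap * nsq (p t)) (kap * (2 * complex.Re ((p x)^* * z))).
  by apply: is_derive_eq; rewrite /GRing.scale.
have dGp := @is_derive1_comp _ (G j) _ x _ _ dG dk.
apply: cderive_eq (cderiveC dGp) _.
have -> : (p x)^* * z + p x * z^* = (2 * complex.Re ((p x)^* * z))%:C.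
  have -> : p x * z^* = ((p x)^* * z)^* by rewrite rmorphM /= conjcK.
  by rewrite addcJ rmorphM rmorph_nat.
rewrite /GRing.scale /= -!rmorphM -rmorphN -rmorphM /=; congr (_%:C); ring.
Qed.

Lemma cderive_mode j (p : R -> R[i]) x z : 0 < nsq (p x) -> cderive p x z ->
  cderive (fun t => cylinder_mode j (p t)) x (cylinder_mode_deriv j (p x) z).
Proof.
move=> p0 pz; apply: cderive_eq (cderiveM (cderive_radial j p0 pz) (cderiveX j pz)) _.
by rewrite /cylinder_mode_deriv; ring.
Qed.

(** The vector from the point r om e^(it), which runs over the circle of radius
    r, to the fixed point X. *)
Definition displacement r t : R[i] := X - r%:C * (om * expi t).

Lemma cderive_displacement_r r t :
  cderive (displacement ^~ t) r (- (om * expi t)).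
Proof.
apply: cderive_eq (cderiveB (cderive_cst X r)
  (cderiveM (cderiveC (is_derive_id r 1)) (cderive_cst (om * expi t) r))) _.
by rewrite mul1r mulr0 addr0 sub0r.
Qed.

Lemma cderive_expi1 t : cderive (@expi R) t ('i * expi t).
Proof.
have := cderive_expi 1 t; rewrite mul1r (_ : 1%:C = 1)// mul1r.
by under eq_fun do rewrite mul1r.
Qed.

Lemma cderive_displacement_t r t :
  cderive (displacement r) t (- (r%:C * 'i * (om * expi t))).
Proof.
apply: cderive_eq (cderiveB (cderive_cst X t)
  (cderiveZ r%:C (cderiveZ om (cderive_expi1 t)))) _.
by ring.
Qed.

(** The radial derivative differs from a multiple of the angular one by the mode
    of the next order: in complex notation a combination of the two is the
    derivative in the conjugate variable, which raises the order of a
    cylindrical wave. The other combination lowers it. *)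
Lemma mode_raising j (r : R) (p tau : R[i]) :
  r%:C * 'i * cylinder_mode_deriv j p (- tau) =
  cylinder_mode_deriv j p (- (r%:C * 'i * tau)) +
  2 * kap%:C * (r%:C * 'i) * tau^* * cylinder_mode j.+1 p.
Proof.
rewrite /cylinder_mode_deriv /cylinder_mode !conjcN !conjcM conjc_real conjci.
by rewrite exprS; ring.
Qed.

Lemma mode_lowering j (r : R) (p tau : R[i]) : 0 < nsq p ->
  r%:C * 'i * cylinder_mode_deriv j.+1 p (- tau) =
  - cylinder_mode_deriv j.+1 p (- (r%:C * 'i * tau)) -
  2 * (r%:C * 'i) * tau * cylinder_mode j p.
Proof.
move=> p0; have [_ H] := cG j (mulr_gt0 kap_gt0 p0).
rewrite /cylinder_mode_deriv /cylinder_mode !conjcN !conjcM conjc_real conjci.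
have -> : (G j (kap * nsq p))%:C = j.+1%:R * (G j.+1 (kap * nsq p))%:C
    - kap%:C * (p * p^*) * (G j.+2 (kap * nsq p))%:C.
  have -> : G j (kap * nsq p) = j.+1%:R * G j.+1 (kap * nsq p) - kap * nsq p * G j.+2 (kap * nsq p).
    by rewrite H opprB addrCA subrr addr0.
  by rewrite rmorphB !rmorphM rmorph_nat /= -nsqE.
by rewrite exprS; ring.
Qed.

Hypothesis X_neq0 : 0 < nsq X.
Let rho : R := Num.sqrt (nsq X).

Lemma rho_sqr : nsq X = rho ^+ 2. Proof. by rewrite sqr_sqrtr// ltW. Qed.

Lemma displacement_bounds r1 r t : `|r| <= r1 -> r1 < rho ->
  (rho - r1) ^+ 2 <= nsq (displacement r t) <= (rho + r1) ^+ 2.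
Proof.
move=> rr1 r1rho; apply: nsq_sub_bounds => //.
- exact: le_trans rr1.
- exact: rho_sqr.
- rewrite !nsqM nsqC om1 nsq_expi !mulr1 -(real_normK (num_real r)).
  by rewrite ler_pXn2r// ?nnegrE// (le_trans _ rr1).
Qed.

Lemma displacement_gt0 r t : `|r| < rho -> 0 < nsq (displacement r t).
Proof.
move=> rrho; have /andP[H _] := displacement_bounds t (lexx `|r|) rrho.
by apply: lt_le_trans H; rewrite exprn_gt0// subr_gt0.
Qed.

Local Notation e m := (fun t : R => expi (m%:~R * t)).

Lemma ccont_displacement r : ccont (displacement r).
Proof. exact: ccont_cderive (cderive_displacement_t r). Qed.

Lemma ccont_expi c : ccont (fun t : R => expi (c * t)).
Proof. exact: ccont_cderive (cderive_expi c). Qed.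

Lemma ccont_expi1 : ccont (@expi R).
Proof. exact: ccont_cderive cderive_expi1. Qed.

Lemma ccont_radial j r : `|r| < rho ->
  ccont (fun t => (G j (kap * nsq (displacement r t)))%:C).
Proof.
move=> rrho; apply: ccont_cderive => t.
exact: cderive_radial (displacement_gt0 t rrho) (cderive_displacement_t r t).
Qed.

Lemma ccont_mode j r : `|r| < rho -> ccont (fun t => cylinder_mode j (displacement r t)).
Proof.
move=> rrho; apply: ccontM; first exact: ccont_radial.
by apply: ccontX; exact: ccont_displacement.
Qed.

Lemma ccont_mode_deriv j r z : `|r| < rho -> ccont z ->
  ccont (fun t => cylinder_mode_deriv j (displacement r t) (z t)).
Proof.
move=> rrho cz; have cd := ccont_displacement r.
apply: ccontD; apply: ccontM.
- apply: ccontN; apply: ccontM; first exact: ccont_cst.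
  by apply: ccontD; apply: ccontM => //; exact: ccontJ.
- by apply: ccontM; [exact: ccont_radial|exact: ccontX].
- exact: ccont_radial.
- by do 2 apply: ccontM => //; [exact: ccont_cst|exact: ccontX].
Qed.

(** Up to the factor 2 pi, the Fourier coefficient of order - m of the wave seen
    on the circle of radius r. *)
Definition mode_coef j m r : R[i] :=
  cint (fun t => cylinder_mode j (displacement r t) * e m t).

Definition mode_coef_deriv j m r : R[i] :=
  cint (fun t => cylinder_mode_deriv j (displacement r t) (- (om * expi t)) * e m t).

Lemma cderive_mode_coef j m r : `|r| < rho ->
  cderive (mode_coef j m) r (mode_coef_deriv j m r).
Proof.
(* For |x| <= r1 < rho the displacement stays away from 0, where G is singular. *)
move=> rrho; pose r1 := (`|r| + rho) / 2.
have rr1 : `|r| < r1 by rewrite /r1; lra.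
have r1rho : r1 < rho by rewrite /r1; lra.
pose S : set (R * R) := [set p | `|p.1| < r1].
have rI : r \in `]-r1, r1[ by rewrite in_itv/= -ltr_norml.
have SI (p : R * R) : S p -> (rho - r1) ^+ 2 <= nsq (displacement p.1 p.2) <= (rho + r1) ^+ 2.
  by move=> /ltW Sp; exact: displacement_bounds.
have bd : cbounded S (fun p => displacement p.1 p.2).
  exists ((rho + r1) ^+ 2); split; first exact: sqr_ge0.
  by move=> p /SI /andP[].
have bexp (g : R * R -> R) : cbounded S (fun p => expi (g p)).
  by exists 1; split=> // p _; rewrite nsq_expi.
have bG k : cbounded S (fun p => (G k (kap * nsq (displacement p.1 p.2)))%:C).
  apply: (@cboundedC _ _ _ (G k) _ (kap * (rho - r1) ^+ 2) (kap * (rho + r1) ^+ 2)).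
    by move=> p /SI /andP[h1 h2]; rewrite !ler_pM2l ?h1.
  move=> x hx; have x0 : 0 < x.
    by apply: lt_le_trans hx; rewrite mulr_gt0// exprn_gt0// subr_gt0.
  by have [/is_derive_continuous] := cG k x0.
have btau : cbounded S (fun p => - (om * expi p.2)).
  by apply: cboundedN; apply: cboundedM; [exact: cbounded_cst|exact: bexp].
have [C [C0 HC]] : cbounded S (fun p => cylinder_mode_deriv j (displacement p.1 p.2) (- (om * expi p.2)) * e m p.2).
  apply: cboundedM; last exact: bexp.
  apply: cboundedD; apply: cboundedM.
  - apply: cboundedN; apply: cboundedM; first exact: cbounded_cst.
    by apply: cboundedD; apply: cboundedM => //; exact: cboundedJ.
  - by apply: cboundedM => //; exact: cboundedX.
  - exact: bG.
  - apply: cboundedM => //; apply: cboundedM; first exact: cbounded_cst.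
    exact: cboundedX.
apply: (@cderive_under_circle R (fun r t => cylinder_mode j (displacement r t) * e m t)
  (fun r t => cylinder_mode_deriv j (displacement r t) (- (om * expi t)) * e m t)
  (- r1) r1 r (Num.sqrt C) rI); last exact: sqrtr_ge0.
- move=> x t; rewrite in_itv/= -ltr_norml => xr1.
  have dm := @cderive_mode j (displacement ^~ t) x _
    (displacement_gt0 t (lt_trans xr1 r1rho)) (cderive_displacement_r x t).
  by apply: cderive_eq (cderiveM dm (cderive_cst (e m t) x)) _; rewrite mulr0 addr0.
- move=> x; rewrite in_itv/= -ltr_norml => xr1.
  by apply: ccontM; [exact: ccont_mode (lt_trans xr1 r1rho)|exact: ccont_expi].
- move=> x t; rewrite in_itv/= -ltr_norml sqr_sqrtr// => xr1 _.
  exact: (HC (x, t)).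
Qed.

(** Integration by parts over a period. *)
Lemma cint_mode_angular j m r : `|r| < rho ->
  cint (fun t => cylinder_mode_deriv j (displacement r t) (- (r%:C * 'i * (om * expi t))) * e m t)
  = - ((m%:~R)%:C * 'i * mode_coef j m r).
Proof.
move=> rrho; have cm := ccont_mode j rrho.
pose f t := cylinder_mode j (displacement r t) * e m t.
have cf : ccont f by apply: ccontM => //; exact: ccont_expi.
pose g t := cylinder_mode_deriv j (displacement r t) (- (r%:C * 'i * (om * expi t))) * e m t.
have cg : ccont g.
  apply: ccontM; last exact: ccont_expi.
  apply: ccont_mode_deriv => //; apply: ccontN; apply: ccontM; first exact: ccont_cst.
  by apply: ccontM; [exact: ccont_cst|exact: ccont_expi1].
have fd t : cderive f t (g t + (m%:~R)%:C * 'i * f t).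
  have dm := cderive_mode j (displacement_gt0 t rrho) (cderive_displacement_t r t).
  apply: cderive_eq (cderiveM dm (cderive_expi _ t)) _.
  by rewrite /g /f; ring.
have cmf : ccont (fun t => (m%:~R)%:C * 'i * f t) by apply: ccontM => //; exact: ccont_cst.
have := cint_FTC fd (ccontD cg cmf).
have -> : f (2 * pi) = f 0.
  rewrite /f expi_2pi mulr0 expi0 /displacement; congr (cylinder_mode _ (_ - _ * (_ * _)) * _).
  by have := @expi_2pi R 1; rewrite mulr1z mul1r expi0.
rewrite subrr cintD// cintZ// => /eqP; rewrite addr_eq0 => /eqP.
exact.
Qed.

Lemma cint_ext (f g : R -> R[i]) : f =1 g -> cint f = cint g.
Proof. by move=> /funext ->. Qed.

(** Integrated over the circle, the angular derivative becomes multiplication by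
    m, and the raising relation becomes an ordinary differential equation in r. *)
Lemma mode_coef_raising j m r : `|r| < rho ->
  r%:C * mode_coef_deriv j m r =
  2 * kap%:C * r%:C * om^* * mode_coef j.+1 (m - 1) r - (m%:~R)%:C * mode_coef j m r.
Proof.
move=> rrho.
have i0 : ('i : R[i]) * 'i = -1 by apply: eqc => /=; ring.
suff H : r%:C * 'i * mode_coef_deriv j m r =
  - ((m%:~R)%:C * 'i * mode_coef j m r) + 2 * kap%:C * (r%:C * 'i) * om^* * mode_coef j.+1 (m - 1) r.
  apply/eqP; rewrite -subr_eq0; apply/eqP.
  transitivity (- ('i * 'i) * (r%:C * mode_coef_deriv j m r -
   (2 * kap%:C * r%:C * om^* * mode_coef j.+1 (m - 1) r - (m%:~R)%:C * mode_coef j m r))).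
    by rewrite i0; ring.
  transitivity (- 'i * (r%:C * 'i * mode_coef_deriv j m r
    - (2 * kap%:C * (r%:C * 'i) * om^* * mode_coef j.+1 (m - 1) r - (m%:~R)%:C * 'i * mode_coef j m r))).
    by ring.
  by rewrite H; ring.
rewrite -cint_mode_angular// /mode_coef_deriv /mode_coef.
have ct : ccont (fun t => - (om * expi t)).
  by apply: ccontN; apply: ccontM; [exact: ccont_cst|exact: ccont_expi1].
have c1 : ccont (fun t => cylinder_mode_deriv j (displacement r t) (- (om * expi t)) * e m t).
  by apply: ccontM; [exact: ccont_mode_deriv|exact: ccont_expi].
have c2 : ccont (fun t => cylinder_mode j.+1 (displacement r t) * e (m - 1) t).
  by apply: ccontM; [exact: ccont_mode|exact: ccont_expi].
have c3 : ccont (fun t => cylinder_mode_deriv j (displacement r t) (- (r%:C * 'i * (om * expi t))) * e m t).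
  apply: ccontM; last exact: ccont_expi.
  apply: ccont_mode_deriv => //; apply: ccontN; apply: ccontM; first exact: ccont_cst.
  by apply: ccontM; [exact: ccont_cst|exact: ccont_expi1].
rewrite -!cintZ// -cintD//; last by apply: ccontM => //; exact: ccont_cst.
apply: cint_ext => t.
rewrite mulrA mode_raising mulrDl; congr (_ + _).
have -> : e (m - 1) t = (expi t)^* * e m t.
  by rewrite expiJ -expiD intrB mulrBl mul1r addrC.
by rewrite conjcM; ring.
Qed.

Lemma mode_coef_lowering j m r : `|r| < rho ->
  r%:C * mode_coef_deriv j.+1 m r =
  (m%:~R)%:C * mode_coef j.+1 m r - 2 * r%:C * om * mode_coef j (m + 1) r.
Proof.
move=> rrho.
have i0 : ('i : R[i]) * 'i = -1 by apply: eqc => /=; ring.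
suff H : r%:C * 'i * mode_coef_deriv j.+1 m r =
  - (- ((m%:~R)%:C * 'i * mode_coef j.+1 m r)) - 2 * (r%:C * 'i) * om * mode_coef j (m + 1) r.
  apply/eqP; rewrite -subr_eq0; apply/eqP.
  transitivity (- ('i * 'i) * (r%:C * mode_coef_deriv j.+1 m r -
   ((m%:~R)%:C * mode_coef j.+1 m r - 2 * r%:C * om * mode_coef j (m + 1) r))).
    by rewrite i0; ring.
  transitivity (- 'i * (r%:C * 'i * mode_coef_deriv j.+1 m r
    - ((m%:~R)%:C * 'i * mode_coef j.+1 m r - 2 * (r%:C * 'i) * om * mode_coef j (m + 1) r))).
    by ring.
  by rewrite H; ring.
rewrite -cint_mode_angular// /mode_coef_deriv /mode_coef.
have ct : ccont (fun t => - (om * expi t)).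
  by apply: ccontN; apply: ccontM; [exact: ccont_cst|exact: ccont_expi1].
have c1 : ccont (fun t => cylinder_mode_deriv j.+1 (displacement r t) (- (om * expi t)) * e m t).
  by apply: ccontM; [exact: ccont_mode_deriv|exact: ccont_expi].
have c2 : ccont (fun t => cylinder_mode j (displacement r t) * e (m + 1) t).
  by apply: ccontM; [exact: ccont_mode|exact: ccont_expi].
have c3 : ccont (fun t => cylinder_mode_deriv j.+1 (displacement r t) (- (r%:C * 'i * (om * expi t))) * e m t).
  apply: ccontM; last exact: ccont_expi.
  apply: ccont_mode_deriv => //; apply: ccontN; apply: ccontM; first exact: ccont_cst.
  by apply: ccontM; [exact: ccont_cst|exact: ccont_expi1].
rewrite -[- cint _]mulN1r -mulNr -!cintZ// -cintD//; first last.
  by apply: ccontM => //; exact: ccont_cst.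
  by apply: ccontM => //; exact: ccont_cst.
apply: cint_ext => t.
rewrite mulrA mode_lowering; last exact: displacement_gt0.
have -> : e (m + 1) t = expi t * e m t.
  by rewrite -expiD intrD mulrDl mul1r addrC.
by ring.
Qed.

End Graf.

(** * The addition formula of Graf *)

Section GrafFormula.
Context {R : realType}.
Variables (G : nat -> R -> R) (kap : R) (X om : R[i]).
Implicit Types (r t : R) (j : nat) (m : int).
Hypothesis cG : cylinder G.
Hypothesis kap_gt0 : 0 < kap.
Hypothesis om1 : nsq om = 1.
Hypothesis X_neq0 : 0 < nsq X.
Local Notation rho := (Num.sqrt (nsq X)).
Local Notation A := (mode_coef G kap X om).
Local Notation H j := (cylinder_mode G kap j X).

Lemma omJ : om * om^* = 1. Proof. by rewrite -nsqE om1. Qed.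

Lemma is_derive_besselE_sqr n r :
  is_derive r 1 (fun r => besselE n (kap * r ^+ 2)) (- (2 * kap * r * besselE n.+1 (kap * r ^+ 2))).
Proof.
have d2 : is_derive r 1 (fun r => kap * r ^+ 2) (2 * kap * r).
  by apply: is_derive_eq; rewrite /GRing.scale /= ?expr1; ring.
have := @is_derive1_comp _ (besselE n) _ r _ _ (is_derive_besselE n _) d2.
by move=> /is_derive_eq; apply; rewrite /GRing.scale /=; ring.
Qed.

Lemma cint_expi m : m != 0 -> cint (fun t : R => expi (m%:~R * t)) = 0.
Proof.
move=> m0; have ce : ccont (fun t : R => expi (m%:~R * t)) by exact: ccont_expi.
have cme : ccont (fun t : R => (m%:~R)%:C * 'i * expi (m%:~R * t)).
  by apply: ccontM => //; exact: ccont_cst.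
have := cint_FTC (cderive_expi m%:~R) cme.
rewrite expi_2pi mulr0 expi0 subrr cintZ// => /eqP; rewrite mulf_eq0 => /orP[|/eqP//].
rewrite mulf_eq0 => /orP[|]; rewrite eq_complex /= ?eqxx ?andbT ?oner_eq0 ?andbF//.
by rewrite intr_eq0 (negbTE m0).
Qed.

Lemma mode_coef0 j m : A j m 0 = if m == 0 then (2 * pi)%:C * H j else 0.
Proof.
have disp t : displacement X om 0 t = X by rewrite /displacement mul0r subr0.
have -> : A j m 0 = cint (fun t => H j * expi (m%:~R * t)).
  by apply: cint_ext => t; rewrite disp.
rewrite cintZ; last exact: ccont_expi.
case: eqVneq => [->|m0]; last by rewrite cint_expi// mulr0.
rewrite (_ : (fun t : R => _) = fun=> 1) ?cint_cst; first by rewrite mulr1 mulrC.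
by apply/funext => t; rewrite mul0r expi0.
Qed.

(** The pair (A_(j,0), A_(j+1,-1)) solves the first-order system of (J_0, J_1),
    which is singular at r = 0. Uniqueness comes from the energy F of the
    difference to the expected solution: it does not increase and starts at 0. *)
Lemma mode_coef_order0 j r : 0 <= r -> r < rho ->
  A j 0 r = (2 * pi)%:C * (besselE 0 (kap * r ^+ 2))%:C * H j.
Proof.
move=> r0 rrho; pose K := (2 * pi)%:C * H j.
pose a0 r := K * (besselE 0 (kap * r ^+ 2))%:C.
pose b0 r := - (om * K) * (r * besselE 1 (kap * r ^+ 2))%:C.
pose c r := A j 0 r - a0 r.
pose d r := A j.+1 (-1) r - b0 r.
pose F r := nsq (c r) + kap * nsq (d r).
have da0 x : cderive a0 x (K * (- (2 * kap * x * besselE 1 (kap * x ^+ 2)))%:C).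
  by apply: cderiveZ; apply: cderiveC; exact: is_derive_besselE_sqr.
have db0 x : cderive b0 x (- (om * K) *
    (besselE 1 (kap * x ^+ 2) - 2 * kap * x ^+ 2 * besselE 2 (kap * x ^+ 2))%:C).
  apply: cderiveZ; apply: cderiveC.
  have dE := is_derive_besselE_sqr 1 x.
  by apply: is_derive_eq; rewrite /GRing.scale /=; ring.
have dc x : `|x| < rho -> cderive c x (mode_coef_deriv G kap X om j 0 x - K * (- (2 * kap * x * besselE 1 (kap * x ^+ 2)))%:C).
  by move=> xrho; apply: cderiveB; [exact: cderive_mode_coef|exact: da0].
have dd x : `|x| < rho -> cderive d x (mode_coef_deriv G kap X om j.+1 (-1) x - - (om * K) *
    (besselE 1 (kap * x ^+ 2) - 2 * kap * x ^+ 2 * besselE 2 (kap * x ^+ 2))%:C).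
  by move=> xrho; apply: cderiveB; [exact: cderive_mode_coef|exact: db0].
have dc' x : 0 < x -> x < rho -> cderive c x (2 * kap%:C * om^* * d x).
  move=> x0 xrho; have xrho' : `|x| < rho by rewrite gtr0_norm.
  apply: cderive_eq (dc x xrho') _.
  have x'0 : x%:C != 0 by rewrite eq_complex /= eqxx andbT gt_eqF.
  apply: (mulfI x'0); rewrite mulrBr mode_coef_raising// (_ : (0%:~R)%:C = 0)// mul0r subr0 sub0r.
  rewrite /d /b0 rmorphN !rmorphM rmorph_nat /=.
  have := omJ; move: (om^*) => w ww.
  transitivity (2 * kap%:C * x%:C * (w * A j.+1 (-1) x + K * x%:C * (besselE 1 (kap * x ^+ 2))%:C)); first by ring.
  by rewrite -[K in LHS]mul1r -ww; ring.
have dd' x : 0 < x -> x < rho -> cderive d x (- (x^-1)%:C * d x - 2 * om * c x).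
  move=> x0 xrho; have xrho' : `|x| < rho by rewrite gtr0_norm.
  apply: cderive_eq (dd x xrho') _.
  have x'0 : x%:C != 0 by rewrite eq_complex /= eqxx andbT gt_eqF.
  have xx : x%:C * (x^-1)%:C = 1 by rewrite -rmorphM /= divff// gt_eqF.
  apply: (mulfI x'0); rewrite mulrBr mode_coef_lowering// addNr.
  rewrite (_ : ((-1)%:~R)%:C = -1 :> R[i]); last by rewrite rmorphN.
  have E2 : kap * x ^+ 2 * besselE 2 (kap * x ^+ 2) = besselE 1 (kap * x ^+ 2) - besselE 0 (kap * x ^+ 2).
    by rewrite besselE_three_term mul1r.
  have -> : besselE 1 (kap * x ^+ 2) - 2 * kap * x ^+ 2 * besselE 2 (kap * x ^+ 2)
     = 2 * besselE 0 (kap * x ^+ 2) - besselE 1 (kap * x ^+ 2).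
    transitivity (besselE 1 (kap * x ^+ 2) - 2 * (kap * x ^+ 2 * besselE 2 (kap * x ^+ 2))).
      by ring.
    by rewrite E2; ring.
  rewrite /d /c /b0 /a0 !rmorphB !rmorphM rmorph_nat /=.
  transitivity (- (x%:C * (x^-1)%:C) * (A j.+1 (-1) x + om * K * (x%:C * (besselE 1 (kap * x ^+ 2))%:C))
     - 2 * x%:C * om * (A j 0 x - K * (besselE 0 (kap * x ^+ 2))%:C)); last by ring.
  by rewrite xx; ring.
have dF x : 0 < x -> x < rho -> is_derive x 1 F (- (2 * kap / x * nsq (d x))).
  move=> x0 xrho; have h1 := nsq_derive (dc' x x0 xrho); have h2 := nsq_derive (dd' x x0 xrho).
  rewrite /F; apply: is_derive_eq; rewrite /GRing.scale /=.
  have e1 : complex.Re ((c x)^* * (2 * kap%:C * om^* * d x)) =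
     2 * kap * complex.Re (((c x) * om)^* * d x).
    rewrite conjcM -[2 * kap in RHS]ReC.
    transitivity (complex.Re ((2 * kap)%:C * ((c x)^* * om^* * d x))).
      by congr (complex.Re _); rewrite rmorphM rmorph_nat /=; ring.
    by rewrite ReM ImC mul0r subr0.
  have e2 : complex.Re ((d x)^* * (- (x^-1)%:C * d x - 2 * om * c x)) =
     - (x^-1 * nsq (d x)) - 2 * complex.Re (((c x) * om)^* * d x).
    have -> : complex.Re (((c x) * om)^* * d x) = complex.Re ((d x)^* * (c x * om)).
      by rewrite -[LHS]ReJ (conjcM (conjc _)) conjcK mulrC.
    transitivity (complex.Re (- (x^-1 * nsq (d x))%:C - 2%:C * ((d x)^* * (c x * om)))).
      by congr (complex.Re _); rewrite rmorphM /= nsqE (_ : 2%:C = 2); [ring|rewrite rmorph_nat].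
    by rewrite ReD !ReN ReM ReC ImC mul0r subr0.
  by rewrite e1 e2; ring.
have cF : {within `[0, r], continuous F}.
  apply: continuous_in_subspaceT => x; rewrite inE/= in_itv/= => /andP[x0 xr].
  have xrho : `|x| < rho by rewrite ger0_norm// (le_lt_trans xr).
  apply: cvgD; first exact: is_derive_continuous (nsq_derive (dc x xrho)).
  by apply: cvgM; [exact: cvg_cst|exact: is_derive_continuous (nsq_derive (dd x xrho))].
have F0 : F 0 = 0.
  rewrite /F /c /d !mode_coef0 /= /a0 /b0 mul0r (_ : 0%:C = 0)// mulr0 subr0.
  rewrite expr0n mulr0 besselE0 fact0 invr1 (_ : 1%:C = 1)// mulr1 subrr.
  have -> : nsq (0 : R[i]) = 0 by rewrite /nsq /= expr0n addr0.
  by rewrite mulr0 addr0.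
have Fr : F r <= 0.
  rewrite -F0 -lerN2.
  apply: (@is_derive_ge0_le _ (fun x => - F x) (fun x => 2 * kap / x * nsq (d x)) 0 r r0).
  - move=> x; rewrite in_itv/= => /andP[x0 xr].
    have dFx := dF x x0 (lt_trans xr rrho).
    by apply: is_derive_eq; rewrite opprK.
  - move=> x; rewrite in_itv/= => /andP[x0 xr].
    by rewrite mulr_ge0 ?nsq_ge0// divr_ge0 ?ltW// mulr_gt0.
  - by move=> x; apply: cvgN; exact: cF.
have c0 : nsq (c r) = 0.
  apply/eqP; rewrite eq_le nsq_ge0 andbT; apply: le_trans Fr.
  by rewrite /F lerDl mulr_ge0 ?nsq_ge0// ltW.
by move/nsq_eq0/eqP: c0; rewrite subr_eq0 => /eqP ->; rewrite /a0 /K; ring.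
Qed.

Lemma cderive_near (f g : R -> R[i]) r z : (\near r, f r = g r) ->
  cderive f r z -> cderive g r z.
Proof.
move=> fg [f1 f2]; split.
  apply: (near_eq_is_derive _ f1); near=> x.
  by congr (complex.Re _); near: x.
apply: (near_eq_is_derive _ f2); near=> x.
by congr (complex.Im _); near: x.
Unshelve. all: by end_near.
Qed.

(** Graf's addition formula, by induction from order 0: the lowering relation
    expresses A_(j,m+1) by A_(j+1,m) and its derivative. *)
Lemma mode_coefE j (m : nat) r : 0 <= r -> r < rho ->
  A j m r = (2 * pi)%:C * (kap ^+ m * r ^+ m * besselE m (kap * r ^+ 2))%:C * om^* ^+ m * H (m + j).
Proof.
elim: m j r => [|m IH] j r r0 rrho.
  by rewrite mode_coef_order0// !expr0 !mul1r mulr1 add0n.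
have [r'0|r'0] := eqVneq r 0.
  rewrite r'0 mode_coef0 (_ : (m.+1%:Z == 0) = false)// [0 ^+ m.+1]exprS.
  by rewrite mul0r mulr0 mul0r (_ : 0%:C = 0)// mulr0 !mul0r.
have {r'0}r0 : 0 < r by rewrite lt_neqAle eq_sym r'0.
have rrho' : `|r| < rho by rewrite gtr0_norm.
pose K := (2 * pi)%:C * (kap ^+ m)%:C * om^* ^+ m * H (m.+1 + j).
pose f (x : R) := K * (x ^+ m * besselE m (kap * x ^+ 2))%:C.
pose df := K * ((m%:R / r) * (r ^+ m * besselE m (kap * r ^+ 2))
   - 2 * kap * r ^+ m.+1 * besselE m.+1 (kap * r ^+ 2))%:C.
have dfr : cderive f r df.
  apply: cderiveZ; apply: cderiveC.
  have dE := is_derive_besselE_sqr m r.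
  have dX : is_derive r 1 (fun x : R => x ^+ m) (m%:R / r * r ^+ m).
    case: {IH K f df dE} m => [|m]; first by rewrite mulr0n !mul0r; exact: (is_derive_cst (1 : R)).
    apply: is_derive_eq (is_derive_expr m r) _.
    by rewrite exprS mulrA divfK// gt_eqF.
  by apply: is_derive_eq; rewrite /GRing.scale /= [r ^+ m.+1]exprS; ring.
have Af : cderive (A j.+1 m) r df.
  apply: cderive_near dfr; near=> x.
  have [x0 xrho] : 0 <= x /\ x < rho.
    split; last by near: x; exact: lt_nbhsl.
    by apply/ltW; near: x; exact: lt_nbhsr.
  rewrite IH// /f /K addSnnS !rmorphM /=; ring.
have := mode_coef_lowering cG kap_gt0 om1 X_neq0 j m rrho'.
rewrite (cderive_uniq (cderive_mode_coef cG kap_gt0 om1 X_neq0 j.+1 m rrho') Af).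
rewrite IH ?ltW//.
rewrite -PoszD addn1 addnS -addSn (_ : (m%:~R)%:C = m%:R)//; last first.
  by rewrite -pmulrn rmorph_nat.
set b := besselE m.+1 _; set a := besselE m _ => E.
have r'0 : r != 0 by rewrite gt_eqF.
have nz : 2 * r%:C * om != 0.
  rewrite !mulf_neq0 ?pnatr_eq0//; first by rewrite eq_complex /= eqxx andbT.
  by apply/eqP => om0; move: om1 => /eqP; rewrite om0 /nsq /= expr0n addr0 eq_sym oner_eq0.
apply: (mulfI nz).
have -> : 2 * r%:C * om * A j m.+1 r = m%:R * ((2 * pi)%:C * (kap ^+ m * r ^+ m * a)%:C *
   om^* ^+ m * H (m.+1 + j)) - r%:C * df by rewrite E; ring.
have -> : r%:C * df = K * (m%:R * (r ^+ m * a) - 2 * kap * r ^+ m.+2 * b)%:C.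
  rewrite /df mulrCA -rmorphM /=; congr (_ * _%:C).
  by rewrite [r ^+ m.+2]exprS -/a -/b; move: (r ^+ m.+1) (r ^+ m) => x y; field.
rewrite /K [om^* ^+ m.+1]exprS [kap ^+ m.+1]exprS [r ^+ m.+2]exprS.
rewrite !(rmorphM, rmorphB, rmorph_nat) /=.
have := omJ; move: (om^*) => w ww.
transitivity (2 * r%:C * (om * w) * ((2 * pi%:C) * (kap%:C * (kap ^+ m)%:C * (r ^+ m.+1)%:C * b%:C) * w ^+ m * H (m.+1 + j))).
  by rewrite ww; ring.
by ring.
Unshelve. all: by end_near.
Qed.

End GrafFormula.

(** * Lommel integrals and rotational averages over the disc *)

Section DiscLommel.
Context {R : realType}.
Variable r : R.
Hypothesis r0 : 0 < r.
Local Notation mu2 := (lebesgue2 R).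
Local Notation area := (fine (mu2 (disc r))).

Lemma area_gt0 : 0 < area.
Proof.
apply: fine_gt0; apply/andP; split; [exact: disc_gt0|exact: disc_lty].
Qed.

(** The function p is g + x g' for g = x^m L. *)
Lemma radial_integral_power m (L dL p : R -> R) :
  (forall x : R, is_derive x 1 L (dL x)) -> continuous dL ->
  (forall x : R, is_derive x 1 (fun x => x ^+ m.+1 * L x) (p x)) ->
  Rintegral mu2 (disc r) (fun q => p (sqnorm q)) = (r ^+ 2) ^+ m * L (r ^+ 2) * area.
Proof.
move=> dLx cdL pd.
have dX (x : R) : is_derive x 1 (fun x => x ^+ m) (m%:R * x ^+ m.-1).
  case: {pd} m => [|m]; last exact: is_derive_expr.
  by rewrite mulr0n mul0r; exact: (is_derive_cst (1 : R)).
have cL : continuous L by move=> x; exact: is_derive_continuous (dLx x).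
pose dg x := m%:R * x ^+ m.-1 * L x + x ^+ m * dL x.
have gd (x : R) : is_derive x 1 (fun x => x ^+ m * L x) (dg x).
  by have dXx := dX x; have dLx' := dLx x; apply: is_derive_eq; rewrite /GRing.scale /= /dg; ring.
have cdg : continuous dg.
  move=> x; apply: cvgD.
    apply: cvgM; last exact: cL.
    by apply: cvgM; [exact: cvg_cst|exact: exprn_continuous].
  by apply: cvgM; [exact: exprn_continuous|exact: cdL].
rewrite -(radial_integral r0 gd cdg); apply: eq_Rintegral => q _.
set x := sqnorm q.
have h1 : is_derive x 1 (fun x => x ^+ m.+1 * L x) (x ^+ m * L x + x * dg x).
  rewrite (_ : (fun x => x ^+ m.+1 * L x) = (fun x => x * (x ^+ m * L x))).
    by have gx := gd x; apply: is_derive_eq; rewrite /GRing.scale /=; ring.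
  by apply/funext => y; rewrite exprS mulrA.
by have [_ <-] := pd x; have [_ <-] := h1.
Qed.

Lemma disc_lommel m (a b : R) : a != b ->
  Rintegral mu2 (disc r)
    (fun q => sqnorm q ^+ m * besselE m (a * sqnorm q) * besselE m (b * sqnorm q)) =
  (r ^+ 2) ^+ m * (a * besselE m.+1 (a * r ^+ 2) * besselE m (b * r ^+ 2)
      - b * besselE m (a * r ^+ 2) * besselE m.+1 (b * r ^+ 2)) / (a - b) * area.
Proof.
move=> ab; have ab0 : a - b != 0 by rewrite subr_eq0.
pose L x := (a * besselE m.+1 (a * x) * besselE m (b * x)
      - b * besselE m (a * x) * besselE m.+1 (b * x)) / (a - b).
pose dL x := (b ^+ 2 * besselE m (a * x) * besselE m.+2 (b * x)
     - a ^+ 2 * besselE m.+2 (a * x) * besselE m (b * x)) / (a - b).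
have cE := continuous_besselE_scale.
transitivity ((r ^+ 2) ^+ m * L (r ^+ 2) * area); last by rewrite /L mulrA.
apply: (@radial_integral_power m L dL (fun x => x ^+ m * besselE m (a * x) * besselE m (b * x))).
- move=> x; have d1 := is_derive_besselE_scale a m x; have d2 := is_derive_besselE_scale b m x.
  have d3 := is_derive_besselE_scale a m.+1 x; have d4 := is_derive_besselE_scale b m.+1 x.
  by rewrite /L; apply: is_derive_eq; rewrite /GRing.scale /= /dL; field.
- move=> x; apply: cvgM; last exact: cvg_cst.
  by apply: cvgB; do 2 (apply: cvgM; last exact: cE); exact: cvg_cst.
- move=> x; have dl := is_derive_lommel m a b x.
  rewrite (_ : (fun x => x ^+ m.+1 * L x) = (fun x => x ^+ m.+1 * (a * besselE m.+1 (a * x) * besselE m (b * x)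
      - b * besselE m (a * x) * besselE m.+1 (b * x)) * (a - b)^-1)).
    by apply: is_derive_eq; rewrite /GRing.scale /=; field.
  by apply/funext => y; rewrite /L mulrA.
Qed.

Lemma disc_lommel_diag m (a : R) : a != 0 ->
  Rintegral mu2 (disc r)
    (fun q => sqnorm q ^+ m * besselE m (a * sqnorm q) * besselE m (a * sqnorm q)) =
  (r ^+ 2) ^+ m * besselA m (a * r ^+ 2) * area.
Proof.
move=> a0.
pose L x := besselA m (a * x).
pose dL x := a * (- 2 * besselE m (a * x) * besselE m.+1 (a * x)
   + m%:R * besselE m.+1 (a * x) ^+ 2 + m%:R * besselE m (a * x) * besselE m.+2 (a * x)
   + besselE m.+1 (a * x) ^+ 2 - 2 * besselE m.+1 (a * x) * (a * x * besselE m.+2 (a * x))).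
have cE := continuous_besselE_scale.
have dLx (x : R) : is_derive x 1 L (dL x).
  have d1 := is_derive_besselE_scale a m x.
  have d3 := is_derive_besselE_scale a m.+1 x.
  by rewrite /L /besselA; apply: is_derive_eq; rewrite /GRing.scale /= /dL; ring.
transitivity ((r ^+ 2) ^+ m * L (r ^+ 2) * area) => //.
apply: (@radial_integral_power m L dL (fun x => x ^+ m * besselE m (a * x) * besselE m (a * x))).
- have cX2 n : continuous (fun x : R => besselE n (a * x) ^+ 2).
    by move=> x; rewrite (_ : (fun y => _) = (fun y => besselE n (a * y) * besselE n (a * y)));
      [apply: cvgM; exact: cE|apply/funext => y; rewrite expr2].
  have cc (c : R) : continuous (fun x : R => c) by move=> x; exact: cvg_cst.
  move=> x; apply: cvgM; first exact: cc.
  apply: cvgB; last first.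
    apply: cvgM; first by apply: cvgM; [exact: cc|exact: cE].
    by apply: cvgM; [apply: cvgM; [exact: cc|exact: cvg_id]|exact: cE].
  apply: cvgD; last exact: cX2.
  apply: cvgD; first apply: cvgD.
  + by apply: cvgM; [apply: cvgM; [exact: cc|exact: cE]|exact: cE].
  + by apply: cvgM; [exact: cc|exact: cX2].
  + by apply: cvgM; [apply: cvgM; [exact: cc|exact: cE]|exact: cE].
- move=> x; have dA := is_derive_besselA m (a * x).
  have dl : is_derive x 1 (fun x => a * x) a.
    by apply: is_derive_eq; rewrite /GRing.scale /= mulr1.
  have dc := @is_derive1_comp _ (fun x => x ^+ m.+1 * besselA m x) (fun x => a * x) x _ _ dA dl.
  rewrite (_ : (fun x => x ^+ m.+1 * L x) = (fun x => (a ^+ m.+1)^-1 * ((a * x) ^+ m.+1 * besselA m (a * x)))).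
    apply: is_derive_eq; rewrite /GRing.scale /= !exprMn exprS.
    by move: (a ^+ m) (expf_neq0 m a0) => am am0; field; rewrite ?a0 ?am0.
  apply/funext => y; rewrite /L exprMn.
  by rewrite !mulrA mulVf ?mul1r// expf_neq0.
Qed.

End DiscLommel.

Section PlaneMeasure.
Context {R : realType}.

(** The plane measure under a name of its own, to which its sigma-finiteness, as
    Fubini's theorem requires it, is attached. *)
Definition plane_measure : set (plane R) -> \bar R := lebesgue2 R.
HB.instance Definition _ := Measure.on plane_measure.

Let plane_measure_sigma_finite : sigma_finite setT plane_measure.
Proof.
exists (fun n => disc n.+1%:R).
  apply/seteqP; split => // p _.
  have [n pn] : exists n : nat, sqnorm p < n%:R.
    by exists (Num.truncn (sqnorm p)).+1; rewrite truncnS_gt.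
  exists n => //; apply/in_discE => //; apply: lt_le_trans pn _.
  by rewrite -natrX ler_nat (leq_trans (leqnSn n))// leq_pmulr.
by move=> n; split; [exact: measurable_disc|exact: disc_lty].
Qed.

HB.instance Definition _ :=
  Measure_isSigmaFinite.Build _ _ _ plane_measure plane_measure_sigma_finite.

End PlaneMeasure.

Section Averaging.
Context {R : realType}.
Variable r : R.
Hypothesis r0 : 0 < r.
Local Notation mu := (@lebesgue_measure R).
Local Notation mu2 := (lebesgue2 R).
Local Notation pm := (@plane_measure R).
Local Notation circle := (`[0, (2 * pi : R)]%classic).

Lemma bm_rotate c s (f : plane R -> R) : c ^+ 2 + s ^+ 2 = 1 ->
  bounded_measurable r f -> bounded_measurable r (f \o rotate c s).
Proof.
move=> cs [mf [C fC]].
have Dr p : disc r p -> disc r (rotate c s p).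
  by move=> Dp; rewrite -[disc r _]/((rotate c s @^-1` disc r) p) rotate_disc.
split; last by exists C => p Dp; exact/fC/Dr.
apply: (measurable_comp (F := disc r)) => //.
- exact: measurable_disc.
- by move=> _ [p Dp <-]; exact: Dr.
- by apply: measurable_funTS; have [] := rotate_preserves cs.
Qed.

Lemma measurable_rotate :
  measurable_fun setT (fun z : measurableTypeR R * plane R => rotate (cos (z.1 : R)) (sin (z.1 : R)) z.2).
Proof.
have mc : measurable_fun setT (fun z : measurableTypeR R * plane R => cos (z.1 : R)).
  apply: (measurableT_comp (f := @cos R)); last exact: measurable_fst.
  by apply: continuous_measurable_fun; exact: continuous_cos.
have ms : measurable_fun setT (fun z : measurableTypeR R * plane R => sin (z.1 : R)).
  apply: (measurableT_comp (f := @sin R)); last exact: measurable_fst.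
  by apply: continuous_measurable_fun; exact: continuous_sin.
have m1 : measurable_fun setT (fun z : measurableTypeR R * plane R => (z.2.1 : R)).
  by apply: (measurableT_comp (f := fst)); [exact: measurable_fst|exact: measurable_snd].
have m2 : measurable_fun setT (fun z : measurableTypeR R * plane R => (z.2.2 : R)).
  by apply: (measurableT_comp (f := snd)); [exact: measurable_snd|exact: measurable_snd].
apply/measurable_fun_pairP; split.
  by apply: measurable_funB; apply: measurable_funM.
by apply: measurable_funD; apply: measurable_funM.
Qed.

(** Fubini's theorem and the rotation invariance of the plane measure. *)
Lemma disc_average (f : plane R -> R) : bounded_measurable r f ->
  2 * pi * Rintegral mu2 (disc r) f =
  Rintegral mu2 (disc r) (fun p => Rintegral mu circle (fun t => f (rotate (cos t) (sin t) p))).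
Proof.
move=> bf; have [mf [C fC]] := bf.
have mD := measurable_disc r0.
have mc : measurable (circle : set (measurableTypeR R)) by exact: measurable_itv.
pose fD : plane R -> R := f \_ (disc r).
have mfD : measurable_fun setT fD by apply/(measurable_restrictT _ mD).
pose F (z : measurableTypeR R * plane R) : R :=
  fD (rotate (cos (z.1 : R)) (sin (z.1 : R)) z.2) * \1_circle z.1.
have mF : measurable_fun setT F.
  apply: measurable_funM; first exact: (measurableT_comp mfD measurable_rotate).
  by apply: measurableT_comp; [exact: measurable_indic|exact: measurable_fst].
have rotD (t : R) p : disc r (rotate (cos t) (sin t) p) <-> disc r p.
  by rewrite -[disc r (rotate _ _ p)]/((rotate (cos t) (sin t) @^-1` disc r) p) rotate_disc// cos2Dsin2.
have fDE t p : fD (rotate (cos t) (sin t) p) = (fun p => f (rotate (cos t) (sin t) p)) \_ (disc r) p.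
  rewrite /fD !patchE (_ : (rotate (cos t) (sin t) p \in disc r) = (p \in disc r))//.
  by apply/idP/idP => /set_mem/rotD H; apply/mem_set.
have circ_lty : (mu circle < +oo)%E.
  by rewrite lebesgue_measure_itv/=; case: ifPn => // _; rewrite -EFinB ltry.
have C0 : 0 <= C.
  have H := fC (0, 0); apply: le_trans (H _); first exact: normr_ge0.
  by apply/(in_discE r0); rewrite /sqnorm /= !expr0n addr0 exprn_gt0.
have FC z : `|F z| <= C * \1_(circle `*` disc r) z.
  rewrite /F fDE !indicE patchE normrM.
  have -> : (z \in circle `*` disc r) = (z.1 \in circle) && (z.2 \in disc r).
    by apply/idP/andP => [/set_mem[h1 h2]|[/set_mem h1 /set_mem h2]];
      [split; apply/mem_set|apply/mem_set].
  case: (boolP (z.2 \in disc r)) => zD; last first.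
    by rewrite normr0 mul0r andbF mulr0.
  rewrite andbT; apply: ler_pM; [exact: normr_ge0|exact: normr_ge0| |].
    by apply: fC; apply/rotD; exact: set_mem.
  by rewrite ger0_norm.
have mX : measurable (circle `*` disc r : set (measurableTypeR R * plane R)).
  exact: measurableX.
have iC : (mu \x pm)%E.-integrable setT (EFin \o (fun z => C * \1_(circle `*` disc r) z)).
  rewrite (_ : EFin \o _ = (fun z => C%:E * (\1_(circle `*` disc r) z)%:E)%E); last first.
    by apply/funext => z /=; rewrite EFinM.
  apply: integrableZl; first exact: measurableT.
  rewrite (_ : (fun z => _) = (EFin \o cst (1 : R)) \_ (circle `*` disc r)); last first.
    by apply/funext => z; rewrite patchE indicE; case: ifP.
  apply/(integrable_mkcond _ mX); apply: measurable_bounded_integrable; first exact: mX.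
  - have := @product_measure1E _ _ _ _ R mu pm circle (disc r) mc mD => /= ->.
    apply: lte_mul_pinfty; first exact: measure_ge0.
      by rewrite ge0_fin_numE ?measure_ge0.
    exact: disc_lty.
  - exact: measurable_cst.
  - by exists 1; split; [exact: num_real|move=> x x1 z _; apply: le_trans (ltW x1); rewrite normr1].
have iF : (mu \x pm)%E.-integrable setT (EFin \o F).
  apply: (le_integrable _ _ _ iC) => //.
    exact/measurable_EFinP.
  by move=> z _ /=; rewrite lee_fin (le_trans (FC z))// ler_norm.
have fub := @Fubini _ _ _ _ R mu pm (EFin \o F) iF.
have EI : (\int[pm]_(p in disc r) (f p)%:E = (Rintegral mu2 (disc r) f)%:E)%E.
  by rewrite /Rintegral fineK//; apply: integrable_fin_num => //; exact: bm_integrable.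
have L : (\int[mu]_t \int[pm]_p (EFin \o F) (t, p) = (2 * pi * Rintegral mu2 (disc r) f)%:E)%E.
  transitivity (\int[mu]_(t in circle) (Rintegral mu2 (disc r) f)%:E)%E.
    rewrite [RHS]integral_mkcond; apply: eq_integral => t _; rewrite patchE.
    case: (boolP (t \in circle)) => tc.
      have cs := cos2Dsin2 t.
      rewrite -(integral_rotate cs r0 (bm_integrable r0 bf) (bm_integrable r0 (bm_rotate cs bf))).
      have -> : (Rintegral mu2 (disc r) (f \o rotate (cos t) (sin t)))%:E =
          (\int[pm]_(p in disc r) (f (rotate (cos t) (sin t) p))%:E)%E.
        rewrite /Rintegral fineK//; apply: integrable_fin_num => //.
        exact: (bm_integrable r0 (bm_rotate cs bf)).
      rewrite [RHS]integral_mkcond; apply: eq_integral => p _ /=.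
      rewrite /F /= indicE tc mulr1 fDE !patchE; by case: ifP.
    by rewrite integral0_eq// => p _ /=; rewrite /F /= indicE (negbTE tc) mulr0.
  rewrite integral_cst//= lebesgue_measure_itv/= lte_fin mulr_gt0 ?pi_gt0//.
  by rewrite -EFinB -EFinM subr0 mulrC.
apply: EFin_inj; rewrite -L fub /Rintegral.
have bq p : disc r p -> forall t, `|f (rotate (cos t) (sin t) p)| <= C.
  by move=> Dp t; apply/fC/rotD.
have inner p : disc r p -> (\int[mu]_t (EFin \o F) (t, p) =
    (Rintegral mu circle (fun t => f (rotate (cos t) (sin t) p)))%:E)%E.
  move=> Dp; rewrite /Rintegral fineK.
    rewrite [RHS]integral_mkcond; apply: eq_integral => t _ /=.
    rewrite /F /= patchE indicE fDE patchE (mem_set Dp).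
    by case: ifP => _; rewrite ?mulr1 ?mulr0.
  apply: integrable_fin_num => //; apply: measurable_bounded_integrable => //.
    have mfp : measurable_fun setT (fun t : measurableTypeR R => fD (rotate (cos t) (sin t) p)).
      exact: (measurable_fun_pair1 p (measurableT_comp mfD measurable_rotate)).
    apply: measurable_funTS; apply: eq_measurable_fun mfp => t _.
    by rewrite fDE patchE (mem_set Dp).
  exists C; split; first exact: num_real.
  by move=> x Cx t _; apply: (le_trans (bq p Dp t)); exact: ltW.
transitivity (\int[pm]_(p in disc r) (Rintegral mu circle (fun t => f (rotate (cos t) (sin t) p)))%:E)%E.
  rewrite [RHS]integral_mkcond; apply: eq_integral => p _; rewrite patchE.
  case: (boolP (p \in disc r)) => pD; first by apply: inner; exact: set_mem.
  rewrite integral0_eq// => t _ /=; rewrite /F /= fDE patchE (negbTE pD).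
  by rewrite mul0r.
rewrite fineK// -[X in X \is a fin_num]/(\int[pm]_(p in disc r) (Rintegral mu circle (fun t => f (rotate (cos t) (sin t) p)))%:E)%E.
have -> : (\int[pm]_(p in disc r) (Rintegral mu circle (fun t => f (rotate (cos t) (sin t) p)))%:E = \int[pm]_p \int[mu]_t (EFin \o F) (t, p))%E.
  rewrite [LHS]integral_mkcond; apply: eq_integral => p _; rewrite patchE.
  case: (boolP (p \in disc r)) => pD; first by rewrite inner//; exact: set_mem.
  rewrite integral0_eq// => t _ /=; rewrite /F /= fDE patchE (negbTE pD).
  by rewrite mul0r.
by rewrite -fub L.
Qed.

End Averaging.

(** * Complex integrals over the disc *)

Section ComplexDisc.
Context {R : realType}.
Variable r : R.
Hypothesis r0 : 0 < r.
Local Notation Re := (@complex.Re R).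
Local Notation Im := (@complex.Im R).
Local Notation mu2 := (lebesgue2 R).
Implicit Types (f g : plane R -> R[i]) (p : plane R).

Definition cbm f := bounded_measurable r (fun p => Re (f p)) /\
  bounded_measurable r (fun p => Im (f p)).

Lemma cbm_cst z : cbm (fun=> z).
Proof. by split; exact: bm_cst. Qed.

Lemma cbm_real (h : plane R -> R) : bounded_measurable r h -> cbm (fun p => (h p)%:C).
Proof. by move=> bh; split => //; exact: bm_cst. Qed.

Lemma cbmD f g : cbm f -> cbm g -> cbm (fun p => f p + g p).
Proof.
move=> [f1 f2] [g1 g2]; split.
  rewrite (_ : (fun _ => _) = (fun p => Re (f p) + Re (g p))); first exact: bmD.
  by apply/funext => p; rewrite ReD.
rewrite (_ : (fun _ => _) = (fun p => Im (f p) + Im (g p))); first exact: bmD.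
by apply/funext => p; rewrite ImD.
Qed.

Lemma cbmM f g : cbm f -> cbm g -> cbm (fun p => f p * g p).
Proof.
move=> [f1 f2] [g1 g2]; split.
  rewrite (_ : (fun _ => _) = (fun p => Re (f p) * Re (g p) - Im (f p) * Im (g p))).
    by apply: bmB; exact: bmM.
  by apply/funext => p; rewrite ReM.
rewrite (_ : (fun _ => _) = (fun p => Re (f p) * Im (g p) + Im (f p) * Re (g p))).
  by apply: bmD; exact: bmM.
by apply/funext => p; rewrite ImM.
Qed.

Lemma cbmJ f : cbm f -> cbm (fun p => (f p)^*).
Proof.
move=> [f1 f2]; split.
  rewrite (_ : (fun _ => _) = (fun p => Re (f p)))//.
  by apply/funext => p; rewrite ReJ.
rewrite (_ : (fun _ => _) = (fun p => - Im (f p))); first exact: bmN.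
by apply/funext => p; rewrite ImJ.
Qed.

Lemma cbmX f n : cbm f -> cbm (fun p => f p ^+ n).
Proof.
move=> bf; elim: n => [|n IH]; first exact: (cbm_cst 1).
rewrite (_ : (fun _ => _) = (fun p => f p * f p ^+ n)); first exact: cbmM.
by apply/funext => p; rewrite exprS.
Qed.

Lemma cbm_sum (I : Type) (s : seq I) (P : pred I) (F : I -> plane R -> R[i]) :
  (forall i, P i -> cbm (F i)) -> cbm (fun p => \sum_(i <- s | P i) F i p).
Proof.
move=> bF; elim: s => [|i s IH].
  rewrite (_ : (fun _ => _) = fun=> 0); first exact: cbm_cst.
  by apply/funext => p; rewrite big_nil.
have [Pi|nPi] := boolP (P i).
  rewrite (_ : (fun _ => _) = (fun p => F i p + \sum_(i <- s | P i) F i p)).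
    by apply: cbmD => //; exact: bF.
  by apply/funext => p; rewrite big_cons Pi.
rewrite (_ : (fun _ => _) = (fun p => \sum_(i <- s | P i) F i p))//.
by apply/funext => p; rewrite big_cons (negbTE nPi).
Qed.

Lemma Re_cintegral f : Re (cintegral (disc r) f) = Rintegral mu2 (disc r) (fun p => Re (f p)).
Proof. by []. Qed.
Lemma Im_cintegral f : Im (cintegral (disc r) f) = Rintegral mu2 (disc r) (fun p => Im (f p)).
Proof. by []. Qed.

Lemma eq_cintegral f g : (forall p, disc r p -> f p = g p) ->
  cintegral (disc r) f = cintegral (disc r) g.
Proof.
by move=> fg; congr Complex; apply: eq_Rintegral => p /set_mem Dp; rewrite fg.
Qed.

Lemma cintegralD f g : cbm f -> cbm g ->
  cintegral (disc r) (fun p => f p + g p) = cintegral (disc r) f + cintegral (disc r) g.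
Proof.
have mD := measurable_disc r0.
move=> [f1 f2] [g1 g2]; apply: eqc; rewrite ?ReD ?ImD ?Re_cintegral ?Im_cintegral.
  by under eq_Rintegral do rewrite ReD; rewrite RintegralD//; exact: bm_integrable.
by under eq_Rintegral do rewrite ImD; rewrite RintegralD//; exact: bm_integrable.
Qed.

Lemma cintegralZ f z : cbm f -> cintegral (disc r) (fun p => z * f p) = z * cintegral (disc r) f.
Proof.
have mD := measurable_disc r0.
move=> [f1 f2]; have i1 := bm_integrable r0 f1; have i2 := bm_integrable r0 f2.
have iZ c (h : plane R -> R) : bounded_measurable r h ->
    mu2.-integrable (disc r) (EFin \o (fun p => c * h p)).
  by move=> bh; apply: bm_integrable => //; apply: bmM => //; exact: bm_cst.
apply: eqc; rewrite ?ReM ?ImM ?Re_cintegral ?Im_cintegral.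
  under eq_Rintegral do rewrite ReM.
  by rewrite RintegralB ?RintegralZl//; exact: iZ.
under eq_Rintegral do rewrite ImM.
by rewrite RintegralD ?RintegralZl//; exact: iZ.
Qed.

Lemma cintegralJ f : cbm f -> cintegral (disc r) (fun p => (f p)^*) = (cintegral (disc r) f)^*.
Proof.
have mD := measurable_disc r0.
move=> [f1 f2]; apply: eqc; rewrite ?ReJ ?ImJ ?Re_cintegral ?Im_cintegral.
  by apply: eq_Rintegral => p _; rewrite ReJ.
rewrite -mulN1r -RintegralZl//; last exact: bm_integrable.
by apply: eq_Rintegral => p _; rewrite ImJ mulN1r.
Qed.

Lemma cintegral_real (h : plane R -> R) :
  cintegral (disc r) (fun p => (h p)%:C) = (Rintegral mu2 (disc r) h)%:C.
Proof.
apply: eqc; rewrite ?ReC ?ImC // Im_cintegral.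
by rewrite /Rintegral integral0_eq.
Qed.

Lemma cintegral_sum (I : Type) (s : seq I) (P : pred I) (F : I -> plane R -> R[i]) :
  (forall i, P i -> cbm (F i)) ->
  cintegral (disc r) (fun p => \sum_(i <- s | P i) F i p) =
  \sum_(i <- s | P i) cintegral (disc r) (F i).
Proof.
move=> bF; elim: s => [|i s IH].
  transitivity (0 * cintegral (disc r) (fun=> 0)); last by rewrite big_nil mul0r.
  rewrite -cintegralZ; last exact: cbm_cst.
  by apply: eq_cintegral => p _; rewrite big_nil mul0r.
rewrite big_cons; case: ifPn => Pi.
  rewrite -IH -cintegralD; [|exact: bF|exact: cbm_sum].
  by apply: eq_cintegral => p _; rewrite big_cons Pi.
by rewrite -IH; apply: eq_cintegral => p _; rewrite big_cons (negbTE Pi).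
Qed.

Lemma cdisc_average f : cbm f -> (2 * pi)%:C * cintegral (disc r) f =
  cintegral (disc r) (fun p => cint (fun t => f (rotate (cos t) (sin t) p))).
Proof.
move=> [f1 f2]; apply: eqc; rewrite ?ReM ?ImM ?ReC ?ImC ?Re_cintegral ?Im_cintegral.
  by rewrite mul0r subr0 (disc_average r0 f1); apply: eq_Rintegral => p _; rewrite Re_cint.
by rewrite mul0r addr0 (disc_average r0 f2); apply: eq_Rintegral => p _; rewrite Im_cint.
Qed.

Definition zc p : R[i] := (p.1 : R) +i* (p.2 : R).

Lemma nsq_zc p : nsq (zc p) = sqnorm p. Proof. by []. Qed.

Lemma zc_rotate t p : zc (rotate (cos t) (sin t) p) = expi t * zc p.
Proof. by apply: eqc; rewrite ?ReM ?ImM /= // addrC. Qed.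

Lemma cbm_zc : cbm zc.
Proof. by split; [exact: bm_fst|exact: bm_snd]. Qed.

(** At z = r e^(it) this is r^|m| e^(imt): a polynomial in z for m >= 0
    and in its conjugate for m < 0. *)
Definition zpow (m : int) (z : R[i]) : R[i] :=
  if m is Negz _ then (z^*) ^+ `|m|%N else z ^+ `|m|%N.

Lemma conjcX (z : R[i]) n : (z ^+ n)^* = z^* ^+ n.
Proof. exact: rmorphXn. Qed.

Lemma nsqX (z : R[i]) n : nsq (z ^+ n) = nsq z ^+ n.
Proof.
elim: n => [|n IH]; first by rewrite /nsq /= expr1n expr0n addr0.
by rewrite !exprS nsqM IH.
Qed.

Lemma nsq_zpow m z : nsq (zpow m z) = nsq z ^+ `|m|%N.
Proof. by case: m => n; rewrite /zpow nsqX ?nsqJ. Qed.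

Lemma cbm_zpow m : cbm (fun p => zpow m (zc p)).
Proof. by case: m => n; apply: cbmX; [exact: cbm_zc|apply: cbmJ; exact: cbm_zc]. Qed.

Section GrafDisc.
Variables (G : nat -> R -> R) (kap : R) (X : R[i]) (h : R -> R).
Hypothesis cG : cylinder G.
Hypothesis kap_gt0 : 0 < kap.
Hypothesis rX : r ^+ 2 < nsq X.
Hypothesis ch : continuous h.

Lemma nsq_X_gt0 : 0 < nsq X.
Proof. by apply: lt_trans rX; rewrite exprn_gt0. Qed.

Lemma cbm_kernel : cbm (fun p => (G 0 (kap * nsq (X - zc p)))%:C).
Proof.
apply: cbm_real; pose rho := Num.sqrt (nsq X).
have rho2 : nsq X = rho ^+ 2 by rewrite sqr_sqrtr// ltW// nsq_X_gt0.
have rrho : r < rho.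
  by rewrite -(ltr_pXn2r (n := 2))// ?nnegrE ?sqrtr_ge0 ?ltW// -rho2.
have bd p : disc r p -> (rho - r) ^+ 2 <= nsq (X - zc p) <= (rho + r) ^+ 2.
  move=> /(in_discE r0) Dp; apply: nsq_sub_bounds => //; first exact: ltW.
  exact: ltW.
apply: (@bm_comp _ _ (G 0) _ (kap * (rho - r) ^+ 2) (kap * (rho + r) ^+ 2)).
- apply: bmM; first exact: bm_cst.
  have bX : cbm (fun p => X - zc p).
    rewrite (_ : (fun p => _) = (fun p => X + -1 * zc p)).
      by apply: cbmD; [exact: cbm_cst|apply: cbmM; [exact: cbm_cst|exact: cbm_zc]].
    by apply/funext => p; rewrite mulN1r.
  by case: bX => b1 b2; apply: bmD; apply: bmX.
- by move=> p /bd /andP[h1 h2]; rewrite in_itv/= !ler_pM2l ?h1.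
- move=> x; rewrite in_itv/= => /andP[hx _].
  have x0 : 0 < x by apply: lt_le_trans hx; rewrite mulr_gt0// exprn_gt0// subr_gt0.
  by have [/is_derive_continuous] := cG 0 x0.
Qed.

(** Averaging over rotations replaces the kernel, radius by radius, by its
    Fourier coefficient, which Graf's formula evaluates. *)
Lemma graf_disc_nat (m : nat) :
  cintegral (disc r) (fun p => (G 0 (kap * nsq (X - zc p)))%:C *
      (zc p ^+ m * (h (sqnorm p))%:C)) =
  (kap ^+ m * G m (kap * nsq X))%:C * X ^+ m *
  (Rintegral mu2 (disc r)
     (fun p => sqnorm p ^+ m * besselE m (kap * sqnorm p) * h (sqnorm p)))%:C.
Proof.
have X0 := nsq_X_gt0.
pose f p := (G 0 (kap * nsq (X - zc p)))%:C * (zc p ^+ m * (h (sqnorm p))%:C).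
have bf : cbm f.
  apply: cbmM; first exact: cbm_kernel.
  by apply: cbmM; [apply: cbmX; exact: cbm_zc|apply: cbm_real; exact: bm_sqnorm_comp].
have pi2 : (2 * pi)%:C != 0 :> R[i].
  by rewrite eq_complex /= eqxx andbT gt_eqF// mulr_gt0// pi_gt0.
apply: (mulfI pi2); rewrite (cdisc_average bf).
have be : bounded_measurable r (fun p => sqnorm p ^+ m * besselE m (kap * sqnorm p) * h (sqnorm p)).
  apply: bmM; last exact: bm_sqnorm_comp.
  apply: bmM; first by apply: bmX; apply: (bm_sqnorm_comp r0 (h := id)) => x; exact: cvg_id.
  by apply: (bm_sqnorm_comp r0 (h := fun x => besselE m (kap * x))); exact: continuous_besselE_scale.
rewrite -cintegral_real mulrA -cintegralZ; last exact: cbm_real.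
apply: eq_cintegral => p /(in_discE r0) Dp.
pose s : R := Num.sqrt (sqnorm p).
have s2 : s ^+ 2 = sqnorm p by rewrite sqr_sqrtr// sqnorm_ge0.
have [om [om1 zE]] : exists om : R[i], nsq om = 1 /\ zc p = s%:C * om.
  have [s0|s0] := eqVneq s 0.
    exists 1; split; first by rewrite /nsq /= expr1n expr0n addr0.
    by rewrite s0 mul0r; apply: nsq_eq0; rewrite nsq_zc -s2 s0 expr0n.
  have sC : s%:C != 0 by rewrite eq_complex /= eqxx andbT.
  exists (s^-1%:C * zc p); split.
    by rewrite nsqM nsqC nsq_zc -s2 exprVn mulVf// expf_neq0.
  by rewrite mulrA -rmorphM /= divff// mul1r.
have s_ge0 : 0 <= s by exact: sqrtr_ge0.
have srho : s < Num.sqrt (nsq X) by rewrite ltr_sqrt// (lt_trans Dp).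
transitivity (cint (fun t => (zc p ^+ m * (h (sqnorm p))%:C) *
    (cylinder_mode G kap 0 (displacement X om s t) * expi (m%:~R * t)))).
  apply: cint_ext => t.
  rewrite /f; have -> : sqnorm (rotate (cos t) (sin t) p) = sqnorm p.
    by rewrite -!nsq_zc zc_rotate nsqM nsq_expi mul1r.
  rewrite zc_rotate exprMn (_ : m%:~R = m%:R)// expi_natM.
  rewrite /cylinder_mode expr0 mulr1 /displacement.
  have -> : s%:C * (om * expi t) = expi t * zc p by rewrite zE; ring.
  ring.
rewrite cintZ; last first.
  apply: ccontM; last exact: ccont_expi.
  by apply: ccont_mode => //; rewrite ger0_norm.
have := @mode_coefE R G kap X om cG kap_gt0 om1 X0 0 m s s_ge0 srho.
rewrite /mode_coef => ->; rewrite addn0 s2 /cylinder_mode.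
have zz : zc p ^+ m * ((s ^+ m)%:C * om^* ^+ m) = (sqnorm p ^+ m)%:C.
  have CX (x : R) : (x ^+ m)%:C = x%:C ^+ m by rewrite rmorphXn.
  rewrite -nsq_zc !CX nsqE exprMn; congr (_ * _).
  by rewrite zE conjcM conjc_real exprMn.
have CM (x y : R) : (x * y)%:C = x%:C * y%:C by rewrite rmorphM.
rewrite !CM -zz; ring.
Qed.

Lemma graf_disc (m : int) :
  cintegral (disc r) (fun p => (G 0 (kap * nsq (X - zc p)))%:C *
      (zpow m (zc p) * (h (sqnorm p))%:C)) =
  (kap ^+ `|m|%N * G `|m|%N (kap * nsq X))%:C * zpow m X *
  (Rintegral mu2 (disc r)
     (fun p => sqnorm p ^+ `|m|%N * besselE `|m|%N (kap * sqnorm p) * h (sqnorm p)))%:C.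
Proof.
case: m => n; first exact: graf_disc_nat.
rewrite /zpow /=; set k := n.+1.
have := congr1 conjc (graf_disc_nat k).
rewrite -cintegralJ; last first.
  apply: cbmM; first exact: cbm_kernel.
  by apply: cbmM; [apply: cbmX; exact: cbm_zc|apply: cbm_real; exact: bm_sqnorm_comp].
rewrite !conjcM !conjc_real conjcX => <-.
by apply: eq_cintegral => p _; rewrite !conjcM !conjc_real conjcX.
Qed.

End GrafDisc.

End ComplexDisc.

(** * The entries and the invertibility of the diagonal blocks *)

Section BasisFunctions.
Context {R : realType}.
Implicit Types (p : plane R) (m : int) (n : nat).

(** The sign in J_(-m) = (-1)^m J_m. *)
Definition order_sign m : R := if m is Negz _ then (-1) ^+ `|m|%N else 1.

Lemma order_sign_neq0 m : order_sign m != 0.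
Proof. by case: m => n; rewrite /order_sign ?signr_eq0 ?oner_eq0. Qed.

Lemma euclidE p : euclid p = Num.sqrt (sqnorm p). Proof. by []. Qed.

Lemma euclid_ge0 p : 0 <= euclid p. Proof. exact: sqrtr_ge0. Qed.

Lemma euclid_sqr p : euclid p ^+ 2 = sqnorm p.
Proof. by rewrite euclidE sqr_sqrtr// sqnorm_ge0. Qed.

Lemma expi_angle p : (euclid p)%:C * expi (angle p) = zc p.
Proof.
have [e0|e0] := eqVneq (euclid p) 0.
  by rewrite e0 mul0r; apply/esym/nsq_eq0; rewrite nsq_zc -euclid_sqr e0 expr0n.
have e_gt0 : 0 < euclid p by rewrite lt_neqAle eq_sym e0 euclid_ge0.
pose c : R := (p.1 : R) / euclid p.
have c2 : c ^+ 2 = 1 - ((p.2 : R) / euclid p) ^+ 2.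
  rewrite /c !exprMn !exprVn euclid_sqr.
  have s0 : sqnorm p != 0 by rewrite -euclid_sqr expf_neq0.
  rewrite -{1}(mulfV s0) -mulrBl; congr (_ * _).
  by rewrite /sqnorm addrK.
have c1 : -1 <= c <= 1.
  have h : c ^+ 2 <= 1 by rewrite c2 gerBl sqr_ge0.
  by rewrite -ler_norml -(ler_pXn2r (n := 2))// ?nnegrE// real_normK ?num_real// expr1n.
have ss : Num.sqrt (1 - c ^+ 2) = `|(p.2 : R)| / euclid p.
  by rewrite c2 subKr sqrtr_sqr normf_div (ger0_norm (euclid_ge0 p)).
have cE : euclid p * c = p.1 by rewrite /c mulrCA divff// mulr1.
rewrite /angle -/c; case: ifPn => p2.
  apply: eqc; rewrite ?ReM ?ImM ?ReC ?ImC /= ?mul0r ?subr0 ?addr0.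
    by rewrite acosK.
  by rewrite sin_acos// ss ger0_norm// mulrCA divff// mulr1.
apply: eqc; rewrite ?ReM ?ImM ?ReC ?ImC /= ?mul0r ?subr0 ?addr0.
  by rewrite cosN acosK.
rewrite sinN sin_acos// ss ltr0_norm ?ltNge//.
by rewrite mulrN mulNr mulrN opprK mulrCA divff// mulr1.
Qed.

Lemma expi_intM m (t : R) : expi (m%:~R * t) = zpow m (expi t).
Proof.
case: m => n; first exact: expi_natM.
rewrite /zpow -conjcX -expi_natM expiJ; congr expi.
by rewrite -mulNr NegzE mulrNz.
Qed.

Lemma zpowM m (z w : R[i]) : zpow m (z * w) = zpow m z * zpow m w.
Proof. by case: m => n; rewrite /zpow ?conjcM exprMn. Qed.

Lemma zpowC m (x : R) : zpow m x%:C = (x ^+ `|m|%N)%:C.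
Proof. by case: m => n; rewrite /zpow ?conjc_real rmorphXn. Qed.

Lemma CM (x y : R) : (x * y)%:C = x%:C * y%:C. Proof. exact: rmorphM. Qed.

Lemma angular_radial m (k : R) p :
  expi (m%:~R * angle p) * (besselJ m (k * euclid p))%:C =
  (order_sign m * (k / 2) ^+ `|m|%N)%:C * zpow m (zc p) *
    (besselE `|m|%N ((k / 2) ^+ 2 * sqnorm p))%:C.
Proof.
rewrite expi_intM besselJE -expi_angle zpowM zpowC.
have -> : k * euclid p / 2 = k / 2 * euclid p by rewrite mulrAC.
by rewrite !exprMn euclid_sqr !CM -/(order_sign m); ring.
Qed.

Definition phi_coef (r0 : R) m n : R :=
  (Num.sqrt (pi * besselJ (m + 1) (besselJ_zero m n) ^+ 2) * r0)^-1 *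
  (order_sign m * (wavenumber r0 m n / 2) ^+ `|m|%N).

Lemma phiE (r0 : R) m n p : phi r0 m n p =
  (phi_coef r0 m n)%:C * (zpow m (zc p) *
    (besselE `|m|%N ((wavenumber r0 m n / 2) ^+ 2 * sqnorm p))%:C).
Proof.
rewrite /phi /phi_polar -mulrA angular_radial /phi_coef.
by rewrite [((_)^-1 * _)%:C]CM !mulrA.
Qed.

Definition psi_coef (r0 k : R) m : R :=
  (Num.sqrt pi * r0 * bessel_A m (k * r0))^-1 * (order_sign m * (k / 2) ^+ `|m|%N).

Lemma psiE (r0 k : R) m p : psi r0 k m p =
  (psi_coef r0 k m)%:C * (zpow m (zc p) * (besselE `|m|%N ((k / 2) ^+ 2 * sqnorm p))%:C).
Proof.
rewrite /psi /psi_polar -mulrA [X in _ * X]mulrC angular_radial /psi_coef.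
by rewrite [((_)^-1 * _)%:C]CM !mulrA.
Qed.

Lemma besselJ_zero_abs m n : @besselJ_zero R m n = besselJ_zero `|m|%N n.
Proof. by elim: n => //= n ->. Qed.

Lemma wavenumber_abs (r0 : R) m n : wavenumber r0 m n = wavenumber r0 `|m|%N n.
Proof. by rewrite /wavenumber besselJ_zero_abs. Qed.

(** The angular factors are conjugate to each other and multiply to |x|^(2|m|),
    which leaves a radial integral. *)
Lemma dot_phi_psi (r0 : R) m n (k : R) : 0 < r0 ->
  complex.Re (dotL2_disc r0 (phi r0 m n) (psi r0 k m)) =
  phi_coef r0 m n * psi_coef r0 k m *
  Rintegral (lebesgue2 R) (disc r0) (fun p => sqnorm p ^+ `|m|%N *
     besselE `|m|%N ((wavenumber r0 m n / 2) ^+ 2 * sqnorm p) *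
     besselE `|m|%N ((k / 2) ^+ 2 * sqnorm p)).
Proof.
move=> r00; rewrite /dotL2_disc Re_cintegral.
have mD := measurable_disc r00.
rewrite -RintegralZl//; last first.
  apply: bm_integrable => //; apply: bmM => //; last first.
    by apply: (bm_sqnorm_comp r00 (h := fun x => besselE `|m|%N (_ * x))); exact: continuous_besselE_scale.
  apply: bmM => //; last first.
    by apply: (bm_sqnorm_comp r00 (h := fun x => besselE `|m|%N (_ * x))); exact: continuous_besselE_scale.
  by apply: bmX; apply: (bm_sqnorm_comp r00 (h := id)) => x; exact: cvg_id.
apply: eq_Rintegral => p _; rewrite phiE psiE.
set e1 := besselE _ _; set e2 := besselE _ _.
rewrite !conjcM !conjc_real.
have -> : sqnorm p ^+ `|m|%N = nsq (zpow m (zc p)) by rewrite nsq_zpow.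
rewrite -[RHS]ReC; congr complex.Re; rewrite !CM nsqE; ring.
Qed.

Section KBlock.
Variables (r0 : R) (N : nat) (kt : nat -> nat -> R) (m : int).
Hypothesis r0_gt0 : 0 < r0.
Hypothesis N_gt0 : (0 < N)%N.
Local Notation am := `|m|%N.
Local Notation k := (wavenumber r0 am).
Hypothesis kt_gt0 : forall i, (0 < i <= N)%N -> 0 < kt am i.
Hypothesis kt_adm : forall i, (0 < i <= N)%N ->
  exists2 d, admissible_radius r0 N am i d & `|kt am i - k i| < d.

Let adm i : (0 < i <= N)%N -> exists d, admissible_radius r0 N am i d.
Proof. by move=> /kt_adm[d]; exists d. Qed.

Lemma wavenumber_gt0 n : (0 < n <= N.+1)%N -> 0 < k n.
Proof.
move=> nN; rewrite /wavenumber divr_gt0//.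
exact: (besselJ_zero_gt0 r0_gt0 adm N_gt0).
Qed.

Lemma half_wavenumber_zero n : (k n / 2) ^+ 2 * r0 ^+ 2 = (besselJ_zero am n / 2) ^+ 2.
Proof. by rewrite /wavenumber; field; rewrite gt_eqF. Qed.

Lemma besselE_zero n : (0 < n <= N)%N -> besselE am ((k n / 2) ^+ 2 * r0 ^+ 2) = 0.
Proof.
case: n => // n nN; rewrite half_wavenumber_zero.
have [J0 _] := besselJ_zero_root r0_gt0 adm N_gt0 (ltnW nN).
have z0 : 0 < @besselJ_zero R am n.+1.
  have nN1 : (0 < n.+1 <= N.+1)%N by case/andP: nN => _ /leqW.
  exact: (besselJ_zero_gt0 r0_gt0 adm N_gt0 nN1).
move: J0; rewrite besselJ_natE => /eqP; rewrite mulf_eq0 expf_eq0 => /orP[|/eqP//].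
by rewrite (gt_eqF (divr_gt0 z0 _)) ?andbF.
Qed.

(** The norming factor contains J_(m+1) at a zero of J_m, which is nonzero since
    that zero is simple. For m < 0 the order m + 1 has the absolute value
    |m| - 1, and the recurrence passes from |m| + 1 to it. *)
Lemma phi_coef_neq0 n : (0 < n <= N)%N -> phi_coef r0 m n != 0.
Proof.
move=> nN; have nN1 : (0 < n <= N.+1)%N by case/andP: nN => -> nN; rewrite leqW.
have z0 := besselJ_zero_gt0 r0_gt0 adm N_gt0 nN1.
have k0 := wavenumber_gt0 nN1.
have E0 := besselE_zero nN; rewrite half_wavenumber_zero in E0.
set u := (besselJ_zero am n / 2) ^+ 2 in E0.
have u0 : 0 < u by rewrite exprn_gt0// divr_gt0.
rewrite /phi_coef mulf_neq0//; last first.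
  rewrite mulf_neq0 ?order_sign_neq0// expf_neq0// mulf_neq0 ?invr_eq0//.
  by rewrite wavenumber_abs gt_eqF.
rewrite invr_eq0 mulf_neq0 ?gt_eqF// sqrtr_gt0 mulr_gt0 ?pi_gt0//.
rewrite exprn_even_gt0//= besselJ_zero_abs besselJE -/u.
have hu : besselE (absz (m + 1)) u != 0.
  move: E0 z0 k0; rewrite -/u; move: u0; case: (m) => l /= u0 E0 _ _.
    by rewrite addn1; exact: besselE_simple_zero.
  rewrite (_ : Negz l + 1 = - l%:Z) ?abszN; last first.
    by rewrite NegzE -addn1 PoszD opprD subrK.
  have := besselE_simple_zero u0 E0; apply: contra => /eqP El.
  have := besselE_three_term l u; rewrite E0 El mulr0 subr0 => /eqP.
  by rewrite mulf_eq0 gt_eqF.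
rewrite mulf_neq0// mulf_neq0//; first exact: order_sign_neq0.
by rewrite expf_neq0// gt_eqF// divr_gt0.
Qed.

Lemma psi_coef_neq0 (x : R) : 0 < x -> psi_coef r0 x m != 0.
Proof.
move=> x0; rewrite /psi_coef mulf_neq0//; last first.
  by rewrite mulf_neq0 ?order_sign_neq0// expf_neq0// gt_eqF// divr_gt0.
have y0 : 0 < (x * r0 / 2) ^+ 2 by rewrite exprn_gt0// divr_gt0// mulr_gt0.
rewrite invr_eq0 bessel_AE gt_eqF// mulr_gt0//.
  by rewrite mulr_gt0// sqrtr_gt0 pi_gt0.
by rewrite sqrtr_gt0; apply: mulr_gt0; [exact: exprn_gt0|exact: besselA_gt0].
Qed.

Local Notation lommel a b := (Rintegral (lebesgue2 R) (disc r0) (fun p => sqnorm p ^+ am *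
   besselE am (a * sqnorm p) * besselE am (b * sqnorm p))).

Lemma besselE_off_zero n x : (n <= N)%N -> k n < x < k n.+1 ->
  besselE am ((x / 2) ^+ 2 * r0 ^+ 2) != 0.
Proof.
move=> nN /andP[x1 x2].
have [_ /(_ (x * r0))] := besselJ_zero_root r0_gt0 adm N_gt0 nN.
move: x1 x2; rewrite /wavenumber ltr_pdivrMr// ltr_pdivlMr// in_itv/= => -> -> /(_ isT).
rewrite besselJ_natE mulf_eq0 negb_or => /andP[_].
by rewrite (_ : (x * r0 / 2) ^+ 2 = (x / 2) ^+ 2 * r0 ^+ 2)//; ring.
Qed.

Lemma wavenumber_inj i n : (0 < i <= N)%N -> (0 < n <= N)%N -> i != n -> k i != k n.
Proof.
move=> /andP[i0 iN] /andP[n0 nN].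
have mono := increasing_below (wavenumber_lt adm N_gt0).
rewrite neq_ltn => /orP[] h.
  by rewrite lt_eqF// mono// h /= leqW.
by rewrite gt_eqF// mono// h /= leqW.
Qed.

Definition row_factor (x : R) : R := psi_coef r0 x m *
  besselE am ((x / 2) ^+ 2 * r0 ^+ 2) * (r0 ^+ 2) ^+ am * fine ((lebesgue2 R) (disc r0)).

Definition column_factor n : R :=
  - (phi_coef r0 m n * k n * besselE am.+1 ((k n / 2) ^+ 2 * r0 ^+ 2)).

Lemma column_factor_neq0 n : (0 < n <= N)%N -> column_factor n != 0.
Proof.
move=> nN; have k0 : 0 < k n by apply: wavenumber_gt0; case/andP: nN => -> /leqW.
rewrite oppr_eq0 mulf_neq0 ?besselE_simple_zero ?besselE_zero//.
  by rewrite mulf_neq0 ?phi_coef_neq0// gt_eqF.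
by rewrite mulr_gt0 ?exprn_gt0// divr_gt0.
Qed.

(** Since E_m vanishes at the wavenumber k_n, one of the two boundary terms of
    Lommel's integral drops out, and what remains is a quotient of Cauchy type up
    to a factor of the row and a factor of the column. *)
Lemma dot_cauchy n x : (0 < n <= N)%N -> 0 < x -> x != k n ->
  phi_coef r0 m n * psi_coef r0 x m * lommel ((k n / 2) ^+ 2) ((x / 2) ^+ 2) =
  row_factor x * (k n / (x ^+ 2 - k n ^+ 2)) * column_factor n.
Proof.
move=> nN x0 xk; have k0 : 0 < k n by apply: wavenumber_gt0; case/andP: nN => -> /leqW.
have s0 : x + k n != 0 by rewrite gt_eqF// addr_gt0.
have d0 : x - k n != 0 by rewrite subr_eq0.
have ab : (k n / 2) ^+ 2 != (x / 2) ^+ 2.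
  rewrite -subr_eq0 (_ : _ - _ = - (x + k n) * (x - k n) / 4); last by field.
  by rewrite !mulf_neq0 ?oppr_eq0 ?invr_eq0 ?pnatr_eq0.
rewrite disc_lommel// besselE_zero// /row_factor /column_factor.
have -> : (k n / 2) ^+ 2 - (x / 2) ^+ 2 = - (x + k n) * (x - k n) / 4 by field.
have -> : x ^+ 2 - k n ^+ 2 = (x + k n) * (x - k n) by ring.
set e1 := besselE _ _; set e2 := besselE _ _; set e3 := besselE _ _.
field.
by rewrite s0 d0.
Qed.

Lemma dot_diag_neq0 n : (0 < n <= N)%N ->
  phi_coef r0 m n * psi_coef r0 (k n) m * lommel ((k n / 2) ^+ 2) ((k n / 2) ^+ 2) != 0.
Proof.
move=> nN; have k0 : 0 < k n by apply: wavenumber_gt0; case/andP: nN => -> /leqW.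
have k20 : 0 < (k n / 2) ^+ 2 by rewrite exprn_gt0// divr_gt0.
rewrite mulf_neq0//; first by rewrite mulf_neq0 ?phi_coef_neq0 ?psi_coef_neq0.
rewrite disc_lommel_diag ?gt_eqF// mulr_gt0 ?area_gt0//.
apply: mulr_gt0; first by rewrite !exprn_gt0.
by apply: besselA_gt0; apply: mulr_gt0 => //; rewrite exprn_gt0.
Qed.

Lemma KblockE (i n : 'I_N) : Kblock r0 N kt m i n =
  phi_coef r0 m n.+1 * psi_coef r0 (kt am i.+1) m *
  lommel ((k n.+1 / 2) ^+ 2) ((kt am i.+1 / 2) ^+ 2).
Proof. rewrite mxE (dot_phi_psi _ _ _ r0_gt0) (wavenumber_abs r0 m); reflexivity. Qed.

(** After division of the columns by their factors, row i is a multiple of the row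
    with entries k_n / (x^2 - k_n^2), x being the i-th frequency, which is strictly
    dominated by its diagonal entry. If x equals k_i, the row vanishes off the
    diagonal by orthogonality. *)
Lemma Kblock_unitmx : Kblock r0 N kt m \in unitmx.
Proof.
(* The column factors are divided out; the row factors do not affect dominance. *)
pose D : 'rV[R]_N := \row_n (column_factor n.+1)^-1.
suff : Kblock r0 N kt m *m diag_mx D \in unitmx by rewrite unitmx_mul => /andP[].
apply: dominant_unitmx => i.
have iN : (0 < i.+1 <= N)%N by rewrite ltn_ord.
have nN (n : 'I_N) : (0 < n.+1 <= N)%N by rewrite ltn_ord.
have x0 := kt_gt0 iN; have [d dadm xd] := kt_adm iN.
have [T [TE Toff Tdiag]] : exists T : nat -> R, [/\
    forall n : 'I_N, (Kblock r0 N kt m *m diag_mx D) i n = T n,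
    forall n : 'I_N, kt am i.+1 != k n.+1 ->
      T n = row_factor (kt am i.+1) * (k n.+1 / (kt am i.+1 ^+ 2 - k n.+1 ^+ 2)) &
    kt am i.+1 = k i.+1 -> T i != 0].
  exists (fun n => phi_coef r0 m n.+1 * psi_coef r0 (kt am i.+1) m *
    lommel ((k n.+1 / 2) ^+ 2) ((kt am i.+1 / 2) ^+ 2) / column_factor n.+1); split.
  - by move=> n; rewrite mul_mx_diag mxE KblockE [D _ _]mxE.
  - by move=> n xk; rewrite (dot_cauchy (nN n) x0 xk) mulfK// column_factor_neq0.
  - by move=> ->; rewrite mulf_neq0 ?invr_eq0 ?column_factor_neq0// dot_diag_neq0.
under eq_bigr do rewrite TE.
rewrite TE; move: (kt am i.+1) x0 xd Toff Tdiag => x x0 xd Toff Tdiag.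
have [xk|xk] := eqVneq x (k i.+1).
  rewrite big1 => [|n ni]; first by rewrite normr_gt0 Tdiag.
  have in1 : i.+1 != n.+1 by rewrite eqSS eq_sym.
  rewrite Toff; last by rewrite xk; exact: (wavenumber_inj iN (nN n) in1).
  by rewrite xk /row_factor besselE_zero// mulr0 !mul0r normr0.
have rx0 : row_factor x != 0.
  have hE : besselE am ((x / 2) ^+ 2 * r0 ^+ 2) != 0.
    have /andP[h1 h2] := wavenumber_neighbours adm N_gt0 iN dadm xd.
    have := xk; rewrite neq_lt => /orP[h|h].
      by apply: (@besselE_off_zero i); [exact: ltnW|rewrite h1 h].
    by apply: (@besselE_off_zero i.+1) => //; rewrite h h2.
  rewrite /row_factor; apply: mulf_neq0; last by rewrite gt_eqF// area_gt0.
  apply: mulf_neq0; last by rewrite !expf_neq0// gt_eqF.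
  by apply: mulf_neq0 => //; exact: psi_coef_neq0.
have kn (n : 'I_N) : x != k n.+1.
  have /andP[h1 h2] := wavenumber_neighbours adm N_gt0 iN dadm xd.
  have mono := increasing_below (wavenumber_lt adm N_gt0).
  have [->//|] := eqVneq n i; rewrite neq_ltn => /orP[ni|ni].
    rewrite gt_eqF// (le_lt_trans _ h1)//=.
    move: ni; rewrite leq_eqVlt => /orP[/eqP ->//|ni]; apply/ltW/mono.
    by rewrite ni /= ltnW// ltnW.
  rewrite lt_eqF// (lt_le_trans h2)//.
  move: ni; rewrite -ltnS leq_eqVlt => /orP[/eqP ->//|ni]; apply/ltW/mono.
  by rewrite ni /= leqW.
rewrite (Toff _ xk) (eq_bigr (fun n : 'I_N =>
    `|row_factor x| * `|k n.+1 / (x ^+ 2 - k n.+1 ^+ 2)|)); last first.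
  by move=> n _; rewrite (Toff _ (kn n)) normrM.
rewrite [ltRHS]normrM -mulr_sumr ltr_pM2l ?normr_gt0//.
have := wavenumber_row_dominant r0_gt0 adm N_gt0 iN dadm xd xk.
have k_gt0 (n : 'I_N) : 0 < k n.+1 by apply: wavenumber_gt0; rewrite /= ltnS ltnW.
rewrite big_add1 big_mkord normf_div (gtr0_norm (k_gt0 i)).
apply: le_lt_trans; rewrite le_eqVlt; apply/orP; left; apply/eqP.
apply: eq_big => n; first by rewrite eqSS.
by move=> _; rewrite normf_div (gtr0_norm (k_gt0 n)).
Qed.

End KBlock.
End BasisFunctions.

(** * The forward operator on the basis *)

Section Outgoing.
Context {R : realType}.
Variables (r0 k : R) (x : plane R).
Hypothesis r0_gt0 : 0 < r0.
Hypothesis k_gt0 : 0 < k.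
Hypothesis x_out : r0 ^+ 2 < nsq (zc x).
Local Notation kap := ((k / 2) ^+ 2).
Local Notation mu2 := (lebesgue2 R).
Implicit Types (p y : plane R) (m : int) (n : nat).

Let kap_gt0 : 0 < kap. Proof. by rewrite exprn_gt0// divr_gt0. Qed.

(** The Hankel function of order |m|, freed from its power of x. *)
Definition outgoing m (u : R) : R[i] :=
  (besselE `|m|%N u)%:C + 'i * (besselY `|m|%N u)%:C.

Lemma outgoing_neq0 m u : 0 < u -> outgoing m u != 0.
Proof.
move=> u0; apply/eqP => h.
have := congr1 (@complex.Re R) h; have := congr1 (@complex.Im R) h.
rewrite /outgoing ReD ImD ReM ImM !ReC !ImC /= !(mul0r, mulr0, mul1r, subr0, addr0, add0r).
by move=> Y0 E0; have := besselEY_neq0 u0 E0; rewrite Y0 eqxx.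
Qed.

Lemma greenE y : disc r0 y ->
  green k x y = - ('i / 4) * outgoing 0 (kap * nsq (zc x - zc y)).
Proof.
move=> /(in_discE r0_gt0) Dy.
have nxy : 0 < nsq (zc x - zc y) by apply: nsq_sub_gt0; rewrite (lt_trans _ x_out).
rewrite /green; congr (_ * _).
set e := euclid _.
have e2 : e ^+ 2 = nsq (zc x - zc y) by rewrite /e euclid_sqr; rewrite /nsq ReD ImD ReN ImN.
have e0 : 0 < e.
  by rewrite lt_neqAle euclid_ge0 andbT eq_sym; apply: contraTneq nxy => e0; rewrite -e2 e0 expr0n ltxx.
have ke : (k * e / 2) ^+ 2 = kap * nsq (zc x - zc y) by rewrite -e2; ring.
rewrite /hankel1_0 besselY0E ?mulr_gt0// besselJE ke /= expr0 !mul1r /outgoing /=.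
by apply: eqc; rewrite ?ReD ?ImD ?ReM ?ImM /= !(mul0r, mulr0, mul1r, subr0, addr0, add0r).
Qed.

Lemma cbm_outgoing : cbm r0 (fun y => - ('i / 4) * outgoing 0 (kap * nsq (zc x - zc y))).
Proof.
apply: cbmM; first exact: cbm_cst.
apply: cbmD; first exact: (cbm_kernel r0_gt0 cylinder_besselE kap_gt0 x_out).
apply: cbmM; first exact: cbm_cst.
exact: (cbm_kernel r0_gt0 cylinder_besselY kap_gt0 x_out).
Qed.

Lemma cbm_phi m n : cbm r0 (phi r0 m n).
Proof.
rewrite (_ : phi r0 m n = fun p => (phi_coef r0 m n)%:C * (zpow m (zc p) *
    (besselE `|m|%N ((wavenumber r0 m n / 2) ^+ 2 * sqnorm p))%:C)); last first.
  by apply/funext => p; exact: phiE.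
apply: cbmM; first exact: cbm_cst.
apply: cbmM; first exact: cbm_zpow.
apply: cbm_real; apply: (bm_sqnorm_comp r0_gt0 (h := fun x => besselE `|m|%N (_ * x))).
exact: continuous_besselE_scale.
Qed.

(** By Graf's formula the field radiated by phi is an outgoing wave of the same
    angular order, and its amplitude is the radial integral that also defines
    the entry of K: the measurement at frequency k is a multiple of the scalar
    product with psi. *)
Lemma forward_phi m n : forward r0 k (phi r0 m n) x =
  - ('i / 4) * outgoing m (kap * nsq (zc x)) * (kap ^+ `|m|%N / psi_coef r0 k m)%:C *
  zpow m (zc x) * (complex.Re (dotL2_disc r0 (phi r0 m n) (psi r0 k m)))%:C.
Proof.
rewrite (dot_phi_psi _ _ _ r0_gt0).
set I := Rintegral _ _ _; pose h := fun t : R => besselE `|m|%N ((wavenumber r0 m n / 2) ^+ 2 * t).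
have ch : continuous h by exact: continuous_besselE_scale.
have IE : I = Rintegral mu2 (disc r0)
    (fun p => sqnorm p ^+ `|m|%N * besselE `|m|%N (kap * sqnorm p) * h (sqnorm p)).
  by apply: eq_Rintegral => p _; rewrite mulrAC.
have gE := graf_disc r0_gt0 cylinder_besselE kap_gt0 x_out ch m.
have gY := graf_disc r0_gt0 cylinder_besselY kap_gt0 x_out ch m.
rewrite -IE in gE; rewrite -IE in gY.
have cb (G : nat -> R -> R) : cylinder G -> cbm r0 (fun p => (G 0 (kap * nsq (zc x - zc p)))%:C *
    (zpow m (zc p) * (h (sqnorm p))%:C)).
  move=> cG; apply: cbmM; first exact: (cbm_kernel r0_gt0 cG kap_gt0 x_out).
  by apply: cbmM; [exact: cbm_zpow|apply: cbm_real; exact: bm_sqnorm_comp].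
transitivity (cintegral (disc r0) (fun p => (- ('i / 4) * (phi_coef r0 m n)%:C) *
   ((besselE 0 (kap * nsq (zc x - zc p)))%:C * (zpow m (zc p) * (h (sqnorm p))%:C) +
    'i * ((besselY 0 (kap * nsq (zc x - zc p)))%:C * (zpow m (zc p) * (h (sqnorm p))%:C))))).
  apply: eq_cintegral => p Dp; rewrite greenE// phiE /outgoing -/(h _) absz0; ring.
have bY := cb _ cylinder_besselY; have bE := cb _ cylinder_besselE.
have biY := cbmM (cbm_cst r0 'i) bY.
apply: (etrans (cintegralZ r0_gt0 _ (cbmD bE biY))).
rewrite (cintegralD r0_gt0 bE biY) (cintegralZ r0_gt0 _ bY) gE gY /outgoing.
move: (psi_coef_neq0 m r0_gt0 k_gt0).
generalize (phi_coef r0 m n) (psi_coef r0 k m) => c d d0.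
have dd : d%:C * d^-1%:C = 1 by rewrite -CM divff.
rewrite !CM -[LHS]mulr1 -dd; ring.
Qed.

Lemma measurable_cmul (f g : plane R -> R[i]) :
  measurable_fun (disc r0) (fun p => complex.Re (f p)) ->
  measurable_fun (disc r0) (fun p => complex.Im (f p)) -> cbm r0 g ->
  measurable_fun (disc r0) (fun p => complex.Re (g p * f p)) /\
  measurable_fun (disc r0) (fun p => complex.Im (g p * f p)).
Proof.
move=> f1 f2 [[g1 _] [g2 _]]; split.
  rewrite (_ : (fun _ => _) = (fun p => complex.Re (g p) * complex.Re (f p) -
      complex.Im (g p) * complex.Im (f p))); last by apply/funext => p; rewrite ReM.
  by apply: measurable_funB; exact: measurable_funM.
rewrite (_ : (fun _ => _) = (fun p => complex.Re (g p) * complex.Im (f p) +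
    complex.Im (g p) * complex.Re (f p))); last by apply/funext => p; rewrite ImM.
by apply: measurable_funD; exact: measurable_funM.
Qed.

Lemma ae_Rintegral (f g : plane R -> R) :
  measurable_fun (disc r0) f -> measurable_fun (disc r0) g ->
  {ae mu2, forall p, disc r0 p -> f p = g p} ->
  Rintegral mu2 (disc r0) f = Rintegral mu2 (disc r0) g.
Proof.
move=> mf mg fg; rewrite /Rintegral; congr fine; apply: ae_eq_integral.
- exact: measurable_disc.
- exact/measurable_EFinP.
- exact/measurable_EFinP.
- by apply: filterS fg => p /[apply] ->.
Qed.

Lemma forward_ae (f g : plane R -> R[i]) : inL2_disc r0 f -> cbm r0 g ->
  eqL2_disc r0 f g -> forward r0 k f x = forward r0 k g x.
Proof.
move=> [f1 f2 _] [[g1 _] [g2 _]] fg; rewrite /forward.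
pose K y := - ('i / 4) * outgoing 0 (kap * nsq (zc x - zc y)).
transitivity (cintegral (disc r0) (fun p => K p * f p)).
  by apply: eq_cintegral => p Dp; rewrite greenE.
transitivity (cintegral (disc r0) (fun p => K p * g p)); last first.
  by apply: eq_cintegral => p Dp; rewrite greenE.
have [mf1 mf2] := measurable_cmul f1 f2 cbm_outgoing.
have [mg1 mg2] := measurable_cmul g1 g2 cbm_outgoing.
by apply: eqc; rewrite ?Re_cintegral ?Im_cintegral; apply: ae_Rintegral => //;
  apply: filterS fg => p /[apply] ->.
Qed.

Lemma forward_source (M N : nat) (s : plane R -> R[i]) (c : 'I_(M.*2.+1) -> 'I_N -> R[i]) :
  inL2_disc r0 s ->
  eqL2_disc r0 s (fun x => \sum_(b < M.*2.+1) \sum_(n < N) c b n * phi r0 (b%:Z - M%:Z) n.+1 x) ->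
  forward r0 k s x =
  \sum_(b < M.*2.+1) \sum_(n < N) c b n * forward r0 k (phi r0 (b%:Z - M%:Z) n.+1) x.
Proof.
move=> Ls sE; have cb (b : 'I_(M.*2.+1)) (n : 'I_N) : cbm r0 (fun p => c b n * phi r0 (b%:Z - M%:Z) n.+1 p).
  by apply: cbmM; [exact: cbm_cst|exact: cbm_phi].
rewrite (forward_ae Ls _ sE); last by apply: cbm_sum => b _; exact: cbm_sum.
pose K y := - ('i / 4) * outgoing 0 (kap * nsq (zc x - zc y)).
have cK := cbm_outgoing; have cp m n := cbmM cK (cbm_phi m n).
transitivity (cintegral (disc r0) (fun p => \sum_(b < M.*2.+1) \sum_(n < N)
    c b n * (K p * phi r0 (b%:Z - M%:Z) n.+1 p))).
  apply: eq_cintegral => p Dp; rewrite greenE// mulr_sumr; apply: eq_bigr => b _.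
  by rewrite mulr_sumr; apply: eq_bigr => n _; rewrite mulrCA.
have cb2 (b : 'I_(M.*2.+1)) (n : 'I_N) : cbm r0 (fun p => c b n * (K p * phi r0 (b%:Z - M%:Z) n.+1 p)).
  by apply: cbmM; [exact: cbm_cst|exact: cp].
rewrite cintegral_sum => [|//|b _]; last by apply: cbm_sum.
apply: eq_bigr => b _; rewrite cintegral_sum//; apply: eq_bigr => n _.
rewrite (cintegralZ r0_gt0 _ (cp _ _)); congr (_ * _).
by apply: eq_cintegral => p Dp; rewrite greenE.
Qed.

End Outgoing.

(** * Trigonometric polynomials vanishing almost everywhere *)

Section TrigPolynomial.
Context {R : realType}.
Local Notation mu := (@lebesgue_measure R).

Lemma ae_inhabits_interval (P : set (measurableTypeR R)) (a b : R) : a < b ->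
  {ae mu, forall t, P t} -> exists2 t : R, a <= t < b & P t.
Proof.
move=> ab aeP; apply: contrapT => nP.
have H : mu.-negligible (`[a, b[%classic : set (measurableTypeR R)).
  apply: negligibleS aeP => t /=; rewrite in_itv/= => tab Pt; apply: nP.
  by exists t.
have mI : measurable (`[a, b[%classic : set (measurableTypeR R)) by exact: measurable_itv.
have := etrans (esym (lebesgue_measure_itv `[a, b[)) (measure_negligible mI H).
rewrite /= lte_fin ab -EFinD => /eqP.
by rewrite eqe subr_eq0 gt_eqF.
Qed.

(** Up to the factor e^(-iMt) this is a polynomial in e^(it). Each of n + 1
    disjoint subintervals of [0, pi], on which cos is injective, contains a zero,
    which is more than the degree permits. *)
Lemma trig_polynomial_eq0 (n M : nat) (a : 'I_n -> R[i]) :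
  {ae mu, forall t : R, 0 <= t < 2 * pi ->
    \sum_(b < n) a b * expi ((b%:Z - M%:Z)%:~R * t) = 0} ->
  forall b, a b = 0.
Proof.
move=> ae0.
have grid (j : 'I_n.+1) : exists t : R, [/\ pi * (j%:R / n.+1%:R) <= t < pi * (j.+1%:R / n.+1%:R) &
    \sum_(b < n) a b * expi (b%:R * t) = 0].
  have n0 : 0 < n.+1%:R^-1 :> R by rewrite invr_gt0 ltr0n.
  have [|t tj h] := ae_inhabits_interval _ ae0 (a := pi * (j%:R / n.+1%:R)) (b := pi * (j.+1%:R / n.+1%:R)).
    by rewrite ltr_pM2l ?pi_gt0// ltr_pM2r// ltr_nat.
  exists t; split => //.
  have ht : 0 <= t < 2 * pi.
    have /andP[t1 t2] := tj; rewrite (le_trans _ t1)/=; last first.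
      by rewrite !mulr_ge0 ?pi_ge0 ?ler0n// ltW.
    apply: (lt_le_trans t2); rewrite mulrC ler_pM2r ?pi_gt0//.
    apply: (@le_trans _ _ 1); last by rewrite ler1n.
    by rewrite ler_pdivrMr ?ltr0n// mul1r ler_nat.
  transitivity (expi (M%:R * t) * \sum_(b < n) a b * expi ((b%:Z - M%:Z)%:~R * t)).
    rewrite mulr_sumr; apply: eq_bigr => b _; rewrite mulrCA -expiD; congr (_ * expi _).
    by rewrite -mulrDl intrB addrCA subrr addr0.
  by rewrite h// mulr0.
have [t tP] := choice grid.
have t_mono (i j : 'I_n.+1) : (i < j)%N -> t i < t j.
  move=> ij; have [/andP[_ h1] _] := tP i; have [/andP[h2 _] _] := tP j.
  apply: (lt_le_trans h1); apply: le_trans h2.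
  by rewrite ler_pM2l ?pi_gt0// ler_pM2r ?invr_gt0 ?ltr0n// ler_nat.
have t_range (i : 'I_n.+1) : t i \in `[0, pi].
  have [/andP[h1 h2] _] := tP i; rewrite in_itv/= (le_trans _ h1)/=; last first.
    by rewrite !mulr_ge0 ?pi_ge0 ?ler0n// invr_ge0.
  rewrite (le_trans (ltW h2))// ler_piMr ?pi_ge0//.
  by rewrite ler_pdivrMr ?ltr0n// mul1r ler_nat.
have expi_inj : injective (fun i : 'I_n.+1 => expi (t i)).
  move=> i j /(congr1 (@complex.Re R)) /= cij.
  have tij := cos_inj (t_range i) (t_range j) cij.
  apply/val_inj/eqP; case: (ltngtP i j) => // /t_mono; rewrite tij ltxx //.
(* Evaluated at e^(it), p is the sum multiplied by e^(iMt). *)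
pose p := \poly_(b < n) (if insub b is Some b' then a b' else 0).
have p0 : p = 0.
  apply: (@roots_geq_poly_eq0 _ p [seq expi (t i) | i : 'I_n.+1]).
  - apply/allP => z /mapP[i _ ->]; apply/rootP; rewrite horner_poly.
    have [_ h] := tP i; rewrite -[RHS]h; apply: eq_bigr => b _.
    by rewrite valK expi_natM.
  - by rewrite map_inj_uniq// enum_uniq.
  - by rewrite size_image card_ord (leq_trans (size_poly _ _)).
move=> b; have := congr1 (fun q : {poly R[i]} => q`_b) p0.
by rewrite coef_poly ltn_ord coef0 valK.
Qed.

End TrigPolynomial.

(** * Recovery of the source *)

Section Recovery.
Context {R : realType}.
Variables (r0 Rout : R) (M N : nat) (kt : nat -> nat -> R).
Hypotheses (r0_gt0 : 0 < r0) (r0_lt : r0 < Rout) (N_gt0 : (0 < N)%N).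
Hypothesis kt_gt0 : forall m i : nat, (m <= M)%N -> (0 < i <= N)%N -> 0 < kt m i.
Hypothesis kt_close : forall m i : nat, (m <= M)%N -> (0 < i <= N)%N ->
  `|kt m i - wavenumber r0 m i| < Delta_k r0 M N.
Implicit Types (m : int) (s : plane R -> R[i]).

Lemma Kblock_order_unitmx m : (`|m| <= M)%N -> Kblock r0 N kt m \in unitmx.
Proof.
move=> mM; apply: Kblock_unitmx => // i iN; first exact: kt_gt0.
exact: Delta_k_admissible (kt_close mM iN).
Qed.

Lemma block_order_le (b : 'I_(M.*2.+1)) : (`|block_order M b| <= M)%N.
Proof.
rewrite /block_order; case: ifPn => [//|]; rewrite -leqNgt => Mb.
rewrite -[X in (X <= _)%N]abszN opprB (subzn Mb) absz_nat leq_subLR addnn.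
by rewrite -ltnS.
Qed.

Lemma signed_order_le (b : 'I_(M.*2.+1)) : (absz (b%:Z - M%:Z)%R <= M)%N.
Proof.
have bM : (b <= M.*2)%N by rewrite -ltnS.
case: (leqP M b) => Mb; first by rewrite subzn// absz_nat leq_subLR addnn.
rewrite -[X in (X <= _)%N]abszN opprB (subzn (ltnW Mb)).
exact: leq_subr.
Qed.

Lemma Kmatrix_unitmx : Kmatrix r0 M N kt \in unitmx.
Proof.
by apply: unitmx_mxdiag => b; apply: Kblock_order_unitmx; exact: block_order_le.
Qed.

Lemma zc_of_polar t : zc (of_polar Rout t) = Rout%:C * expi t.
Proof. by apply: eqc; rewrite ?ReM ?ImM /= ?(mul0r, subr0, addr0). Qed.

Lemma nsq_of_polar t : nsq (zc (of_polar Rout t)) = Rout ^+ 2.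
Proof. by rewrite zc_of_polar nsqM nsq_expi mulr1 nsqC. Qed.

(** The real matrix K acts separately on the real and imaginary parts. *)
Lemma Kblock_combination_eq0 m (c : 'I_N -> R[i]) : (`|m| <= M)%N ->
  (forall i : 'I_N, \sum_(n < N) c n * (Kblock r0 N kt m i n)%:C = 0) ->
  forall n, c n = 0.
Proof.
move=> mM c0; have Ku := Kblock_order_unitmx mM.
have real_eq0 (d : 'I_N -> R) :
    (forall i : 'I_N, \sum_(n < N) d n * Kblock r0 N kt m i n = 0) -> forall n, d n = 0.
  move=> d0 n; have : Kblock r0 N kt m *m (\col_n d n) = 0.
    apply/colP => i; rewrite !mxE -[RHS](d0 i); apply: eq_bigr => j _.
    by rewrite [X in _ * X]mxE mulrC.
  by move=> /(congr1 (mulmx (invmx (Kblock r0 N kt m)))); rewrite mulKmx// mulmx0 => /colP/(_ n); rewrite !mxE.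
have Re_sum (F : 'I_N -> R[i]) : complex.Re (\sum_(n < N) F n) = \sum_(n < N) complex.Re (F n).
  by apply: (big_morph _ (@ReD R)).
have Im_sum (F : 'I_N -> R[i]) : complex.Im (\sum_(n < N) F n) = \sum_(n < N) complex.Im (F n).
  by apply: (big_morph _ (@ImD R)).
move=> n; apply: eqc.
  apply: (real_eq0 (fun n => complex.Re (c n))) => i.
  rewrite -[RHS](congr1 (@complex.Re R) (c0 i)) Re_sum; apply: eq_bigr => j _.
  by rewrite ReM ReC ImC mulr0 subr0.
apply: (real_eq0 (fun n => complex.Im (c n))) => i.
rewrite -[RHS](congr1 (@complex.Im R) (c0 i)) Im_sum; apply: eq_bigr => j _.
by rewrite ImM ReC ImC mulr0 add0r.
Qed.

(** On the outer circle the angular orders separate. In the order m of a given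
    pair (b, n), the frequency kt |m| i determines, up to a nonzero gain, the
    product of row i of the block of order m with the coefficients of that
    order; the block being invertible, these products determine the
    coefficients. *)
Lemma source_recovery s s' : source_space r0 M N s -> source_space r0 M N s' ->
  (forall m i : nat, (m <= M)%N -> (0 < i <= N)%N ->
     eqL2_circle Rout (forward r0 (kt m i) s) (forward r0 (kt m i) s')) ->
  eqL2_disc r0 s s'.
Proof.
move=> [Ls [c sE]] [Ls' [c' sE']] data.
suff cc b n : c b n = c' b n.
  apply: filterS2 sE sE' => p sp sp' Dp; rewrite sp// sp'//.
  by apply: eq_bigr => b _; apply: eq_bigr => n _; rewrite cc.
have Rout_gt0 : 0 < Rout by exact: lt_trans r0_lt.
have out t : r0 ^+ 2 < nsq (zc (of_polar Rout t)).
  by rewrite nsq_of_polar ltr_pXn2r// ?nnegrE ltW.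
apply/eqP; rewrite -subr_eq0; apply/eqP.
set m : int := b%:Z - M%:Z; have mM : (`|m| <= M)%N := signed_order_le b.
apply: (@Kblock_combination_eq0 m (fun n => c b n - c' b n)) => // i.
have iN : (0 < i.+1 <= N)%N by rewrite ltn_ord.
have k_gt0 := kt_gt0 mM iN; set k := kt `|m|%N i.+1 in k_gt0.
(* The amplitude of the outgoing wave of order l per unit of scalar product. *)
pose gain (l : int) : R[i] := - ('i / 4) * outgoing l ((k / 2) ^+ 2 * Rout ^+ 2) *
  (((k / 2) ^+ 2) ^+ `|l|%N / psi_coef r0 k l)%:C * (Rout ^+ `|l|%N)%:C.
have gain_neq0 l : gain l != 0.
  have C0 (x : R) : x != 0 -> x%:C != 0 :> R[i] by rewrite eq_complex /= eqxx andbT.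
  have k2 : 0 < (k / 2) ^+ 2 by rewrite exprn_gt0// divr_gt0.
  rewrite /gain mulf_neq0//; last by rewrite C0// expf_neq0// gt_eqF.
  rewrite mulf_neq0//; last first.
    by rewrite C0// mulf_neq0 ?invr_eq0 ?psi_coef_neq0// expf_neq0// gt_eqF.
  rewrite mulf_neq0 ?outgoing_neq0// ?mulr_gt0// ?exprn_gt0//.
  rewrite oppr_eq0 mulf_neq0 ?invr_eq0 ?pnatr_eq0//.
  by rewrite eq_complex /= oner_eq0 andbF.
pose dot (l : int) (n : nat) : R[i] := (complex.Re (dotL2_disc r0 (phi r0 l n) (psi r0 k l)))%:C.
have fwd (l : int) (j : nat) (t : R) : forward r0 k (phi r0 l j) (of_polar Rout t) =
    gain l * dot l j * expi (l%:~R * t).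
  rewrite (forward_phi r0_gt0 k_gt0 (out t)) nsq_of_polar zc_of_polar zpowM zpowC expi_intM.
  by rewrite /gain /dot; ring.
have expand (s0 : plane R -> R[i]) (c0 : 'I_(M.*2.+1) -> 'I_N -> R[i]) (t : R) : inL2_disc r0 s0 ->
    eqL2_disc r0 s0 (fun x => \sum_(b < M.*2.+1) \sum_(n < N) c0 b n * phi r0 (b%:Z - M%:Z) n.+1 x) ->
    forward r0 k s0 (of_polar Rout t) = \sum_(b < M.*2.+1)
      (gain (b%:Z - M%:Z) * \sum_(n < N) c0 b n * dot (b%:Z - M%:Z) n.+1) * expi ((b%:Z - M%:Z)%:~R * t).
  move=> L E; rewrite (forward_source r0_gt0 k_gt0 (out t) L E); apply: eq_bigr => b0 _.
  by rewrite mulr_sumr mulr_suml; apply: eq_bigr => n0 _; rewrite fwd; ring.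
have := @trig_polynomial_eq0 R _ M (fun b0 : 'I_(M.*2.+1) =>
  gain (b0%:Z - M%:Z) * \sum_(n < N) (c b0 n - c' b0 n) * dot (b0%:Z - M%:Z) n.+1) _ b.
have H : {ae (@lebesgue_measure R), forall t : R, 0 <= t < 2 * pi ->
    \sum_(b0 < M.*2.+1) (gain (b0%:Z - M%:Z) * \sum_(n < N) (c b0 n - c' b0 n) * dot (b0%:Z - M%:Z) n.+1)
      * expi ((b0%:Z - M%:Z)%:~R * t) = 0}.
  have := data _ _ mM iN; rewrite /eqL2_circle.
  have flt := @ae_filter_ringOfSetsType _ (measurableTypeR R) R (@lebesgue_measure R).
  apply: (@filterS _ _ flt) => t h /h; rewrite -/k (expand _ _ _ Ls sE) (expand _ _ _ Ls' sE').
  move=> /eqP; rewrite -subr_eq0 -sumrB => /eqP h0; rewrite -[RHS]h0; apply: eq_bigr => b0 _.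
  rewrite -mulrBl -mulrBr -sumrB; congr (_ * _ * _); apply: eq_bigr => n0 _.
  by rewrite mulrBl.
move=> /(_ H) /eqP; rewrite mulf_eq0 (negbTE (gain_neq0 _)) /= => /eqP h.
by rewrite -[RHS]h; apply: eq_bigr => n0 _; rewrite mxE.
Qed.

End Recovery.

Theorem theorem1 (R : realType) (R0 Rout : R) (M N : nat)
    (kt : nat -> nat -> R)
    (hR0 : 0 < R0) (hR : R0 < Rout) (hN : (1 <= N)%N)
    (hkt_pos : forall m i : nat, (m <= M)%N -> (1 <= i <= N)%N -> 0 < kt m i)
    (hkt : forall m i : nat, (m <= M)%N -> (1 <= i <= N)%N ->
       `| kt m i - wavenumber R0 m i | < Delta_k R0 M N) :
  Kmatrix R0 M N kt \in unitmx /\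
  forall s s' : plane R -> R[i],
    source_space R0 M N s -> source_space R0 M N s' ->
    (forall m i : nat, (m <= M)%N -> (1 <= i <= N)%N ->
       eqL2_circle Rout (forward R0 (kt m i) s) (forward R0 (kt m i) s')) ->
    eqL2_disc R0 s s'.
Proof.
by split=> [|s s']; [exact: Kmatrix_unitmx|exact: source_recovery].
Qed.
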